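(* Let $\Bbbk$ be a field of characteristic $0$. Let $\lambda,\mu$ be partitions and set $n=|\lambda|$ and $m=|\mu|$. Then there is an isomorphism of $\Bbbk$-vector spaces $$\operatorname{Ext}^1_{\mathcal{C}_{\mathrm{LieC}}\textbf{-}\mathrm{Mod}}(T(S_{\lambda}),T(S_{\mu}))\cong\begin{cases} S_{\mu}\otimes_{\Bbbk\mathfrak{S}_{m}}\mathcal{C}_{\mathrm{Lie}}(n,m)\otimes_{\Bbbk\mathfrak{S}_{n}}S_{\lambda} & \text{if } m=n-1,\\ S_{\mu}\otimes_{\Bbbk\mathfrak{S}_{m}}\mathrm{uB}(n,m)\otimes_{\Bbbk\mathfrak{S}_{n}}S_{\lambda} & \text{if } m=n+2,\\ 0 & \text{otherwise,}\end{cases}$$ where $S_{\mu}$ is considered as a right $\Bbbk\mathfrak{S}_{m}$-module. Moreover, $$\dim_{\Bbbk}\operatorname{Ext}^1_{\mathcal{C}_{\mathrm{LieC}}\textbf{-}\mathrm{Mod}}(T(S_{\lambda}),T(S_{\mu}))=\begin{cases}\sum_{\rho\vdash n-2}LR^{\lambda}_{\rho,1^2}\,LR^{\mu}_{\rho,1} & \text{if } m=n-1,\\ LR^{\mu}_{\lambda,2} & \text{if } m=n+2,\\ 0 & \text{otherwise.}\end{cases}$$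
   Context: $\Bbbk$ is a field of characteristic $0$. A $\Bbbk$-linear PROP is a $\Bbbk$-linear strict symmetric monoidal category whose objects are the non-negative integers with tensor product given on objects by addition; $P_{1,1}:2\to 2$ denotes its symmetry. For a $\Bbbk$-linear category $\mathcal{C}$, a $\mathcal{C}$-module is a $\Bbbk$-linear functor from $\mathcal{C}$ to the category of $\Bbbk$-vector spaces; $\mathcal{C}\textbf{-}\mathrm{Mod}$ is the abelian category of $\mathcal{C}$-modules, and $\operatorname{Ext}^1$ is taken in it. $\mathcal{C}_{\mathrm{Lie}}$ is the $\Bbbk$-linear PROP freely generated by a Lie algebra object $(L=1,[,]:2\to 1)$ (the bracket being antisymmetric and satisfying the Jacobi identity). Explicitly, $\mathcal{C}_{\mathrm{Lie}}(m,n)=\bigoplus_{f:\{1,\dots,m\}\twoheadrightarrow\{1,\dots,n\}}\bigotimes_{i=1}^n \mathcal{L}ie(|f^{-1}(i)|)$, where $\mathcal{L}ie$ is the Lie operad. $\mathcal{C}_{\mathrm{LieC}}$ is the $\Bbbk$-linear PROP for Casimir Lie algebras: it is generated by a Lie algebra object $(L=1,[,]:2\to 1)$ and a morphism $c:0\to 2$ (the Casimir element), subject to the Lie algebra relations and to $P_{1,1}c=c$ and $([,]\otimes \mathrm{id}_1)(\mathrm{id}_1\otimes c)=(\mathrm{id}_1\otimes[,])(c\otimes\mathrm{id}_1)$. It is $\mathbb{N}$-graded by the number of copies of $c$, and its degree $0$ part is $\mathcal{C}_{\mathrm{Lie}}$. The functor $T:\mathcal{C}_{\mathrm{Lie}}\textbf{-}\mathrm{Mod}\to\mathcal{C}_{\mathrm{LieC}}\textbf{-}\mathrm{Mod}$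 is precomposition with the projection $\mathcal{C}_{\mathrm{LieC}}\to\mathcal{C}_{\mathrm{Lie}}$ onto the degree $0$ part (killing all morphisms of positive degree). $\mathrm{uB}$ is the upward Brauer category: the $\Bbbk$-linear PROP whose hom-space $\mathrm{uB}(m,n)$ is spanned by the partitionings of $\{1^+,\dots,m^+\}\sqcup\{1^-,\dots,n^-\}$ into $(m+n)/2$ unordered pairs such that no pair consists of two positive elements (positive elements are inputs, negative elements are outputs; composition is by gluing diagrams). For each of these PROPs $\mathcal{C}$, $\mathcal{C}(n,m)$ is a $(\Bbbk\mathfrak{S}_m,\Bbbk\mathfrak{S}_n)$-bimodule via post- and precomposition with permutations. For a partition $\lambda\vdash d$, $S_\lambda=\Bbbk\mathfrak{S}_d\cdot c_\lambda$ ($c_\lambda$ the Young symmetrizer) is the Specht module, the irreducible left $\Bbbk\mathfrak{S}_d$-module attached to $\lambda$; it is regarded as a (simple) $\mathcal{C}_{\mathrm{Lie}}$-module concentrated at the object $d$, on which all morphisms other than those in $\Bbbk\mathfrak{S}_d=\mathcal{C}_{\mathrm{Lie}}(d,d)$ act by zero. Left modules over symmetric groups are viewed as right modules by inverting group elements. $|\lambda|$ denotes the size of $\lambda$, $\rho\vdash k$ means that $\rho$ is a partition of $k$ (the sum is empty if $k<0$), and $LR^{\nu}_{\alpha,\beta}$ is the Littlewood–Richardson coefficient, i.e. the multiplicity of $S_\nu$ in $\operatorname{Ind}_{\mathfrak{S}_{|\alpha|}\times\mathfrak{S}_{|\beta|}}^{\mathfrak{S}_{|\alpha|+|\beta|}}(S_\alpha\boxtimes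 S_\beta)$; in subscripts, $1^2=(1,1)$, $1=(1)$ and $2=(2)$. *)

(* Defs.v *)
From HB Require Import structures.
From mathcomp Require Import all_boot all_order all_fingroup all_algebra.
From mathcomp Require Import generic_quotient ring.
From mathcomp Require Import boolp classical_sets fsbigop.

Set Implicit Arguments.
Unset Strict Implicit.
Unset Printing Implicit Defensive.

Import GRing.Theory.
Local Open Scope ring_scope.
Local Open Scope quotient_scope.

(* Equality of elements of hom-sets H m n and H m' n' whose indices are only
   provably equal, as in the strict associativity of a PROP. *)
Inductive heq (H : nat -> nat -> Type) (m n : nat) (x : H m n) :
  forall m' n' : nat, H m' n' -> Prop := heq_refl : heq x x.

Lemma heq_eq (H : nat -> nat -> Type) m n (x y : H m n) : heq x y -> x = y.
Proof.
pose T := fun p : nat * nat => H p.1 p.2.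
have tag m' n' (z : H m' n') :
    heq x z -> existT T (m, n) x = existT T (m', n') z by case.
by move=> /tag; exact: (@eq_from_Tagged (nat * nat)%type T (m, n)).
Qed.

Lemma heq_sym (H : nat -> nat -> Type) m n m' n' (x : H m n) (y : H m' n') :
  heq x y -> heq y x.
Proof. by case. Qed.

Lemma heq_trans (H : nat -> nat -> Type) m n m' n' m'' n''
    (x : H m n) (y : H m' n') (z : H m'' n'') :
  heq x y -> heq y z -> heq x z.
Proof. by case. Qed.

(* The groupoid of bijections {0..m-1} -> {0..n-1}.  Its composition is that of
   functions, so that bij n n is the opposite of 'S_n, where s * t is s followed
   by t. *)
Definition is_bij m n (f : {ffun 'I_m -> 'I_n}) : bool :=
  injectiveb f && (m == n).

Definition bij m n := {f : {ffun 'I_m -> 'I_n} | is_bij f}.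
HB.instance Definition _ m n := Finite.on (bij m n).

Definition bij_fun m n (f : bij m n) : 'I_m -> 'I_n := val f.
Coercion bij_fun : bij >-> Funclass.

Lemma bij_inj m n (f : bij m n) : injective f.
Proof. by have /andP[/injectiveP] := valP f. Qed.

Lemma bij_dim m n (f : bij m n) : m = n.
Proof. by have /andP[_ /eqP] := valP f. Qed.

Lemma bijP m n (f g : bij m n) : f =1 g -> f = g.
Proof. by move=> fg; apply/val_inj/ffunP. Qed.

Lemma mk_bij_subproof m n (f : 'I_m -> 'I_n) :
  injective f -> m = n -> is_bij (finfun f).
Proof.
move=> fi mn; apply/andP; split; last exact/eqP.
by apply/injectiveP => x y; rewrite !ffunE => /fi.
Qed.

Definition mk_bij m n (f : 'I_m -> 'I_n) (fi : injective f) (mn : m = n) :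
  bij m n := exist _ (finfun f) (mk_bij_subproof fi mn).

Lemma mk_bijE m n (f : 'I_m -> 'I_n) (fi : injective f) (mn : m = n) :
  mk_bij fi mn =1 f.
Proof. by move=> x; rewrite /bij_fun /= ffunE. Qed.

Lemma bij_heq m n m' n' (f : bij m n) (g : bij m' n') :
  m = m' -> n = n' ->
  (forall (i : 'I_m) (j : 'I_m'), i = j :> nat -> f i = g j :> nat) ->
  heq f g.
Proof.
move=> em en; move: f g; rewrite -em -en => f g fg.
by rewrite (_ : f = g) //; apply: bijP => i; apply/val_inj/fg.
Qed.

Definition bij1 n : bij n n := mk_bij (@inj_id 'I_n) erefl.

Definition bij_comp m n p (g : bij n p) (f : bij m n) : bij m p :=
  mk_bij (inj_comp (@bij_inj _ _ g) (@bij_inj _ _ f))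
         (etrans (bij_dim f) (bij_dim g)).

Definition perm_bij n (s : 'S_n) : bij n n := mk_bij (@perm_inj _ s) erefl.

Definition sum_fun m n m' n' (f : 'I_m -> 'I_n) (g : 'I_m' -> 'I_n') :
    'I_(m + m') -> 'I_(n + n') := fun i =>
  match split i with
  | inl i1 => lshift n' (f i1)
  | inr i2 => rshift n (g i2)
  end.

Lemma sum_funl m n m' n' (f : 'I_m -> 'I_n) (g : 'I_m' -> 'I_n') i :
  sum_fun f g (lshift m' i) = lshift n' (f i).
Proof. by rewrite /sum_fun (unsplitK (inl i)). Qed.

Lemma sum_funr m n m' n' (f : 'I_m -> 'I_n) (g : 'I_m' -> 'I_n') i :
  sum_fun f g (rshift m i) = rshift n (g i).
Proof. by rewrite /sum_fun (unsplitK (inr i)). Qed.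

Lemma ord_splitP m n (P : 'I_(m + n) -> Prop) :
  (forall i, P (lshift n i)) -> (forall i, P (rshift m i)) -> forall i, P i.
Proof. by move=> Pl Pr i; rewrite -(splitK i); case: (split i). Qed.

Lemma sum_fun_inj m n m' n' (f : bij m n) (g : bij m' n') :
  injective (sum_fun f g).
Proof.
apply: ord_splitP => i; apply: ord_splitP => j; rewrite ?sum_funl ?sum_funr.
- by move/lshift_inj/bij_inj->.
- by move/eqP; rewrite eq_lrshift.
- by move/eqP; rewrite eq_rlshift.
- by move/rshift_inj/bij_inj->.
Qed.

Definition bij_sum m n m' n' (f : bij m n) (g : bij m' n') :
    bij (m + m') (n + n') :=
  mk_bij (@sum_fun_inj _ _ _ _ f g) (f_equal2 addn (bij_dim f) (bij_dim g)).

(* The block transposition underlying the symmetry m + n -> n + m. *)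
Definition swap_fun m n (i : 'I_(m + n)) : 'I_(n + m) :=
  match split i with
  | inl i1 => rshift n i1
  | inr i2 => lshift m i2
  end.

Lemma swap_funl m n i : swap_fun (lshift n i) = rshift n i :> 'I_(n + m).
Proof. by rewrite /swap_fun (unsplitK (inl i)). Qed.

Lemma swap_funr m n i : swap_fun (rshift m i) = lshift m i :> 'I_(n + m).
Proof. by rewrite /swap_fun (unsplitK (inr i)). Qed.

Lemma swap_fun_inj m n : injective (@swap_fun m n).
Proof.
apply: ord_splitP => i; apply: ord_splitP => j; rewrite ?swap_funl ?swap_funr.
- by move/rshift_inj->.
- by move/eqP; rewrite eq_rlshift.
- by move/eqP; rewrite eq_lrshift.
- by move/lshift_inj->.
Qed.

Definition swap m n : bij (m + n) (n + m) :=
  mk_bij (@swap_fun_inj m n) (addnC m n).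

Lemma bij_compE m n p (g : bij n p) (f : bij m n) i : bij_comp g f i = g (f i).
Proof. exact: mk_bijE. Qed.

Lemma bij1E n i : bij1 n i = i.
Proof. exact: mk_bijE. Qed.

Lemma bij_suml m n m' n' (f : bij m n) (g : bij m' n') i :
  bij_sum f g (lshift m' i) = lshift n' (f i).
Proof. by rewrite mk_bijE sum_funl. Qed.

Lemma bij_sumr m n m' n' (f : bij m n) (g : bij m' n') i :
  bij_sum f g (rshift m i) = rshift n (g i).
Proof. by rewrite mk_bijE sum_funr. Qed.

Lemma swapl m n i : swap m n (lshift n i) = rshift n i.
Proof. by rewrite mk_bijE swap_funl. Qed.

Lemma swapr m n i : swap m n (rshift m i) = lshift m i.
Proof. by rewrite mk_bijE swap_funr. Qed.

Lemma bij_codom m n (f : bij m n) (j : 'I_n) : j \in codom f.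
Proof.
by apply: inj_card_onto; [exact: bij_inj | rewrite !card_ord (bij_dim f)].
Qed.

Definition bij_invf m n (f : bij m n) (j : 'I_n) : 'I_m := iinv (bij_codom f j).

Lemma bij_invfK m n (f : bij m n) : cancel (bij_invf f) f.
Proof. by move=> j; rewrite /bij_invf f_iinv. Qed.

Lemma bij_funK m n (f : bij m n) : cancel f (bij_invf f).
Proof. by move=> i; apply: (@bij_inj _ _ f); rewrite bij_invfK. Qed.

Lemma bij_invE m n (f : bij m n) i j : f i = j -> bij_invf f j = i.
Proof. by move<-; rewrite bij_funK. Qed.

(* A PROP in finite sets: a strict symmetric monoidal category with objects nat
   and finite hom-sets.  The symmetric structure is given, following Mac Lane,
   by all the permutations at once: fp_bij is a strict monoidal functor on the
   groupoid of bijections, and the image of swap m n is the symmetry P_(m,n).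
   Conversely the symmetries determine fp_bij, since permutations are composites
   of maps id + swap 1 1 + id. *)
Record finprop := FinProp {
  fp_hom : nat -> nat -> finType;
  fp_comp : forall m n p, fp_hom n p -> fp_hom m n -> fp_hom m p;
  fp_tens : forall m n m' n',
    fp_hom m n -> fp_hom m' n' -> fp_hom (m + m') (n + n');
  fp_bij : forall m n, bij m n -> fp_hom m n;
  fp_compA : forall m n p q (h : fp_hom p q) (g : fp_hom n p) (f : fp_hom m n),
    fp_comp h (fp_comp g f) = fp_comp (fp_comp h g) f;
  fp_comp1l : forall m n (f : fp_hom m n), fp_comp (fp_bij (bij1 n)) f = f;
  fp_comp1r : forall m n (f : fp_hom m n), fp_comp f (fp_bij (bij1 m)) = f;
  fp_bij_comp : forall m n p (g : bij n p) (f : bij m n),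
    fp_bij (bij_comp g f) = fp_comp (fp_bij g) (fp_bij f);
  fp_bij_sum : forall m n m' n' (f : bij m n) (g : bij m' n'),
    fp_bij (bij_sum f g) = fp_tens (fp_bij f) (fp_bij g);
  fp_interchange : forall m n p m' n' p' (g : fp_hom n p) (f : fp_hom m n)
      (g' : fp_hom n' p') (f' : fp_hom m' n'),
    fp_tens (fp_comp g f) (fp_comp g' f')
    = fp_comp (fp_tens g g') (fp_tens f f');
  fp_tensA : forall m n m' n' m'' n''
      (f : fp_hom m n) (g : fp_hom m' n') (h : fp_hom m'' n''),
    heq (H := fp_hom) (fp_tens (fp_tens f g) h) (fp_tens f (fp_tens g h));
  fp_tens0l : forall m n (f : fp_hom m n), fp_tens (fp_bij (bij1 0)) f = f;
  fp_tens0r : forall m n (f : fp_hom m n),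
    heq (H := fp_hom) (fp_tens f (fp_bij (bij1 0))) f;
  fp_swap : forall m n m' n' (f : fp_hom m n) (g : fp_hom m' n'),
    fp_comp (fp_bij (swap n n')) (fp_tens f g)
    = fp_comp (fp_tens g f) (fp_bij (swap m m'))
}.

Lemma bij_sumA m n m' n' m'' n''
    (f : bij m n) (g : bij m' n') (h : bij m'' n'') :
  heq (bij_sum (bij_sum f g) h) (bij_sum f (bij_sum g h)).
Proof.
apply: bij_heq; [exact/esym/addnA | exact/esym/addnA |].
apply: ord_splitP => [|k]; first apply: ord_splitP => k.
- move=> j /= ej; have -> : j = lshift _ k by apply/val_inj.
  by rewrite !bij_suml.
- move=> j /= ej; have -> : j = rshift _ (lshift _ k) by apply/val_inj.
  by rewrite !(bij_suml, bij_sumr).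
- move=> j /= ej; have -> : j = rshift _ (rshift _ k).
    by apply/val_inj; rewrite /= -ej addnA.
  by rewrite !bij_sumr /= addnA.
Qed.

Lemma bij_sum0l m n (f : bij m n) : bij_sum (bij1 0) f = f.
Proof.
apply: bijP; apply: (@ord_splitP 0) => [[]//|i]; rewrite bij_sumr.
by apply/val_inj; rewrite /=; congr (nat_of_ord (f _)); apply/val_inj.
Qed.

Lemma bij_sum0r m n (f : bij m n) : heq (bij_sum f (bij1 0)) f.
Proof.
apply: bij_heq; rewrite ?addn0 //.
apply: ord_splitP => [k|[]//] j /= ej; rewrite bij_suml /=.
by congr (nat_of_ord (f _)); apply/val_inj.
Qed.

Definition bij_prop : finprop.
Proof.
refine (@FinProp (fun m n => bij m n) bij_comp bij_sum
  (fun _ _ f => f) _ _ _ _ _ _ bij_sumA bij_sum0l bij_sum0r _) => //.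
- by move=> *; apply: bijP => i; rewrite !bij_compE.
- by move=> *; apply: bijP => i; rewrite !(bij_compE, bij1E).
- by move=> *; apply: bijP => i; rewrite !(bij_compE, bij1E).
- move=> *; apply: bijP; apply: ord_splitP => i;
  by rewrite !(bij_compE, bij_suml, bij_sumr).
- move=> *; apply: bijP; apply: ord_splitP => i;
  by rewrite !(bij_compE, bij_suml, bij_sumr, swapl, swapr).
Defined.

(* Upward Brauer diagrams m -> n.  A partition of the set of inputs (inl) and
   outputs (inr) into unordered pairs is encoded as the fixed-point-free
   involution exchanging the two elements of each pair. *)
Definition is_ubrauer m n (s : {ffun 'I_m + 'I_n -> 'I_m + 'I_n}) : bool :=
  [forall x, (s (s x) == x) && (s x != x)]
  && [forall i, if s (inl i) is inl _ then false else true].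

Definition ubrauer m n := {s : {ffun 'I_m + 'I_n -> 'I_m + 'I_n} | is_ubrauer s}.
HB.instance Definition _ m n := Finite.on (ubrauer m n).

Definition ub_fun m n (s : ubrauer m n) : 'I_m + 'I_n -> 'I_m + 'I_n := val s.
Coercion ub_fun : ubrauer >-> Funclass.

Lemma ubK m n (s : ubrauer m n) : involutive s.
Proof. by have /andP[/forallP sP _] := valP s => x; case/andP: (sP x) => /eqP. Qed.

Lemma ub_neq m n (s : ubrauer m n) x : s x <> x.
Proof. by have /andP[/forallP sP _] := valP s; case/andP: (sP x) => _ /eqP. Qed.

Lemma ub_inl m n (s : ubrauer m n) i : exists j, s (inl i) == inr j.
Proof.
have /andP[_ /forallP sP] := valP s; have := sP i.
by rewrite /ub_fun; case: (val s _) => // j _; exists j.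
Qed.

Lemma mk_ub_subproof m n (s : 'I_m + 'I_n -> 'I_m + 'I_n) :
  involutive s -> (forall x, s x <> x) -> (forall i, exists j, s (inl i) == inr j) ->
  is_ubrauer (finfun s).
Proof.
move=> sK sN sI; apply/andP; split; apply/forallP => x; rewrite !ffunE.
  by rewrite sK eqxx; apply/eqP.
by have [j /eqP->] := sI x.
Qed.

Definition mk_ub m n s sK sN sI : ubrauer m n :=
  exist _ (finfun s) (@mk_ub_subproof m n s sK sN sI).

Lemma mk_ubE m n (s : 'I_m + 'I_n -> 'I_m + 'I_n) sK sN sI x :
  @mk_ub m n s sK sN sI x = s x.
Proof. by rewrite /ub_fun /= ffunE. Qed.

Lemma ubP m n (s t : ubrauer m n) : s =1 t -> s = t.
Proof. by move=> st; apply/val_inj/ffunP. Qed.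

Definition ub_out m n (s : ubrauer m n) (i : 'I_m) : 'I_n :=
  xchoose (ub_inl s i).

Lemma ub_outE m n (s : ubrauer m n) i : s (inl i) = inr (ub_out s i).
Proof. exact/eqP/(xchooseP (ub_inl s i)). Qed.

Lemma ub_outK m n (s : ubrauer m n) i : s (inr (ub_out s i)) = inl i.
Proof. by rewrite -ub_outE ubK. Qed.

Lemma ub_out_inj m n (s : ubrauer m n) : injective (ub_out s).
Proof. by move=> i j ij; have := ub_outK s i; rewrite ij ub_outK => -[]. Qed.

Lemma ub_out_eq m n (s : ubrauer m n) i j : s (inl i) = inr j -> ub_out s i = j.
Proof. by rewrite ub_outE => -[]. Qed.

(* Gluing t after s: strands are followed through the middle row, which is the
   output row of s and the input row of t. *)
Definition ub_comp_fun m n p (t : ubrauer n p) (s : ubrauer m n)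
    (x : 'I_m + 'I_p) : 'I_m + 'I_p :=
  match x with
  | inl i => inr (ub_out t (ub_out s i))
  | inr l =>
    match t (inr l) with
    | inr l' => inr l'
    | inl j =>
      match s (inr j) with
      | inl i => inl i
      | inr j' => inr (ub_out t j')
      end
    end
  end.

Definition ub_lift m n p (t : ubrauer n p) (x : 'I_m + 'I_n) : 'I_m + 'I_p :=
  match x with inl i => inl i | inr j => inr (ub_out t j) end.

Lemma ub_lift_inj m n p (t : ubrauer n p) : injective (@ub_lift m n p t).
Proof. by move=> [i|i] [j|j] //= [] => [->|/ub_out_inj->]. Qed.

Lemma ub_lift_ind m n p (t : ubrauer n p) (P : 'I_m + 'I_p -> Prop) :
  (forall y, P (ub_lift t y)) ->
  (forall l l', t (inr l) = inr l' -> P (inr l)) -> forall x, P x.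
Proof.
move=> P1 P2 [i|l]; first exact: (P1 (inl i)).
case e: (t (inr l)) => [j|l']; last exact: P2 e.
by have := P1 (inr j); rewrite /= (@ub_out_eq _ _ _ _ l) // -e ubK.
Qed.

Lemma ub_comp_fun_lift m n p (t : ubrauer n p) (s : ubrauer m n) y :
  ub_comp_fun t s (ub_lift t y) = ub_lift t (s y).
Proof.
case: y => [i|j] /=; first by rewrite ub_outE.
by rewrite ub_outK; case: (s (inr j)).
Qed.

Lemma ub_comp_fun_top m n p (t : ubrauer n p) (s : ubrauer m n) l l' :
  t (inr l) = inr l' -> ub_comp_fun t s (inr l) = inr l'.
Proof. by move=> /= ->. Qed.

Definition ub_comp m n p (t : ubrauer n p) (s : ubrauer m n) : ubrauer m p.
Proof.
refine (@mk_ub m p (ub_comp_fun t s) _ _ _).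
- apply: (ub_lift_ind (t := t)) => [y|l l' e].
    by rewrite !ub_comp_fun_lift ubK.
  by rewrite !(@ub_comp_fun_top _ _ _ _ _ _ _ e) (@ub_comp_fun_top _ _ _ _ _ _ l) // -e ubK.
- apply: (ub_lift_ind (t := t)) => [y|l l' e].
    by rewrite ub_comp_fun_lift => /ub_lift_inj/ub_neq.
  rewrite (@ub_comp_fun_top _ _ _ _ _ _ _ e) => -[ll].
  by apply: (@ub_neq _ _ t (inr l)); rewrite e ll.
- by move=> i; exists (ub_out t (ub_out s i)).
Defined.

Lemma ub_comp_lift m n p (t : ubrauer n p) (s : ubrauer m n) y :
  ub_comp t s (ub_lift t y) = ub_lift t (s y).
Proof. by rewrite mk_ubE ub_comp_fun_lift. Qed.

Lemma ub_comp_top m n p (t : ubrauer n p) (s : ubrauer m n) l l' :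
  t (inr l) = inr l' -> ub_comp t s (inr l) = inr l'.
Proof. by rewrite mk_ubE; exact: ub_comp_fun_top. Qed.

Lemma ub_comp_out m n p (t : ubrauer n p) (s : ubrauer m n) i :
  ub_out (ub_comp t s) i = ub_out t (ub_out s i).
Proof. by apply: ub_out_eq; rewrite mk_ubE. Qed.

Lemma ub_lift_comp m n p q (u : ubrauer p q) (t : ubrauer n p) (y : 'I_m + 'I_n) :
  ub_lift (ub_comp u t) y = ub_lift u (ub_lift t y).
Proof. by case: y => //= j; rewrite ub_comp_out. Qed.

Lemma ub_compA m n p q (u : ubrauer p q) (t : ubrauer n p) (s : ubrauer m n) :
  ub_comp u (ub_comp t s) = ub_comp (ub_comp u t) s.
Proof.
apply: ubP; apply: (ub_lift_ind (t := u)) => [|l l' e].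
  apply: (ub_lift_ind (t := t)) => [y|l l' e].
    by rewrite !ub_comp_lift -!ub_lift_comp ub_comp_lift.
  rewrite ub_comp_lift (ub_comp_top _ e) /= (@ub_comp_top _ _ _ _ _ _ (ub_out u l')) //.
  exact: etrans (ub_comp_lift u t (inr l)) (congr1 (ub_lift u) e).
by rewrite !(@ub_comp_top _ _ _ _ _ _ l') // (ub_comp_top _ e).
Qed.

Definition ub_bij_fun m n (f : bij m n) (x : 'I_m + 'I_n) : 'I_m + 'I_n :=
  match x with inl i => inr (f i) | inr j => inl (bij_invf f j) end.

Definition ub_bij m n (f : bij m n) : ubrauer m n.
Proof.
refine (@mk_ub m n (ub_bij_fun f) _ _ _).
- by move=> [i|j] /=; rewrite ?bij_funK ?bij_invfK.
- by move=> [i|j].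
- by move=> i; exists (f i).
Defined.

Lemma ub_bij_out m n (f : bij m n) : ub_out (ub_bij f) =1 f.
Proof. by move=> i; apply: ub_out_eq; rewrite mk_ubE. Qed.

Lemma ub_bij_ind m n p (f : bij n p) (P : 'I_m + 'I_p -> Prop) :
  (forall y, P (ub_lift (ub_bij f) y)) -> forall x, P x.
Proof.
by move=> P1; apply: (ub_lift_ind P1) => l l'; rewrite mk_ubE.
Qed.

Lemma ub_comp1l m n (s : ubrauer m n) : ub_comp (ub_bij (bij1 n)) s = s.
Proof.
have e (x : 'I_m + 'I_n) : ub_lift (ub_bij (bij1 n)) x = x.
  by case: x => //= j; rewrite ub_bij_out bij1E.
apply: ubP => x; have := ub_comp_lift (ub_bij (bij1 n)) s x.
by rewrite !e.
Qed.

Lemma ub_comp1r m n (s : ubrauer m n) : ub_comp s (ub_bij (bij1 m)) = s.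
Proof.
apply: ubP; apply: (ub_lift_ind (t := s)) => [y|l l' e]; last first.
  by rewrite (ub_comp_top _ e) e.
rewrite ub_comp_lift; case: y => i; rewrite !mk_ubE /=.
  by rewrite bij1E ub_outE.
by rewrite ub_outK (bij_invE (bij1E i)).
Qed.

Lemma ub_bij_comp m n p (g : bij n p) (f : bij m n) :
  ub_bij (bij_comp g f) = ub_comp (ub_bij g) (ub_bij f).
Proof.
apply: ubP; apply: (ub_bij_ind (f := g)) => y; rewrite ub_comp_lift.
case: y => i; rewrite !mk_ubE /= ub_bij_out ?bij_compE //.
by congr inl; apply: bij_invE; rewrite bij_compE bij_invfK.
Qed.

Definition ub_inL m n m' n' (x : 'I_m + 'I_n) : 'I_(m + m') + 'I_(n + n') :=
  match x with inl i => inl (lshift m' i) | inr j => inr (lshift n' j) end.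

Definition ub_inR m n m' n' (x : 'I_m' + 'I_n') : 'I_(m + m') + 'I_(n + n') :=
  match x with inl i => inl (rshift m i) | inr j => inr (rshift n j) end.

Definition ub_tens_fun m n m' n' (s : ubrauer m n) (t : ubrauer m' n')
    (x : 'I_(m + m') + 'I_(n + n')) : 'I_(m + m') + 'I_(n + n') :=
  match x with
  | inl i => match split i with
             | inl i1 => ub_inL m' n' (s (inl i1))
             | inr i2 => ub_inR m n (t (inl i2))
             end
  | inr j => match split j with
             | inl j1 => ub_inL m' n' (s (inr j1))
             | inr j2 => ub_inR m n (t (inr j2))
             end
  end.

Lemma ub_in_ind m n m' n' (P : 'I_(m + m') + 'I_(n + n') -> Prop) :
  (forall x, P (ub_inL m' n' x)) -> (forall x, P (ub_inR m n x)) -> forall x, P x.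
Proof.
move=> Pl Pr [] i.
  by move: i; apply: ord_splitP => i; [apply: (Pl (inl i)) | apply: (Pr (inl i))].
by move: i; apply: ord_splitP => i; [apply: (Pl (inr i)) | apply: (Pr (inr i))].
Qed.

Lemma ub_tens_funL m n m' n' (s : ubrauer m n) (t : ubrauer m' n') x :
  ub_tens_fun s t (ub_inL m' n' x) = ub_inL m' n' (s x).
Proof. by case: x => i /=; rewrite (unsplitK (inl i)). Qed.

Lemma ub_tens_funR m n m' n' (s : ubrauer m n) (t : ubrauer m' n') x :
  ub_tens_fun s t (ub_inR m n x) = ub_inR m n (t x).
Proof. by case: x => i /=; rewrite (unsplitK (inr i)). Qed.

Lemma ub_inL_inj m n m' n' : injective (@ub_inL m n m' n').
Proof. by move=> [i|i] [j|j] //= [] => /val_inj->. Qed.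

Lemma ub_inR_inj m n m' n' : injective (@ub_inR m n m' n').
Proof. by move=> [i|i] [j|j] //= [] => /addnI/val_inj->. Qed.

Definition ub_tens m n m' n' (s : ubrauer m n) (t : ubrauer m' n') :
  ubrauer (m + m') (n + n').
Proof.
refine (@mk_ub _ _ (ub_tens_fun s t) _ _ _).
- by apply: ub_in_ind => x; rewrite !(ub_tens_funL, ub_tens_funR) ubK.
- apply: ub_in_ind => x; rewrite !(ub_tens_funL, ub_tens_funR).
    by move/ub_inL_inj/ub_neq.
  by move/ub_inR_inj/ub_neq.
- apply: ord_splitP => i.
    exists (lshift n' (ub_out s i)).
    by rewrite (ub_tens_funL s t (inl i)) ub_outE.
  exists (rshift n (ub_out t i)).
  by rewrite (ub_tens_funR s t (inl i)) ub_outE.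
Defined.

Section UbTens.
Variables (m n m' n' : nat) (s : ubrauer m n) (t : ubrauer m' n').

Lemma ub_tensL x : ub_tens s t (ub_inL m' n' x) = ub_inL m' n' (s x).
Proof. by rewrite mk_ubE ub_tens_funL. Qed.

Lemma ub_tensR x : ub_tens s t (ub_inR m n x) = ub_inR m n (t x).
Proof. by rewrite mk_ubE ub_tens_funR. Qed.

Lemma ub_tens_outL i : ub_out (ub_tens s t) (lshift m' i) = lshift n' (ub_out s i).
Proof. by apply: ub_out_eq; rewrite (ub_tensL (inl i)) ub_outE. Qed.

Lemma ub_tens_outR i : ub_out (ub_tens s t) (rshift m i) = rshift n (ub_out t i).
Proof. by apply: ub_out_eq; rewrite (ub_tensR (inl i)) ub_outE. Qed.

Lemma ub_lift_tensL m0 m0' (x : 'I_m0 + 'I_m) :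
  ub_lift (ub_tens s t) (ub_inL m0' m' x) = ub_inL m0' n' (ub_lift s x).
Proof. by case: x => //= i; rewrite ub_tens_outL. Qed.

Lemma ub_lift_tensR m0 m0' (x : 'I_m0' + 'I_m') :
  ub_lift (ub_tens s t) (ub_inR m0 m x) = ub_inR m0 n (ub_lift t x).
Proof. by case: x => //= i; rewrite ub_tens_outR. Qed.

End UbTens.

Lemma ub_interchange m n p m' n' p' (g : ubrauer n p) (f : ubrauer m n)
    (g' : ubrauer n' p') (f' : ubrauer m' n') :
  ub_tens (ub_comp g f) (ub_comp g' f') = ub_comp (ub_tens g g') (ub_tens f f').
Proof.
apply: ubP; apply: ub_in_ind.
- apply: (ub_lift_ind (t := g)) => [y|l l' e].
    by rewrite ub_tensL ub_comp_lift -!(ub_lift_tensL g g') ub_comp_lift ub_tensL.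
  rewrite ub_tensL (ub_comp_top _ e); apply/esym/ub_comp_top.
  by rewrite (ub_tensL _ _ (inr l)) e.
- apply: (ub_lift_ind (t := g')) => [y|l l' e].
    by rewrite ub_tensR ub_comp_lift -!(ub_lift_tensR g g') ub_comp_lift ub_tensR.
  rewrite ub_tensR (ub_comp_top _ e); apply/esym/ub_comp_top.
  by rewrite (ub_tensR _ _ (inr l)) e.
Qed.

Lemma ub_bij_sum m n m' n' (f : bij m n) (g : bij m' n') :
  ub_bij (bij_sum f g) = ub_tens (ub_bij f) (ub_bij g).
Proof.
apply: ubP; apply: ub_in_ind => x; rewrite ?(ub_tensL, ub_tensR);
  case: x => i; rewrite !mk_ubE /= ?bij_suml ?bij_sumr //.
- by congr inl; apply: bij_invE; rewrite bij_suml bij_invfK.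
- by congr inl; apply: bij_invE; rewrite bij_sumr bij_invfK.
Qed.

(* Precomposing s with a bijection relabels its inputs. *)
Definition ub_relabel m n p (f : bij m n) (x : 'I_n + 'I_p) : 'I_m + 'I_p :=
  match x with inl j => inl (bij_invf f j) | inr l => inr l end.

Lemma ub_comp_relabel m n p (s : ubrauer n p) (f : bij m n) x :
  ub_comp s (ub_bij f) (ub_relabel f x) = ub_relabel f (s x).
Proof.
rewrite mk_ubE; case: x => [j|l] /=.
  by rewrite ub_bij_out bij_invfK ub_outE.
by case: (s (inr l)) => //= j; rewrite mk_ubE.
Qed.

Lemma ub_swap m n m' n' (f : ubrauer m n) (g : ubrauer m' n') :
  ub_comp (ub_bij (swap n n')) (ub_tens f g)
  = ub_comp (ub_tens g f) (ub_bij (swap m m')).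
Proof.
have sL (y : 'I_m + 'I_n) : ub_lift (ub_bij (swap n n')) (ub_inL m' n' y)
    = ub_relabel (swap m m') (ub_inR m' n' y).
  case: y => i /=; first by rewrite (bij_invE (swapl _ _)).
  by rewrite ub_bij_out swapl.
have sR (y : 'I_m' + 'I_n') : ub_lift (ub_bij (swap n n')) (ub_inR m n y)
    = ub_relabel (swap m m') (ub_inL m n y).
  case: y => i /=; first by rewrite (bij_invE (swapr _ _)).
  by rewrite ub_bij_out swapr.
apply: ubP; apply: (ub_bij_ind (f := swap n n')); apply: ub_in_ind => y.
  by rewrite ub_comp_lift ub_tensL !sL ub_comp_relabel ub_tensR.
by rewrite ub_comp_lift ub_tensR !sR ub_comp_relabel ub_tensL.
Qed.

Definition ub_code m n (x : 'I_m + 'I_n) : nat + nat :=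
  match x with inl i => inl (nat_of_ord i) | inr j => inr (nat_of_ord j) end.

Definition ub_shift m n (x : nat + nat) : nat + nat :=
  match x with inl i => inl (m + i)%N | inr j => inr (n + j)%N end.

Lemma ub_code_inj m n : injective (@ub_code m n).
Proof. by move=> [i|i] [j|j] //= [] => /val_inj->. Qed.

Lemma ub_codeL m n m' n' (x : 'I_m + 'I_n) : ub_code (ub_inL m' n' x) = ub_code x.
Proof. by case: x. Qed.

Lemma ub_codeR m n m' n' (x : 'I_m' + 'I_n') :
  ub_code (ub_inR m n x) = ub_shift m n (ub_code x).
Proof. by case: x. Qed.

Lemma ub_heq m n m' n' (s : ubrauer m n) (t : ubrauer m' n') :
  m = m' -> n = n' ->
  (forall x y, ub_code x = ub_code y -> ub_code (s x) = ub_code (t y)) ->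
  heq s t.
Proof.
move=> em en; move: s t; rewrite -em -en => s t st.
by rewrite (_ : s = t) //; apply: ubP => x; apply/ub_code_inj/st.
Qed.

Lemma ub_tensA m n m' n' m'' n''
    (f : ubrauer m n) (g : ubrauer m' n') (h : ubrauer m'' n'') :
  heq (ub_tens (ub_tens f g) h) (ub_tens f (ub_tens g h)).
Proof.
apply: ub_heq; [exact/esym/addnA | exact/esym/addnA |].
have sA x : ub_shift (m + m') (n + n') x = ub_shift m n (ub_shift m' n' x).
  by case: x => i /=; rewrite addnA.
apply: ub_in_ind => [|x]; first apply: ub_in_ind => x.
- move=> y ey; have -> : y = ub_inL _ _ x.
    by apply: ub_code_inj; rewrite -ey !ub_codeL.
  by rewrite !ub_tensL !ub_codeL.
- move=> y ey; have -> : y = ub_inR _ _ (ub_inL _ _ x).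
    by apply: ub_code_inj; rewrite -ey !(ub_codeL, ub_codeR).
  by rewrite !(ub_tensL, ub_tensR) !(ub_codeL, ub_codeR).
- move=> y ey; have -> : y = ub_inR _ _ (ub_inR _ _ x).
    by apply: ub_code_inj; rewrite -ey !ub_codeR sA.
  by rewrite !ub_tensR !ub_codeR sA.
Qed.

Lemma ub_tens0l m n (f : ubrauer m n) : ub_tens (ub_bij (bij1 0)) f = f.
Proof.
have e (x : 'I_m + 'I_n) : ub_inR 0 0 x = x.
  by apply: ub_code_inj; rewrite ub_codeR; case: x.
by apply: ubP => x; have := ub_tensR (ub_bij (bij1 0)) f x; rewrite !e.
Qed.

Lemma ub_tens0r m n (f : ubrauer m n) : heq (ub_tens f (ub_bij (bij1 0))) f.
Proof.
apply: ub_heq; rewrite ?addn0 //; apply: ub_in_ind => [x|[[]|[]]//] y ey.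
have -> : y = x by apply: ub_code_inj; rewrite -ey ub_codeL.
by rewrite ub_tensL ub_codeL.
Qed.

Definition ubrauer_prop : finprop :=
  @FinProp (fun m n => ubrauer m n) ub_comp ub_tens ub_bij ub_compA ub_comp1l
    ub_comp1r ub_bij_comp ub_bij_sum ub_interchange ub_tensA ub_tens0l
    ub_tens0r ub_swap.

(* A k-linear PROP, with the same presentation of the symmetry as in finprop. *)
Record lprop (k : fieldType) := LProp {
  hom : nat -> nat -> lmodType k;
  hcomp : forall m n p, hom n p -> hom m n -> hom m p;
  htens : forall m n m' n', hom m n -> hom m' n' -> hom (m + m') (n + n');
  hbij : forall m n, bij m n -> hom m n;
  hcomp_linl : forall m n p (f : hom m n), linear (fun g : hom n p => hcomp g f);
  hcomp_linr : forall m n p (g : hom n p), linear (fun f : hom m n => hcomp g f);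
  htens_linl : forall m n m' n' (g : hom m' n'),
    linear (fun f : hom m n => htens f g);
  htens_linr : forall m n m' n' (f : hom m n),
    linear (fun g : hom m' n' => htens f g);
  hcompA : forall m n p q (h : hom p q) (g : hom n p) (f : hom m n),
    hcomp h (hcomp g f) = hcomp (hcomp h g) f;
  hcomp1l : forall m n (f : hom m n), hcomp (hbij (bij1 n)) f = f;
  hcomp1r : forall m n (f : hom m n), hcomp f (hbij (bij1 m)) = f;
  hbij_comp : forall m n p (g : bij n p) (f : bij m n),
    hbij (bij_comp g f) = hcomp (hbij g) (hbij f);
  hbij_sum : forall m n m' n' (f : bij m n) (g : bij m' n'),
    hbij (bij_sum f g) = htens (hbij f) (hbij g);
  hinterchange : forall m n p m' n' p' (g : hom n p) (f : hom m n)
      (g' : hom n' p') (f' : hom m' n'),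
    htens (hcomp g f) (hcomp g' f') = hcomp (htens g g') (htens f f');
  htensA : forall m n m' n' m'' n''
      (f : hom m n) (g : hom m' n') (h : hom m'' n''),
    heq (H := fun m n => hom m n) (htens (htens f g) h) (htens f (htens g h));
  htens0l : forall m n (f : hom m n), htens (hbij (bij1 0)) f = f;
  htens0r : forall m n (f : hom m n),
    heq (H := fun m n => hom m n) (htens f (hbij (bij1 0))) f;
  hbij_swap : forall m n m' n' (f : hom m n) (g : hom m' n'),
    hcomp (hbij (swap n n')) (htens f g) = hcomp (htens g f) (hbij (swap m m'))
}.

Definition hid k (P : lprop k) n : hom P n n := hbij P (bij1 n).
Definition hperm k (P : lprop k) n (s : 'S_n) : hom P n n := hbij P (perm_bij s).

Section BilinearExtension.
Variable k : fieldType.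

(* k[A], the vector space with basis A, and the bilinear extension of a map. *)
Definition fspan (A : finType) : lmodType k := {ffun A -> k^o}.
Definition fdelta (A : finType) (a : A) : fspan A := [ffun b => (b == a)%:R].

Definition bilext (A B C : finType) (op : A -> B -> C)
    (x : fspan A) (y : fspan B) : fspan C :=
  [ffun c => \sum_a \sum_b x a * y b * (op a b == c)%:R].

Lemma bilext_linl (A B C : finType) (op : A -> B -> C) (y : fspan B) :
  linear (fun x => bilext op x y).
Proof.
move=> c x x'; apply/ffunP => z; rewrite !ffunE scaler_sumr -big_split.
apply: eq_bigr => a _; rewrite scaler_sumr -big_split; apply: eq_bigr => b _.
by rewrite !ffunE !mulrDl /= -!mulrA.
Qed.

Lemma bilext_linr (A B C : finType) (op : A -> B -> C) (x : fspan A) :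
  linear (fun y => bilext op x y).
Proof.
move=> c y y'; apply/ffunP => z; rewrite !ffunE scaler_sumr -big_split.
apply: eq_bigr => a _; rewrite scaler_sumr -big_split; apply: eq_bigr => b _.
by rewrite !ffunE mulrDr mulrDl [x a * _]mulrCA -!mulrA.
Qed.

Lemma sum_delta (A : finType) (F : A -> k) a :
  \sum_b (a == b)%:R * F b = F a.
Proof.
rewrite (bigD1 a) //= eqxx mul1r big1 ?addr0 // => b.
by rewrite eq_sym => /negbTE->; rewrite mul0r.
Qed.

Lemma bilext_deltal (A B C : finType) (op : A -> B -> C) a (y : fspan B) c :
  bilext op (fdelta a) y c = \sum_b y b * (op a b == c)%:R.
Proof.
rewrite ffunE -(sum_delta (fun a => \sum_b y b * (op a b == c)%:R)).
apply: eq_bigr => a' _; rewrite big_distrr /=; apply: eq_bigr => b _.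
by rewrite ffunE eq_sym mulrA.
Qed.

Lemma bilext_deltar (A B C : finType) (op : A -> B -> C) (x : fspan A) b c :
  bilext op x (fdelta b) c = \sum_a x a * (op a b == c)%:R.
Proof.
rewrite ffunE; apply: eq_bigr => a _.
rewrite -(sum_delta (fun b => x a * (op a b == c)%:R)).
by apply: eq_bigr => b' _; rewrite ffunE eq_sym mulrCA mulrA.
Qed.

Lemma bilext_delta (A B C : finType) (op : A -> B -> C) a b :
  bilext op (fdelta a) (fdelta b) = fdelta (op a b).
Proof.
apply/ffunP => c; rewrite bilext_deltal ffunE eq_sym.
rewrite -(sum_delta (fun b => (op a b == c)%:R)); apply: eq_bigr => b' _.
by rewrite ffunE eq_sym.
Qed.

Lemma bilext3l (A B C D E : finType) (op1 : A -> B -> D) (op2 : D -> C -> E)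
    (x : fspan A) (y : fspan B) (z : fspan C) e :
  bilext op2 (bilext op1 x y) z e
  = \sum_a \sum_b \sum_c x a * y b * z c * (op2 (op1 a b) c == e)%:R.
Proof.
rewrite ffunE.
under eq_bigr => d _ do under eq_bigr => c _ do
  rewrite ffunE -mulrA big_distrl /=.
under eq_bigr => d _ do rewrite exchange_big /=.
rewrite exchange_big /=; apply: eq_bigr => a _.
under eq_bigr => d _ do under eq_bigr => c _ do rewrite big_distrl /=.
under eq_bigr => d _ do rewrite exchange_big /=.
rewrite exchange_big /=; apply: eq_bigr => b _.
rewrite exchange_big /=; apply: eq_bigr => c _.
rewrite -(sum_delta (fun d => x a * y b * z c * (op2 d c == e)%:R)).
by apply: eq_bigr => d _; ring.
Qed.

Lemma bilext3r (A B C D E : finType) (op1 : B -> C -> D) (op2 : A -> D -> E)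
    (x : fspan A) (y : fspan B) (z : fspan C) e :
  bilext op2 x (bilext op1 y z) e
  = \sum_a \sum_b \sum_c x a * y b * z c * (op2 a (op1 b c) == e)%:R.
Proof.
rewrite ffunE; apply: eq_bigr => a _.
under eq_bigr => d _ do rewrite ffunE mulrAC big_distrr /=.
rewrite exchange_big /=; apply: eq_bigr => b _.
under eq_bigr => d _ do rewrite big_distrr /=.
rewrite exchange_big /=; apply: eq_bigr => c _.
rewrite -(sum_delta (fun d => x a * y b * z c * (op2 a d == e)%:R)).
by apply: eq_bigr => d _; ring.
Qed.

Lemma fspan_ext (A : finType) (V : lmodType k) (F G : fspan A -> V) :
  linear F -> linear G -> (forall a, F (fdelta a) = G (fdelta a)) -> F =1 G.
Proof.
move=> linF linG FG x.
have Fsum r (H : fspan A -> V) : linear H ->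
    H (\sum_(a <- r) x a *: fdelta a) = \sum_(a <- r) x a *: H (fdelta a).
  move=> linH; elim: r => [|a r IH]; last by rewrite !big_cons linH IH.
  rewrite !big_nil; have := linH (-1) 0 0.
  by rewrite !scaleN1r oppr0 addr0 addNr.
have -> : x = \sum_(a <- enum A) x a *: fdelta a.
  apply/ffunP => b; rewrite sum_ffunE big_enum /= -[LHS](sum_delta x).
  by apply: eq_bigr => a _; rewrite !ffunE mulrC.
by rewrite !Fsum //; apply: eq_bigr => a _; rewrite FG.
Qed.

Lemma linear_fun0 (U V : lmodType k) (f : U -> V) : linear f -> f 0 = 0.
Proof.
by move=> lf; have := lf (-1) 0 0; rewrite !scaleN1r oppr0 addr0 addNr.
Qed.

Lemma linear_funD (U V : lmodType k) (f : U -> V) :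
  linear f -> {morph f : u v / u + v}.
Proof. by move=> lf u v; have := lf 1 u v; rewrite !scale1r. Qed.

Lemma linear_funZ (U V : lmodType k) (f : U -> V) :
  linear f -> forall a u, f (a *: u) = a *: f u.
Proof.
by move=> lf a u; rewrite -[a *: u]addr0 lf linear_fun0 // !addr0.
Qed.

Lemma linear_cmp (U V W : lmodType k) (f : V -> W) (g : U -> V) :
  linear f -> linear g -> linear (fun x => f (g x)).
Proof. by move=> lf lg a x y; rewrite lg lf. Qed.

Lemma bilext_heq (C : nat -> nat -> finType) (m n m' n' : nat)
    (x : fspan (C m n)) (y : fspan (C m' n')) :
  m = m' -> n = n' ->
  (forall (c : C m n) (c' : C m' n'), heq (H := C) c c' -> x c = y c') ->
  heq (H := fun m n => fspan (C m n)) x y.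
Proof.
move=> em en; move: x y; rewrite -em -en => x y xy.
by rewrite (_ : x = y) //; apply/ffunP => c; apply/xy/heq_refl.
Qed.

Lemma heq_eqb (C : nat -> nat -> finType) (m n m' n' : nat)
    (x c : C m n) (y c' : C m' n') :
  heq (H := C) x y -> heq (H := C) c c' -> (x == c) = (y == c').
Proof.
move=> xy cc; apply/eqP/eqP => [xc | yc].
  apply: (@heq_eq C); apply: heq_trans cc; apply: heq_sym.
  by rewrite -xc.
apply: (@heq_eq C); apply: heq_trans (heq_sym cc).
by rewrite -yc.
Qed.

Variable P : finprop.
Let H m n := fspan (fp_hom P m n).

Definition linearize : lprop k.
Proof.
pose cmp m n p : H n p -> H m n -> H m p := bilext (@fp_comp P m n p).
pose tns m n m' n' : H m n -> H m' n' -> H (m + m')%N (n + n')%N :=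
  bilext (@fp_tens P m n m' n').
pose bj m n (f : bij m n) : H m n := fdelta (fp_bij P f).
refine (@LProp k H cmp tns bj _ _ _ _ _ _ _ _ _ _ _ _ _ _).
- by move=> *; apply: bilext_linl.
- by move=> *; apply: bilext_linr.
- by move=> *; apply: bilext_linl.
- by move=> *; apply: bilext_linr.
- move=> m n p q h g f; apply/ffunP => c; rewrite bilext3l bilext3r.
  apply: eq_bigr => a _; apply: eq_bigr => b _; apply: eq_bigr => d _.
  by rewrite fp_compA.
- move=> m n f; apply/ffunP => c; rewrite bilext_deltal.
  rewrite -(sum_delta f c); apply: eq_bigr => b _.
  by rewrite fp_comp1l mulrC eq_sym.
- move=> m n f; apply/ffunP => c; rewrite bilext_deltar.
  rewrite -(sum_delta f c); apply: eq_bigr => b _.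
  by rewrite fp_comp1r mulrC eq_sym.
- by move=> m n p g f; rewrite /cmp bilext_delta -fp_bij_comp.
- by move=> m n m' n' f g; rewrite /tns bilext_delta -fp_bij_sum.
- move=> m n p m' n' p' g f g' f'; rewrite /tns /cmp.
  move: g; apply: fspan_ext => [||g].
  + apply: linear_cmp (bilext_linl _ _) (bilext_linl _ _).
  + apply: linear_cmp (bilext_linl _ _) (bilext_linl _ _).
  move: f; apply: fspan_ext => [||f].
  + apply: linear_cmp (bilext_linl _ _) (bilext_linr _ _).
  + apply: linear_cmp (bilext_linr _ _) (bilext_linl _ _).
  move: g'; apply: fspan_ext => [||g'].
  + apply: linear_cmp (bilext_linr _ _) (bilext_linl _ _).
  + apply: linear_cmp (bilext_linl _ _) (bilext_linr _ _).
  move: f'; apply: fspan_ext => [||f'].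
  + apply: linear_cmp (bilext_linr _ _) (bilext_linr _ _).
  + apply: linear_cmp (bilext_linr _ _) (bilext_linr _ _).
  by rewrite !bilext_delta fp_interchange.
- move=> m n m' n' m'' n'' f g h.
  apply: (@bilext_heq (fp_hom P)); [exact/esym/addnA | exact/esym/addnA |].
  move=> c c' cc; rewrite bilext3l bilext3r.
  apply: eq_bigr => a _; apply: eq_bigr => b _; apply: eq_bigr => d _.
  by rewrite (heq_eqb (fp_tensA a b d) cc).
- move=> m n f; apply/ffunP => c; rewrite bilext_deltal.
  rewrite -(sum_delta f c); apply: eq_bigr => b _.
  by rewrite fp_tens0l mulrC eq_sym.
- move=> m n f; apply: (@bilext_heq (fp_hom P)); rewrite ?addn0 // => c c' cc.
  rewrite bilext_deltar -(sum_delta f c'); apply: eq_bigr => b _.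
  by rewrite (heq_eqb (fp_tens0r b) cc) mulrC eq_sym.
- move=> m n m' n' f g; rewrite /tns /cmp /bj.
  move: f; apply: fspan_ext => [||f].
  + apply: linear_cmp (bilext_linr _ _) (bilext_linl _ _).
  + apply: linear_cmp (bilext_linl _ _) (bilext_linr _ _).
  move: g; apply: fspan_ext => [||g].
  + apply: linear_cmp (bilext_linr _ _) (bilext_linr _ _).
  + apply: linear_cmp (bilext_linl _ _) (bilext_linl _ _).
  by rewrite !bilext_delta fp_swap.
Defined.

End BilinearExtension.
Arguments fspan k A : clear implicits.

(* Vector spaces presented as a set of expressions modulo a congruence. *)
Record linsetoid (k : fieldType) := LinSetoid {
  ls_car : Type;
  ls_eq : ls_car -> ls_car -> Prop;
  ls_zero : ls_car;
  ls_add : ls_car -> ls_car -> ls_car;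
  ls_scale : k -> ls_car -> ls_car;
  ls_refl : forall x, ls_eq x x;
  ls_sym : forall x y, ls_eq x y -> ls_eq y x;
  ls_trans : forall x y z, ls_eq x y -> ls_eq y z -> ls_eq x z;
  ls_addP : forall x x' y y',
    ls_eq x x' -> ls_eq y y' -> ls_eq (ls_add x y) (ls_add x' y');
  ls_scaleP : forall a x x', ls_eq x x' -> ls_eq (ls_scale a x) (ls_scale a x');
  ls_addA : forall x y z,
    ls_eq (ls_add x (ls_add y z)) (ls_add (ls_add x y) z);
  ls_addC : forall x y, ls_eq (ls_add x y) (ls_add y x);
  ls_add0 : forall x, ls_eq (ls_add ls_zero x) x;
  ls_addN : forall x, ls_eq (ls_add (ls_scale (-1) x) x) ls_zero;
  ls_scaleA : forall a b x,
    ls_eq (ls_scale a (ls_scale b x)) (ls_scale (a * b) x);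
  ls_scale1 : forall x, ls_eq (ls_scale 1 x) x;
  ls_scaleDr : forall a x y,
    ls_eq (ls_scale a (ls_add x y)) (ls_add (ls_scale a x) (ls_scale a y));
  ls_scaleDl : forall a b x,
    ls_eq (ls_scale (a + b) x) (ls_add (ls_scale a x) (ls_scale b x))
}.

Section LinSetoidQuotient.
Variables (k : fieldType) (S : linsetoid k).

Definition ls_elt := ls_car S.
HB.instance Definition _ := gen_eqMixin ls_elt.
HB.instance Definition _ := gen_choiceMixin ls_elt.

Definition ls_eqb (x y : ls_elt) : bool := `[< ls_eq x y >].

Lemma ls_eqb_refl : reflexive ls_eqb.
Proof. by move=> x; apply/asboolP/ls_refl. Qed.

Lemma ls_eqb_sym : symmetric ls_eqb.
Proof. by move=> x y; apply/asboolP/asboolP; apply: ls_sym. Qed.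

Lemma ls_eqb_trans : transitive ls_eqb.
Proof.
by move=> y x z /asboolP xy /asboolP yz; apply/asboolP/(ls_trans xy yz).
Qed.

Definition ls_equiv := EquivRel ls_eqb ls_eqb_refl ls_eqb_sym ls_eqb_trans.

Definition lsquot := {eq_quot ls_equiv}.
HB.instance Definition _ := Choice.on lsquot.

Definition ls_pi (x : ls_car S) : lsquot := \pi_({eq_quot ls_equiv}) x.
Definition ls_repr (q : lsquot) : ls_car S := repr (q : {eq_quot ls_equiv}).

Lemma ls_piP x y : ls_pi x = ls_pi y <-> ls_eq x y.
Proof.
rewrite /ls_pi; split => [/eqquotP/asboolP // | xy].
by apply/eqquotP/asboolP.
Qed.

Lemma ls_reprK q : ls_pi (ls_repr q) = q.
Proof. exact: reprK. Qed.

Lemma ls_pi_repr x : ls_eq (ls_repr (ls_pi x)) x.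
Proof. by apply/ls_piP; rewrite ls_reprK. Qed.

Definition lsq_zero : lsquot := ls_pi (ls_zero S).
Definition lsq_add p q : lsquot := ls_pi (ls_add (ls_repr p) (ls_repr q)).
Definition lsq_scale a q : lsquot := ls_pi (ls_scale a (ls_repr q)).
Definition lsq_opp q := lsq_scale (-1) q.

Lemma lsq_addE x y : lsq_add (ls_pi x) (ls_pi y) = ls_pi (ls_add x y).
Proof. by apply/ls_piP/ls_addP; apply: ls_pi_repr. Qed.

Lemma lsq_scaleE a x : lsq_scale a (ls_pi x) = ls_pi (ls_scale a x).
Proof. by apply/ls_piP/ls_scaleP; apply: ls_pi_repr. Qed.

Let lsqE := (lsq_addE, lsq_scaleE).

Lemma lsq_addA : associative lsq_add.
Proof.
move=> x y z; rewrite -(ls_reprK x) -(ls_reprK y) -(ls_reprK z) !lsqE.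
exact/ls_piP/ls_addA.
Qed.

Lemma lsq_addC : commutative lsq_add.
Proof.
by move=> x y; rewrite -(ls_reprK x) -(ls_reprK y) !lsqE; apply/ls_piP/ls_addC.
Qed.

Lemma lsq_add0 : left_id lsq_zero lsq_add.
Proof. by move=> x; rewrite -(ls_reprK x) !lsqE; apply/ls_piP/ls_add0. Qed.

Lemma lsq_addN : left_inverse lsq_zero lsq_opp lsq_add.
Proof.
by move=> x; rewrite -(ls_reprK x) /lsq_opp !lsqE; apply/ls_piP/ls_addN.
Qed.

HB.instance Definition _ :=
  GRing.isZmodule.Build lsquot lsq_addA lsq_addC lsq_add0 lsq_addN.

Lemma lsq_scaleA a b v : lsq_scale a (lsq_scale b v) = lsq_scale (a * b) v.
Proof. by rewrite -(ls_reprK v) !lsqE; apply/ls_piP/ls_scaleA. Qed.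

Lemma lsq_scale1 : left_id 1 lsq_scale.
Proof. by move=> v; rewrite -(ls_reprK v) !lsqE; apply/ls_piP/ls_scale1. Qed.

Lemma lsq_scaleDr : right_distributive lsq_scale +%R.
Proof.
move=> a u v; rewrite -(ls_reprK u) -(ls_reprK v) /GRing.add /= !lsqE.
exact/ls_piP/ls_scaleDr.
Qed.

Lemma lsq_scaleDl v : {morph lsq_scale^~ v : a b / a + b}.
Proof.
move=> a b; rewrite -(ls_reprK v) [in RHS]/GRing.add /= !lsqE.
exact/ls_piP/ls_scaleDl.
Qed.

HB.instance Definition _ := GRing.Zmodule_isLmodule.Build k lsquot
  lsq_scaleA lsq_scale1 lsq_scaleDr lsq_scaleDl.

Definition lsq : lmodType k := lsquot.

Definition lsp (x : ls_car S) : lsq := ls_pi x.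

Lemma lspP x y : lsp x = lsp y <-> ls_eq x y.
Proof. exact: ls_piP. Qed.

Lemma lspD x y : lsp (ls_add x y) = lsp x + lsp y.
Proof. exact/esym/lsq_addE. Qed.

Lemma lspZ a x : lsp (ls_scale a x) = a *: lsp x.
Proof. exact/esym/lsq_scaleE. Qed.

Lemma lsp0 : lsp (ls_zero S) = 0.
Proof. by []. Qed.

Lemma lspK q : lsp (ls_repr q) = q.
Proof. exact: ls_reprK. Qed.

Lemma lsp_surj (Q : lsq -> Prop) : (forall x, Q (lsp x)) -> forall q, Q q.
Proof. by move=> Qp q; rewrite -(lspK q). Qed.

End LinSetoidQuotient.

Record signature := Signature {
  gen : Type;
  gdom : gen -> nat;
  gcod : gen -> nat
}.

Inductive tm (k : fieldType) (G : signature) : nat -> nat -> Type :=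
| tgen (g : gen G) : tm k G (gdom g) (gcod g)
| tbij m n (f : bij m n) : tm k G m n
| tcomp m n p (t : tm k G n p) (u : tm k G m n) : tm k G m p
| ttens m n m' n' (t : tm k G m n) (u : tm k G m' n') :
    tm k G (m + m') (n + n')
| tzero m n : tm k G m n
| tadd m n (t u : tm k G m n) : tm k G m n
| tscale m n (a : k) (t : tm k G m n) : tm k G m n.

Arguments tgen {k G} g.
Arguments tbij {k G m n} f.
Arguments tzero {k G} m n.

Definition tid k G n : tm k G n n := tbij (bij1 n).
Arguments tid {k G} n.

Section Presentation.
Variables (k : fieldType) (G : signature).
Variable rel : forall m n, tm k G m n -> tm k G m n -> Prop.

(* The least congruence that contains rel and makes the terms a k-linear
   PROP.  It relates terms whose types are only provably equal, so that
   strict associativity and unitality need no transport. *)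
Inductive teq : forall m n m' n', tm k G m n -> tm k G m' n' -> Prop :=
| teq_rel m n (t u : tm k G m n) : rel t u -> teq t u
| teq_refl m n (t : tm k G m n) : teq t t
| teq_sym m n m' n' (t : tm k G m n) (u : tm k G m' n') : teq t u -> teq u t
| teq_trans m n m' n' m'' n''
    (t : tm k G m n) (u : tm k G m' n') (v : tm k G m'' n'') :
    teq t u -> teq u v -> teq t v
| teq_comp m n p m' n' p' (t : tm k G n p) (u : tm k G m n)
    (t' : tm k G n' p') (u' : tm k G m' n') :
    teq t t' -> teq u u' -> teq (tcomp t u) (tcomp t' u')
| teq_tens m n p q m' n' p' q' (t : tm k G m n) (u : tm k G p q)
    (t' : tm k G m' n') (u' : tm k G p' q') :
    teq t t' -> teq u u' -> teq (ttens t u) (ttens t' u')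
| teq_add m n m' n' (t u : tm k G m n) (t' u' : tm k G m' n') :
    teq t t' -> teq u u' -> teq (tadd t u) (tadd t' u')
| teq_scale m n m' n' a (t : tm k G m n) (t' : tm k G m' n') :
    teq t t' -> teq (tscale a t) (tscale a t')
| teq_addA m n (t u v : tm k G m n) :
    teq (tadd t (tadd u v)) (tadd (tadd t u) v)
| teq_addC m n (t u : tm k G m n) : teq (tadd t u) (tadd u t)
| teq_add0 m n (t : tm k G m n) : teq (tadd (tzero m n) t) t
| teq_addN m n (t : tm k G m n) : teq (tadd (tscale (-1) t) t) (tzero m n)
| teq_scaleA m n a b (t : tm k G m n) :
    teq (tscale a (tscale b t)) (tscale (a * b) t)
| teq_scale1 m n (t : tm k G m n) : teq (tscale 1 t) t
| teq_scaleDr m n a (t u : tm k G m n) :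
    teq (tscale a (tadd t u)) (tadd (tscale a t) (tscale a u))
| teq_scaleDl m n a b (t : tm k G m n) :
    teq (tscale (a + b) t) (tadd (tscale a t) (tscale b t))
| teq_comp_linl m n p a (t t' : tm k G n p) (u : tm k G m n) :
    teq (tcomp (tadd (tscale a t) t') u)
        (tadd (tscale a (tcomp t u)) (tcomp t' u))
| teq_comp_linr m n p a (t : tm k G n p) (u u' : tm k G m n) :
    teq (tcomp t (tadd (tscale a u) u'))
        (tadd (tscale a (tcomp t u)) (tcomp t u'))
| teq_tens_linl m n m' n' a (t t' : tm k G m n) (u : tm k G m' n') :
    teq (ttens (tadd (tscale a t) t') u)
        (tadd (tscale a (ttens t u)) (ttens t' u))
| teq_tens_linr m n m' n' a (t : tm k G m n) (u u' : tm k G m' n') :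
    teq (ttens t (tadd (tscale a u) u'))
        (tadd (tscale a (ttens t u)) (ttens t u'))
| teq_compA m n p q (t : tm k G p q) (u : tm k G n p) (v : tm k G m n) :
    teq (tcomp t (tcomp u v)) (tcomp (tcomp t u) v)
| teq_comp1l m n (t : tm k G m n) : teq (tcomp (tid n) t) t
| teq_comp1r m n (t : tm k G m n) : teq (tcomp t (tid m)) t
| teq_bij_comp m n p (g : bij n p) (f : bij m n) :
    teq (tbij (bij_comp g f)) (tcomp (tbij g) (tbij f))
| teq_bij_sum m n m' n' (f : bij m n) (g : bij m' n') :
    teq (tbij (bij_sum f g)) (ttens (tbij f) (tbij g))
| teq_interchange m n p m' n' p' (t : tm k G n p) (u : tm k G m n)
    (t' : tm k G n' p') (u' : tm k G m' n') :
    teq (ttens (tcomp t u) (tcomp t' u')) (tcomp (ttens t t') (ttens u u'))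
| teq_tensA m n m' n' m'' n''
    (t : tm k G m n) (u : tm k G m' n') (v : tm k G m'' n'') :
    teq (ttens (ttens t u) v) (ttens t (ttens u v))
| teq_tens0l m n (t : tm k G m n) : teq (ttens (tid 0) t) t
| teq_tens0r m n (t : tm k G m n) : teq (ttens t (tid 0)) t
| teq_swap m n m' n' (t : tm k G m n) (u : tm k G m' n') :
    teq (tcomp (tbij (swap n n')) (ttens t u))
        (tcomp (ttens u t) (tbij (swap m m'))).

Definition tm_linsetoid m n : linsetoid k :=
  @LinSetoid k (tm k G m n) (@teq m n m n) (tzero m n) (@tadd k G m n)
    (@tscale k G m n) (@teq_refl m n) (@teq_sym m n m n)
    (@teq_trans m n m n m n) (fun _ _ _ _ => @teq_add m n m n _ _ _ _)
    (fun _ _ _ => @teq_scale m n m n _ _ _) (@teq_addA m n) (@teq_addC m n)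
    (@teq_add0 m n) (@teq_addN m n) (@teq_scaleA m n) (@teq_scale1 m n)
    (@teq_scaleDr m n) (@teq_scaleDl m n).

Definition pr_hom m n : lmodType k := lsq (tm_linsetoid m n).
Definition tclass m n (t : tm k G m n) : pr_hom m n := @lsp k (tm_linsetoid m n) t.

Lemma tclassP m n (t u : tm k G m n) : tclass t = tclass u <-> teq t u.
Proof. exact: lspP. Qed.

Variant tclass_spec m n : pr_hom m n -> Prop :=
  TClass t : tclass_spec (tclass t).

Lemma tclass_surj m n (x : pr_hom m n) : tclass_spec x.
Proof. by rewrite -(lspK x). Qed.

Definition pr_comp m n p (x : pr_hom n p) (y : pr_hom m n) : pr_hom m p :=
  tclass (tcomp (ls_repr x : tm k G n p) (ls_repr y : tm k G m n)).

Definition pr_tens m n m' n' (x : pr_hom m n) (y : pr_hom m' n') :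
    pr_hom (m + m') (n + n') :=
  tclass (ttens (ls_repr x : tm k G m n) (ls_repr y : tm k G m' n')).

Definition pr_bij m n (f : bij m n) : pr_hom m n := tclass (tbij f).

Lemma teq_repr m n (t : tm k G m n) :
  teq (ls_repr (tclass t) : tm k G m n) t.
Proof. exact: (@ls_pi_repr k (tm_linsetoid m n) t). Qed.

Lemma pr_compE m n p (t : tm k G n p) (u : tm k G m n) :
  pr_comp (tclass t) (tclass u) = tclass (tcomp t u).
Proof. by apply/tclassP/teq_comp; apply: teq_repr. Qed.

Lemma pr_tensE m n m' n' (t : tm k G m n) (u : tm k G m' n') :
  pr_tens (tclass t) (tclass u) = tclass (ttens t u).
Proof. by apply/tclassP/teq_tens; apply: teq_repr. Qed.

Lemma tclass_lin m n a (t u : tm k G m n) :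
  a *: tclass t + tclass u = tclass (tadd (tscale a t) u).
Proof. by rewrite /tclass -lspZ -lspD. Qed.

Lemma tclassD m n (t u : tm k G m n) : tclass (tadd t u) = tclass t + tclass u.
Proof. exact: lspD. Qed.

Lemma tclassZ m n a (t : tm k G m n) : tclass (tscale a t) = a *: tclass t.
Proof. exact: lspZ. Qed.

Lemma tclass0 m n : tclass (tzero m n) = 0.
Proof. by []. Qed.

Lemma teq_dims m n m' n' (t : tm k G m n) (u : tm k G m' n') :
  teq t u -> m = m' /\ n = n'.
Proof.
elim => //; first by move=> ? ? ? ? ? ? _ [-> ->].
- by move=> ? ? ? ? ? ? ? ? ? _ [-> ->] _ [-> ->].
- by move=> ? ? ? ? ? ? ? ? ? ? _ [_ ->] _ [-> _].
- by move=> ? ? ? ? ? ? ? ? ? ? ? ? _ [-> ->] _ [-> ->].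
- by move=> *; rewrite !addnA.
- by move=> *; rewrite !addn0.
Qed.

Lemma tclass_heq m n m' n' (t : tm k G m n) (u : tm k G m' n') :
  teq t u -> heq (H := fun m n => pr_hom m n) (tclass t) (tclass u).
Proof.
move=> tu; have [em en] := teq_dims tu; move: t u tu; rewrite -em -en => t u.
by move/tclassP->.
Qed.

Definition presented : lprop k.
Proof.
refine (@LProp k pr_hom pr_comp pr_tens pr_bij _ _ _ _ _ _ _ _ _ _ _ _ _ _).
- move=> m n p f a g g'; case: (tclass_surj f) (tclass_surj g) (tclass_surj g').
  move=> t [u] [u']; rewrite !(tclass_lin, pr_compE).
  exact/tclassP/teq_comp_linl.
- move=> m n p f a g g'; case: (tclass_surj f) (tclass_surj g) (tclass_surj g').
  move=> t [u] [u']; rewrite !(tclass_lin, pr_compE).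
  exact/tclassP/teq_comp_linr.
- move=> m n m' n' f a g g'.
  case: (tclass_surj f) (tclass_surj g) (tclass_surj g').
  move=> t [u] [u']; rewrite !(tclass_lin, pr_tensE).
  exact/tclassP/teq_tens_linl.
- move=> m n m' n' f a g g'.
  case: (tclass_surj f) (tclass_surj g) (tclass_surj g').
  move=> t [u] [u']; rewrite !(tclass_lin, pr_tensE).
  exact/tclassP/teq_tens_linr.
- move=> m n p q h g f.
  case: (tclass_surj h) (tclass_surj g) (tclass_surj f) => t [u] [v].
  rewrite !pr_compE; exact/tclassP/teq_compA.
- move=> m n f; case: (tclass_surj f) => t.
  rewrite pr_compE; exact/tclassP/teq_comp1l.
- move=> m n f; case: (tclass_surj f) => t.
  rewrite pr_compE; exact/tclassP/teq_comp1r.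
- by move=> m n p g f; rewrite pr_compE; exact/tclassP/teq_bij_comp.
- by move=> m n m' n' g f; rewrite pr_tensE; exact/tclassP/teq_bij_sum.
- move=> m n p m' n' p' g f g' f'.
  case: (tclass_surj g) (tclass_surj f) (tclass_surj g') (tclass_surj f').
  move=> t [u] [t'] [u']; rewrite !(pr_compE, pr_tensE).
  exact/tclassP/teq_interchange.
- move=> m n m' n' m'' n'' f g h.
  case: (tclass_surj f) (tclass_surj g) (tclass_surj h) => t [u] [v].
  rewrite !pr_tensE; exact/tclass_heq/teq_tensA.
- move=> m n f; case: (tclass_surj f) => t.
  rewrite pr_tensE; exact/tclassP/teq_tens0l.
- move=> m n f; case: (tclass_surj f) => t.
  rewrite pr_tensE; exact/tclass_heq/teq_tens0r.
- move=> m n m' n' f g; case: (tclass_surj f) (tclass_surj g) => t [u].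
  rewrite !pr_tensE !pr_compE; exact/tclassP/teq_swap.
Defined.

End Presentation.

(* Morphisms of k-linear PROPs: k-linear functors that are the identity on
   objects and preserve the symmetric monoidal structure. *)
Record lprop_mor (k : fieldType) (P Q : lprop k) := LPropMor {
  pmap : forall m n, hom P m n -> hom Q m n;
  pmap_lin : forall m n, linear (@pmap m n);
  pmap_comp : forall m n p (g : hom P n p) (f : hom P m n),
    pmap (hcomp g f) = hcomp (pmap g) (pmap f);
  pmap_tens : forall m n m' n' (f : hom P m n) (g : hom P m' n'),
    pmap (htens f g) = htens (pmap f) (pmap g);
  pmap_bij : forall m n (f : bij m n), pmap (hbij P f) = hbij Q f
}.

Section Universal.
Variables (k : fieldType) (G : signature).
Variable rel : forall m n, tm k G m n -> tm k G m n -> Prop.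
Variables (Q : lprop k) (v : forall g : gen G, hom Q (gdom g) (gcod g)).

Fixpoint teval m n (t : tm k G m n) : hom Q m n :=
  match t in tm _ _ m n return hom Q m n with
  | tgen g => v g
  | tbij _ _ f => hbij Q f
  | tcomp _ _ _ t u => hcomp (teval t) (teval u)
  | ttens _ _ _ _ t u => htens (teval t) (teval u)
  | tzero _ _ => 0
  | tadd _ _ t u => teval t + teval u
  | tscale _ _ a t => a *: teval t
  end.

Definition respects := forall m n (t u : tm k G m n),
  rel t u -> teval t = teval u.

Hypothesis vP : respects.

Lemma teval_heq m n m' n' (t : tm k G m n) (u : tm k G m' n') :
  teq rel t u -> heq (H := fun m n => hom Q m n) (teval t) (teval u).
Proof.
elim=> //=.
- by move=> ? ? ? ? /vP ->.
- by move=> *; apply: heq_sym.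
- by move=> ? ? ? ? ? ? ? ? ? _ h1 _ h2; apply: heq_trans h1 h2.
- move=> m1 n1 p1 m2 n2 p2 t1 u1 t2 u2 tt h1 uu h2.
  have [e1 e2] := teq_dims tt; have [e3 _] := teq_dims uu.
  move: t2 u2 tt h1 uu h2; rewrite -e1 -e2 -e3 => t2 u2 _ h1 _ h2.
  by rewrite (heq_eq h1) (heq_eq h2).
- by move=> m1 n1 p1 q1 m2 n2 p2 q2 t1 u1 t2 u2 _ h1 _ h2; case: h1; case: h2.
- move=> m1 n1 m2 n2 t1 u1 t2 u2 tt h1 uu h2.
  have [e1 e2] := teq_dims tt.
  move: t2 u2 tt h1 uu h2; rewrite -e1 -e2 => t2 u2 _ h1 _ h2.
  by rewrite (heq_eq h1) (heq_eq h2).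
- by move=> m1 n1 m2 n2 a t1 t2 _ h1; case: h1.
- by move=> *; rewrite addrA.
- by move=> *; rewrite addrC.
- by move=> *; rewrite add0r.
- by move=> *; rewrite scaleN1r addNr.
- by move=> *; rewrite scalerA.
- by move=> *; rewrite scale1r.
- by move=> *; rewrite scalerDr.
- by move=> *; rewrite scalerDl.
- by move=> *; rewrite hcomp_linl.
- by move=> *; rewrite hcomp_linr.
- by move=> *; rewrite htens_linl.
- by move=> *; rewrite htens_linr.
- by move=> *; rewrite hcompA.
- by move=> *; rewrite hcomp1l.
- by move=> *; rewrite hcomp1r.
- by move=> *; rewrite hbij_comp.
- by move=> *; rewrite hbij_sum.
- by move=> *; rewrite hinterchange.
- by move=> *; apply: htensA.
- by move=> *; rewrite htens0l.
- by move=> *; apply: htens0r.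
- by move=> *; rewrite hbij_swap.
Qed.

Lemma teval_eq m n (t u : tm k G m n) : teq rel t u -> teval t = teval u.
Proof. by move=> tu; exact: (heq_eq (teval_heq tu)). Qed.

Definition pr_map m n (x : pr_hom rel m n) : hom Q m n :=
  teval (ls_repr x : tm k G m n).

Lemma pr_mapE m n (t : tm k G m n) : pr_map (tclass rel t) = teval t.
Proof. exact/teval_eq/teq_repr. Qed.

Definition presented_mor : lprop_mor (presented rel) Q.
Proof.
refine (@LPropMor k (presented rel) Q pr_map _ _ _ _).
- move=> m n a x y; case: (tclass_surj x) (tclass_surj y) => t [u].
  by rewrite tclass_lin !pr_mapE.
- move=> m n p x y; case: (tclass_surj x) (tclass_surj y) => t [u].
  by rewrite [X in pr_map X]pr_compE !pr_mapE.
- move=> m n m' n' x y; case: (tclass_surj x) (tclass_surj y) => t [u].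
  by rewrite [X in pr_map X]pr_tensE !pr_mapE.
- by move=> m n f; rewrite pr_mapE.
Defined.

End Universal.

(* The relations of a Lie algebra object; the permutations 1, swap 1 2 and
   swap 2 1 in the Jacobi identity are the cyclic permutations of 3. *)
Inductive lie_axioms k G (br : tm k G 2 1) :
  forall m n, tm k G m n -> tm k G m n -> Prop :=
| lie_antisym : lie_axioms br (tcomp br (tbij (swap 1 1))) (tscale (-1) br)
| lie_jacobi : lie_axioms br
    (tcomp (tcomp br (ttens br (tid 1)))
           (tadd (tadd (tid 3) (tbij (swap 1 2))) (tbij (swap 2 1))))
    (tzero 3 1).

Inductive casimir_axioms k G (br : tm k G 2 1) (c : tm k G 0 2) :
  forall m n, tm k G m n -> tm k G m n -> Prop :=
| casimir_sym : casimir_axioms br c (tcomp (tbij (swap 1 1)) c) c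
| casimir_inv : casimir_axioms br c
    (tcomp (ttens br (tid 1)) (ttens (tid 1) c))
    (tcomp (ttens (tid 1) br) (ttens c (tid 1))).

Variant lie_gen := LieBr.
Definition lie_sig := Signature (fun _ : lie_gen => 2) (fun _ => 1).
Definition lie_br k : tm k lie_sig 2 1 := tgen (LieBr : gen lie_sig).
Definition CLie (k : fieldType) : lprop k := presented (lie_axioms (lie_br k)).

Variant liec_gen := LieCBr | LieCCas.
Definition liec_sig := Signature
  (fun g => if g is LieCBr then 2 else 0)
  (fun g => if g is LieCBr then 1 else 2).
Definition liec_br k : tm k liec_sig 2 1 := tgen (LieCBr : gen liec_sig).
Definition liec_cas k : tm k liec_sig 0 2 := tgen (LieCCas : gen liec_sig).
Variant liec_rel k m n (t u : tm k liec_sig m n) : Prop :=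
| liec_lie of lie_axioms (liec_br k) t u
| liec_casimir of casimir_axioms (liec_br k) (liec_cas k) t u.
Definition CLieC (k : fieldType) : lprop k := presented (@liec_rel k).

(* kSym is the PROP of group algebras of symmetric groups: kSym(n, n) = k[S_n]
   and kSym(m, n) = 0 for m <> n. *)
Definition kSym (k : fieldType) : lprop k := linearize k bij_prop.
Definition uB (k : fieldType) : lprop k := linearize k ubrauer_prop.

Section Projections.
Variable k : fieldType.

Lemma hcomp0l (P : lprop k) m n p (f : hom P m n) : hcomp (0 : hom P n p) f = 0.
Proof. exact: (linear_fun0 (hcomp_linl f)). Qed.

Lemma hcomp0r (P : lprop k) m n p (g : hom P n p) : hcomp g (0 : hom P m n) = 0.
Proof. exact: (linear_fun0 (hcomp_linr g)). Qed.

Lemma htens_0l (P : lprop k) m n m' n' (g : hom P m' n') :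
  htens (0 : hom P m n) g = 0.
Proof. exact: (linear_fun0 (htens_linl g)). Qed.

Lemma htens_0r (P : lprop k) m n m' n' (f : hom P m n) :
  htens f (0 : hom P m' n') = 0.
Proof. exact: (linear_fun0 (htens_linr f)). Qed.

Definition lie_sym_val (g : gen lie_sig) : hom (kSym k) (gdom g) (gcod g) := 0.

Lemma lie_sym_respects : respects (lie_axioms (lie_br k)) lie_sym_val.
Proof.
move=> m n t u [].
  exact: etrans (hcomp0l _ _) (esym (scaler0 _ _)).
exact: etrans (congr1 (fun x => hcomp x _) (hcomp0l _ _)) (hcomp0l _ _).
Qed.

(* The augmentation that kills the bracket. *)
Definition lie_to_sym : lprop_mor (CLie k) (kSym k) :=
  presented_mor lie_sym_respects.

Definition liec_lie_val (g : gen liec_sig) : hom (CLie k) (gdom g) (gcod g) :=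
  match g return hom (CLie k) (@gdom liec_sig g) (@gcod liec_sig g) with
  | LieCBr => tclass (lie_axioms (lie_br k)) (lie_br k)
  | LieCCas => 0
  end.

Lemma liec_lie_respects : respects (@liec_rel k) liec_lie_val.
Proof.
move=> m n t u [[] | []].
- pose r := lie_axioms (lie_br k).
  change (pr_comp (tclass r (lie_br k)) (tclass r (tbij (swap 1 1)))
    = (-1) *: tclass r (lie_br k)).
  by rewrite pr_compE -tclassZ; apply/tclassP/teq_rel/lie_antisym.
- pose r := lie_axioms (lie_br k).
  change (pr_comp (pr_comp (tclass r (lie_br k))
      (pr_tens (tclass r (lie_br k)) (tclass r (tid 1))))
    (tclass r (tid 3) + tclass r (tbij (swap 1 2)) + tclass r (tbij (swap 2 1)))
    = tclass r (tzero 3 1)).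
  have -> : pr_comp (tclass r (lie_br k))
        (pr_tens (tclass r (lie_br k)) (tclass r (tid 1)))
      = tclass r (tcomp (lie_br k) (ttens (lie_br k) (tid 1))).
    by rewrite pr_tensE; exact: pr_compE.
  have -> : tclass r (tid 3) + tclass r (tbij (swap 1 2))
        + tclass r (tbij (swap 2 1))
      = tclass r (tadd (tadd (tid 3) (tbij (swap 1 2))) (tbij (swap 2 1))).
    by rewrite !tclassD.
  apply: etrans (pr_compE _ _ _) _.
  exact/tclassP/teq_rel/lie_jacobi.
- exact: hcomp0r.
- pose e := teval liec_lie_val.
  have e1 : e _ _ (ttens (tid 1) (liec_cas k)) = 0 by exact: htens_0r.
  have e2 : e _ _ (ttens (liec_cas k) (tid 1)) = 0 by exact: htens_0l.
  have e3 : hcomp (e _ _ (ttens (liec_br k) (tid 1)))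
      (e _ _ (ttens (tid 1) (liec_cas k))) = 0 by rewrite e1; exact: hcomp0r.
  have e4 : hcomp (e _ _ (ttens (tid 1) (liec_br k)))
      (e _ _ (ttens (liec_cas k) (tid 1))) = 0 by rewrite e2; exact: hcomp0r.
  exact: etrans e3 (esym e4).
Qed.

(* CLie is the part of CLieC of degree 0 in the Casimir element; the projection
   onto it fixes the bracket and kills the Casimir element. *)
Definition liec_to_lie : lprop_mor (CLieC k) (CLie k) :=
  presented_mor liec_lie_respects.

End Projections.

(* k-linear functors P -> Vect_k and their natural transformations. *)
Record cmod (k : fieldType) (P : lprop k) := CMod {
  cobj : nat -> lmodType k;
  cact : forall m n, hom P m n -> cobj m -> cobj n;
  cact_linl : forall m n (v : cobj m), linear (fun f : hom P m n => cact f v);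
  cact_linr : forall m n (f : hom P m n), linear (cact f);
  cact_id : forall n (v : cobj n), cact (hid P n) v = v;
  cact_comp : forall m n p (g : hom P n p) (f : hom P m n) (v : cobj m),
    cact (hcomp g f) v = cact g (cact f v)
}.

Record cmor (k : fieldType) (P : lprop k) (M N : cmod P) := CMor {
  cfun : forall n, cobj M n -> cobj N n;
  cfun_lin : forall n, linear (@cfun n);
  cfun_nat : forall m n (f : hom P m n) (v : cobj M m),
    cfun (cact f v) = cact f (cfun v)
}.

Definition cmod_iso k (P : lprop k) (M N : cmod P) : Prop :=
  exists f : cmor M N, forall n, bijective (@cfun _ _ _ _ f n).

Definition cpull k (P Q : lprop k) (F : lprop_mor P Q) (M : cmod Q) : cmod P.
Proof.
refine (@CMod k P (cobj M) (fun m n f v => cact (pmap F f) v) _ _ _ _).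
- by move=> m n v a f g; rewrite pmap_lin cact_linl.
- by move=> m n f; exact: cact_linr.
- by move=> n v; rewrite /hid pmap_bij; exact: cact_id.
- by move=> m n p g f v; rewrite pmap_comp cact_comp.
Defined.

Section ModuleCategory.
Variables (k : fieldType) (P : lprop k).
Implicit Types M N : cmod P.

Definition csum M N : cmod P.
Proof.
refine (@CMod k P (fun n => (cobj M n * cobj N n)%type)
  (fun m n f v => (cact f v.1, cact f v.2)) _ _ _ _).
- by move=> m n v a f g /=; rewrite !cact_linl.
- by move=> m n f a u v /=; rewrite !cact_linr.
- by move=> n [u v] /=; rewrite !cact_id.
- by move=> m n p g f [u v] /=; rewrite !cact_comp.
Defined.

Definition cpow M (r : nat) : cmod P.
Proof.
refine (@CMod k P (fun n => {ffun 'I_r -> cobj M n})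
  (fun m n f v => [ffun i => cact f (v i)]) _ _ _ _).
- by move=> m n v a f g; apply/ffunP => i; rewrite !ffunE cact_linl.
- by move=> m n f a u v; apply/ffunP => i; rewrite !ffunE cact_linr.
- by move=> n v; apply/ffunP => i; rewrite !ffunE cact_id.
- by move=> m n p g f v; apply/ffunP => i; rewrite !ffunE cact_comp.
Defined.

Definition cidm M : cmor M M.
Proof. by refine (@CMor k P M M (fun n v => v) _ _). Defined.

Definition cscal M (c : k) : cmor M M.
Proof.
refine (@CMor k P M M (fun n v => c *: v) _ _).
- by move=> n a u v; rewrite scalerDr !scalerA mulrC.
- by move=> m n f v; rewrite (linear_funZ (cact_linr f)).
Defined.

Definition cdiag M : cmor M (csum M M).
Proof. by refine (@CMor k P M (csum M M) (fun n v => (v, v)) _ _). Defined.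

Definition ccodiag M : cmor (csum M M) M.
Proof.
refine (@CMor k P (csum M M) M (fun n v => v.1 + v.2) _ _).
- by move=> n a u v /=; rewrite scalerDr addrACA.
- by move=> m n f v /=; rewrite (linear_funD (cact_linr f)).
Defined.

Definition csum_mor M N M' N' (f : cmor M M') (g : cmor N N') :
  cmor (csum M N) (csum M' N').
Proof.
refine (@CMor k P (csum M N) (csum M' N')
  (fun n v => (cfun f v.1, cfun g v.2)) _ _).
- by move=> n a u v /=; rewrite !cfun_lin.
- by move=> m n h v /=; rewrite !cfun_nat.
Defined.

Record extension (A B : cmod P) := Extension {
  ext_mod : cmod P;
  ext_in : cmor B ext_mod;
  ext_out : cmor ext_mod A;
  ext_inj : forall n, injective (@cfun _ _ _ _ ext_in n);
  ext_surj : forall n (a : cobj A n), exists e, cfun ext_out e = a;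
  ext_exact : forall n (e : cobj ext_mod n),
    cfun ext_out e = 0 <-> exists b, cfun ext_in b = e
}.

(* There is a morphism of short exact sequences E -> E' which is beta on the
   sub-objects and alpha on the quotients. *)
Definition ext_morphism A B A' B' (E : extension A B) (E' : extension A' B')
    (beta : cmor B B') (alpha : cmor A A') : Prop :=
  exists phi : cmor (ext_mod E) (ext_mod E'),
    (forall n (b : cobj B n),
       cfun phi (cfun (ext_in E) b) = cfun (ext_in E') (cfun beta b)) /\
    (forall n (e : cobj (ext_mod E) n),
       cfun (ext_out E') (cfun phi e) = cfun alpha (cfun (ext_out E) e)).

Definition ext_equiv A B (E E' : extension A B) : Prop :=
  ext_morphism E E' (cidm B) (cidm A).

(* E' is the pushout of E along c : B -> B, which such a morphism characterizes
   up to equivalence; pullbacks and pushouts are likewise characterized in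
   ext_baer (Mac Lane, Homology, III.1-2). *)
Definition ext_scaled A B (c : k) (E E' : extension A B) : Prop :=
  ext_morphism E E' (cscal B c) (cidm A).

Definition ext_sum A B A' B' (E : extension A B) (E' : extension A' B') :
  extension (csum A A') (csum B B').
Proof.
refine (@Extension _ _ (csum (ext_mod E) (ext_mod E'))
  (csum_mor (ext_in E) (ext_in E')) (csum_mor (ext_out E) (ext_out E')) _ _ _).
- by move=> n [b b'] [c c'] /= [/ext_inj-> /ext_inj->].
- move=> n [a a']; have [e ea] := ext_surj E a; have [e' ea'] := ext_surj E' a'.
  by exists (e, e'); rewrite /= ea ea'.
- move=> n [e e']; split => /= [[/ext_exact[b <-] /ext_exact[b' <-]]|].
    by exists (b, b').
  move=> [[b b'] /= [<- <-]]; congr (_, _); apply/ext_exact; first by exists b.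
  by exists b'.
Defined.

(* E3 is the Baer sum of E1 and E2: with F the pullback of the direct sum of E1
   and E2 along the diagonal A -> A + A, it is the pushout of F along the
   codiagonal B + B -> B. *)
Definition ext_baer A B (E1 E2 E3 : extension A B) : Prop :=
  exists F : extension A (csum B B),
    ext_morphism F (ext_sum E1 E2) (cidm (csum B B)) (cdiag A) /\
    ext_morphism F E3 (ccodiag B) (cidm A).

(* Ext^1(A, B) is isomorphic to V as a vector space.  Ext^1(A, B) is the set of
   equivalence classes of extensions, with the Baer sum and the scalar
   multiplication by pushout; as the class of all extensions is too large to be
   the carrier of an lmodType, the isomorphism is given as the map cls that
   sends an extension to the image of its class. *)
Definition Ext1_iso (A B : cmod P) (V : lmodType k) : Prop :=
  exists cls : extension A B -> V,
    [/\ forall v, exists E, cls E = v,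
        forall E E', cls E = cls E' <-> ext_equiv E E',
        forall E1 E2 E3, cls E3 = cls E1 + cls E2 <-> ext_baer E1 E2 E3 &
        forall c E E', cls E' = c *: cls E <-> ext_scaled c E E'].

Definition Ext1_dim (A B : cmod P) (d : nat) : Prop := Ext1_iso A B 'rV[k]_d.

(* For S simple and M semisimple: M is the sum of r copies of S and of a module
   with no simple summand isomorphic to S. *)
Definition has_mult (S M : cmod P) (r : nat) : Prop :=
  exists N : cmod P, cmod_iso M (csum (cpow S r) N) /\
    forall (f : cmor S N) n (v : cobj S n), cfun f v = 0.

End ModuleCategory.

(* U (x) V (x) W modulo the relations u (x) v (x) w = u' (x) v' (x) w' given
   by R. *)
Section Tensor3.
Variables (k : fieldType) (U V W : lmodType k).
Variable R : U -> V -> W -> U -> V -> W -> Prop.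

Inductive t3exp :=
| t3pure of U & V & W
| t3zero
| t3add of t3exp & t3exp
| t3scale of k & t3exp.

Inductive t3eq : t3exp -> t3exp -> Prop :=
| t3_rel u v w u' v' w' : R u v w u' v' w' -> t3eq (t3pure u v w) (t3pure u' v' w')
| t3_lin1 a u u' v w : t3eq (t3pure (a *: u + u') v w)
    (t3add (t3scale a (t3pure u v w)) (t3pure u' v w))
| t3_lin2 a u v v' w : t3eq (t3pure u (a *: v + v') w)
    (t3add (t3scale a (t3pure u v w)) (t3pure u v' w))
| t3_lin3 a u v w w' : t3eq (t3pure u v (a *: w + w'))
    (t3add (t3scale a (t3pure u v w)) (t3pure u v w'))
| t3_refl x : t3eq x x
| t3_sym x y : t3eq x y -> t3eq y x
| t3_trans x y z : t3eq x y -> t3eq y z -> t3eq x z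
| t3_addP x x' y y' : t3eq x x' -> t3eq y y' -> t3eq (t3add x y) (t3add x' y')
| t3_scaleP a x x' : t3eq x x' -> t3eq (t3scale a x) (t3scale a x')
| t3_addA x y z : t3eq (t3add x (t3add y z)) (t3add (t3add x y) z)
| t3_addC x y : t3eq (t3add x y) (t3add y x)
| t3_add0 x : t3eq (t3add t3zero x) x
| t3_addN x : t3eq (t3add (t3scale (-1) x) x) t3zero
| t3_scaleA a b x : t3eq (t3scale a (t3scale b x)) (t3scale (a * b) x)
| t3_scale1 x : t3eq (t3scale 1 x) x
| t3_scaleDr a x y :
    t3eq (t3scale a (t3add x y)) (t3add (t3scale a x) (t3scale a y))
| t3_scaleDl a b x :
    t3eq (t3scale (a + b) x) (t3add (t3scale a x) (t3scale b x)).

Definition t3_linsetoid : linsetoid k :=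
  @LinSetoid k t3exp t3eq t3zero t3add t3scale t3_refl t3_sym t3_trans t3_addP
    t3_scaleP t3_addA t3_addC t3_add0 t3_addN t3_scaleA t3_scale1 t3_scaleDr
    t3_scaleDl.

Definition tens3 : lmodType k := lsq t3_linsetoid.
Definition pure3 (u : U) (v : V) (w : W) : tens3 :=
  lsp (t3pure u v w : ls_car t3_linsetoid).

Lemma pure3_rel u v w u' v' w' :
  R u v w u' v' w' -> pure3 u v w = pure3 u' v' w'.
Proof. by move=> r; apply/lspP/t3_rel. Qed.

Lemma pure3_lin1 v w : linear (fun u => pure3 u v w).
Proof. by move=> a u u'; rewrite -lspZ -lspD; apply/lspP/t3_lin1. Qed.

Lemma pure3_lin2 u w : linear (fun v => pure3 u v w).
Proof. by move=> a v v'; rewrite -lspZ -lspD; apply/lspP/t3_lin2. Qed.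

Lemma pure3_lin3 u v : linear (fun w => pure3 u v w).
Proof. by move=> a w w'; rewrite -lspZ -lspD; apply/lspP/t3_lin3. Qed.

Section Lift.
Variables (X : lmodType k) (f : U -> V -> W -> X).
Hypotheses (f1 : forall v w, linear (fun u => f u v w))
  (f2 : forall u w, linear (fun v => f u v w)) (f3 : forall u v, linear (f u v)).
Hypothesis fR : forall u v w u' v' w', R u v w u' v' w' -> f u v w = f u' v' w'.

Fixpoint t3eval (x : t3exp) : X :=
  match x with
  | t3pure u v w => f u v w
  | t3zero => 0
  | t3add x y => t3eval x + t3eval y
  | t3scale a x => a *: t3eval x
  end.

Lemma t3eval_eq x y : t3eq x y -> t3eval x = t3eval y.
Proof.
elim=> //=.
- by move=> a u u' v w; rewrite f1.
- by move=> a u v v' w; rewrite f2.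
- by move=> a u v w w'; rewrite f3.
- by move=> {}x {}y z _ -> _ ->.
- by move=> {}x x' {}y y' _ -> _ ->.
- by move=> a {}x x' _ ->.
- by move=> *; rewrite addrA.
- by move=> *; rewrite addrC.
- by move=> *; rewrite add0r.
- by move=> *; rewrite scaleN1r addNr.
- by move=> *; rewrite scalerA.
- by move=> *; rewrite scale1r.
- by move=> *; rewrite scalerDr.
- by move=> *; rewrite scalerDl.
Qed.

Definition lift3 (q : tens3) : X := t3eval (ls_repr q).

Lemma lift3_lsp x : lift3 (@lsp k t3_linsetoid x) = t3eval x.
Proof. by apply/t3eval_eq; exact: (@ls_pi_repr k t3_linsetoid x). Qed.

Lemma lift3_pure u v w : lift3 (pure3 u v w) = f u v w.
Proof. exact: lift3_lsp. Qed.

Lemma lift3_lin : linear lift3.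
Proof.
move=> a p q; rewrite -(lspK p) -(lspK q) -lspZ -lspD.
by rewrite (lift3_lsp (t3add (t3scale a _) _)) /= -!lift3_lsp.
Qed.

End Lift.

Lemma tens3_ext (X : lmodType k) (f g : tens3 -> X) :
  linear f -> linear g ->
  (forall u v w, f (pure3 u v w) = g (pure3 u v w)) -> f =1 g.
Proof.
move=> lf lg fg q; rewrite -(lspK q); elim: (ls_repr q : t3exp) => /=.
- exact: fg.
- by rewrite lsp0 !linear_fun0.
- move=> x ex y ey; rewrite (lspD (S := t3_linsetoid)).
  by rewrite (linear_funD lf) (linear_funD lg) ex ey.
- move=> a x ex; rewrite (lspZ (S := t3_linsetoid)).
  by rewrite (linear_funZ lf) (linear_funZ lg) ex.
Qed.

End Tensor3.

Section SymmetricGroups.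
Variable k : fieldType.

(* M(m) (x)_{k[S_m]} P(n, m) (x)_{k[S_n]} N(n), where the left k[S_m]-module
   M(m) is made a right module by v s := s^-1 v. *)
Inductive bibalanced (P : lprop k) (M N : cmod (kSym k)) (m n : nat) :
  cobj M m -> hom P n m -> cobj N n -> cobj M m -> hom P n m -> cobj N n -> Prop :=
| bibal_l (s : 'S_m) v x w :
    bibalanced (cact (hperm (kSym k) (s^-1)%g) v) x w v (hcomp (hperm P s) x) w
| bibal_r (s : 'S_n) v x w :
    bibalanced v (hcomp x (hperm P s)) w v x (cact (hperm (kSym k) s) w).

Definition bitens (P : lprop k) (M N : cmod (kSym k)) (m n : nat) : lmodType k :=
  tens3 (@bibalanced P M N m n).

(* The induced representation
   k[S_(a + b)] (x)_{k[S_a x S_b]} (M(a) (x) N(b)), placed in degree a + b. *)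
Inductive ind_balanced (M N : cmod (kSym k)) (a b p : nat) :
  hom (kSym k) (a + b) p -> cobj M a -> cobj N b ->
  hom (kSym k) (a + b) p -> cobj M a -> cobj N b -> Prop :=
| ind_bal (s : 'S_a) (t : 'S_b) x v w :
    ind_balanced (hcomp x (htens (hperm (kSym k) s) (hperm (kSym k) t))) v w
      x (cact (hperm (kSym k) s) v) (cact (hperm (kSym k) t) w).

Section Ind.
Variables (M N : cmod (kSym k)) (a b : nat).

Definition ind_obj p : lmodType k := tens3 (@ind_balanced M N a b p).

Definition ind_fun m n (y : hom (kSym k) m n) (x : hom (kSym k) (a + b) m)
  (v : cobj M a) (w : cobj N b) : ind_obj n := pure3 _ (hcomp y x) v w.

Definition ind_act m n (y : hom (kSym k) m n) : ind_obj m -> ind_obj n :=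
  lift3 (ind_fun y).

Lemma ind_fun_lin1 m n (y : hom (kSym k) m n) v w :
  linear (fun x => ind_fun y x v w).
Proof. exact: linear_cmp (pure3_lin1 _ _ _) (hcomp_linr y). Qed.

Lemma ind_fun_rel m n (y : hom (kSym k) m n) x v w x' v' w' :
  ind_balanced x v w x' v' w' -> ind_fun y x v w = ind_fun y x' v' w'.
Proof.
case=> s t {}x {}v {}w; rewrite /ind_fun hcompA.
exact/pure3_rel/ind_bal.
Qed.

Lemma ind_act_lin m n (y : hom (kSym k) m n) : linear (ind_act y).
Proof.
apply: lift3_lin; first exact: ind_fun_lin1.
- by move=> x w; exact: pure3_lin2.
- by move=> x v; exact: pure3_lin3.
- by move=> *; exact: ind_fun_rel.
Qed.

Lemma ind_act_pure m n (y : hom (kSym k) m n) x v w :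
  ind_act y (pure3 _ x v w) = pure3 _ (hcomp y x) v w.
Proof.
apply: (lift3_pure (f := ind_fun y)); first exact: ind_fun_lin1.
- by move=> ? ?; exact: pure3_lin2.
- by move=> ? ?; exact: pure3_lin3.
- by move=> *; exact: ind_fun_rel.
Qed.

Definition Ind : cmod (kSym k).
Proof.
refine (@CMod k (kSym k) ind_obj ind_act _ _ _ _).
- move=> m n q a0 y y'; move: q; apply: tens3_ext.
  + exact: ind_act_lin.
  + move=> c q q'; rewrite !ind_act_lin !scalerDr !scalerA [a0 * c]mulrC.
    by rewrite addrACA.
  + move=> x v w; rewrite !ind_act_pure hcomp_linl.
    exact: (pure3_lin1 (@ind_balanced M N a b n) v w).
- by move=> m n y; exact: ind_act_lin.
- move=> n; apply: tens3_ext => [||x v w]; first exact: ind_act_lin.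
    by [].
  by rewrite ind_act_pure hcomp1l.
- move=> m n p y' y; apply: tens3_ext => [||x v w]; first exact: ind_act_lin.
    exact: linear_cmp (ind_act_lin y') (ind_act_lin y).
  by rewrite !ind_act_pure hcompA.
Defined.

End Ind.

(* The boxes of the Young diagram la, a non-increasing sequence of row lengths,
   are numbered row by row: box i lies in row reshape_index la i and column
   reshape_offset la i. *)
Definition row_sum (la : seq nat) : hom (kSym k) (sumn la) (sumn la) :=
  \sum_(s : 'S_(sumn la) |
      [forall i, reshape_index la (s i) == reshape_index la i])
    hperm (kSym k) s.

Definition col_sum (la : seq nat) : hom (kSym k) (sumn la) (sumn la) :=
  \sum_(s : 'S_(sumn la) |
      [forall i, reshape_offset la (s i) == reshape_offset la i])
    (-1) ^+ s *: hperm (kSym k) s.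

Definition young_symmetrizer (la : seq nat) := hcomp (row_sum la) (col_sum la).

Definition young_mulr (la : seq nat) n
    (x : {ffun bij (sumn la) n -> k^o}) : {ffun bij (sumn la) n -> k^o} :=
  hcomp (x : hom (kSym k) (sumn la) n) (young_symmetrizer la).

Lemma young_mulr_linear la n : linear (@young_mulr la n).
Proof. exact: (@hcomp_linl _ (kSym k)). Qed.

HB.instance Definition _ la n := GRing.isLinear.Build k
  {ffun bij (sumn la) n -> k^o} {ffun bij (sumn la) n -> k^o} _
  (@young_mulr la n) (@young_mulr_linear la n).

(* k[Bij(N, n)] c_la for N = |la|: this is the left ideal k[S_N] c_la for n = N,
   and 0 for n <> N. *)
Definition specht_space (la : seq nat) (n : nat) :
    {vspace {ffun bij (sumn la) n -> k^o}} :=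
  limg (linfun (@young_mulr la n)).

Lemma specht_spaceP la n (x : {ffun bij (sumn la) n -> k^o}) :
  reflect (exists y, x = young_mulr y) (x \in specht_space la n).
Proof.
apply: (iffP memv_imgP) => [[y _ ->]|[y ->]]; exists y; rewrite ?lfunE //.
exact: memvf.
Qed.

Definition specht_act la m n (y : hom (kSym k) m n)
    (v : subvs_of (specht_space la m)) : subvs_of (specht_space la n) :=
  vsproj (specht_space la n) (hcomp y (vsval v : hom (kSym k) (sumn la) m)).

Lemma specht_actE la m n (y : hom (kSym k) m n)
    (v : subvs_of (specht_space la m)) :
  vsval (specht_act y v) = hcomp y (vsval v : hom (kSym k) (sumn la) m).
Proof.
apply: vsprojK; have /specht_spaceP[x ->] := subvsP v.
apply/specht_spaceP; exists (hcomp y (x : hom (kSym k) _ _)).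
exact: (@hcompA _ (kSym k)).
Qed.

(* The Specht module of la, placed in degree |la|. *)
Definition Specht (la : seq nat) : cmod (kSym k).
Proof.
refine (@CMod k (kSym k) (fun n => subvs_of (specht_space la n))
  (@specht_act la) _ _ _ _).
- move=> m n v a y y'; apply: subvs_inj; rewrite specht_actE [RHS]linearP.
  apply: etrans (@hcomp_linl _ (kSym k) _ _ _ (vsval v) a y y') _.
  by congr (_ *: _ + _); apply/esym/specht_actE.
- move=> m n y a v v'; apply: subvs_inj; rewrite specht_actE [RHS]linearP.
  rewrite linearP.
  apply: etrans (@hcomp_linr _ (kSym k) _ _ _ y a (vsval v) (vsval v')) _.
  by congr (_ *: _ + _); apply/esym/specht_actE.
- move=> n v; apply: subvs_inj; rewrite specht_actE.
  exact: (@hcomp1l _ (kSym k)).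
- move=> m n p y' y v; apply: subvs_inj; rewrite !specht_actE.
  exact/esym/(@hcompA _ (kSym k) _ _ _ _ y' y).
Defined.

(* has_mult holds for exactly one r in characteristic 0, the default value 0 is
   never used. *)
Definition LR (nu al be : seq nat) : nat :=
  xget 0%N [set r | has_mult (Specht nu)
    (Ind (Specht al) (Specht be) (sumn al) (sumn be)) r].

End SymmetricGroups.

Definition SpechtLie k (la : seq nat) : cmod (CLie k) :=
  cpull (lie_to_sym k) (Specht k la).

Definition T_functor k (M : cmod (CLie k)) : cmod (CLieC k) :=
  cpull (liec_to_lie k) M.

Definition is_partition (la : seq nat) : bool :=
  sorted geq la && (0%N \notin la).

(* Main.v *)
Require Import Defs.
From HB Require Import structures.
From mathcomp Require Import all_boot all_order all_fingroup all_algebra.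
From mathcomp Require Import boolp classical_sets fsbigop ring.
Import Defs.

(** An extension of T(S_la) by T(S_mu) splits linearly, and the failure of a
    linear splitting to commute with the morphisms x of C_LieC is a derivation
    D, that is a linear family of maps with D(y x) = y D(x) + D(y) x; changing
    the splitting changes D by an inner derivation.  Hence Ext^1 is the space of
    derivations modulo inner ones ([Ext1_classification]).

    A morphism of a presented PROP is a combination of composites of
    permutations and of generators tensored with identities ([gspan_all]).
    As S_la and S_mu each live at a single object, D can be nonzero only on
    permutations (if m = n), on 1 + [,] : d + 2 -> d + 1 (if m = n - 1), and on
    1 + c : n -> n + 2 (if m = n + 2).  If m = n, averaging over the symmetric
    group makes D inner, as in Maschke's theorem ([all_inner]).

    In the two other cases let y0 be 1 + [,] or 1 + c.  Then D is the linear map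
    D(y0) : S_la -> S_mu, which transforms under S_d x S_2, the symmetries of
    y0, by the sign of S_2 for the bracket and trivially for the Casimir
    element.  Conversely any such map must be shown to come from a derivation,
    and for this one has to read the coefficients of an arbitrary morphism on
    the translates s y0 t of y0.  The morphisms of a presented PROP have no
    evident basis, so C_LieC is first mapped to a PROP with a combinatorial
    basis that separates these translates: upward Brauer diagrams for c, with
    the bracket sent to 0, and surjections with a digraph on each fibre for the
    bracket, sent to the commutator of an associative product, with c sent to 0.
    The coefficients on translates satisfy the derivation rule because a
    translate factors only through an invertible morphism ([Phi_comp]).

    Both Ext^1 ([Ext1_kernels]) and the tensor product of the statement
    ([bitens_kernels]) are thereby the range of one operator on functions of
    two bijections ([ksym]): it averages over S_d x S_2 and multiplies by Young
    symmetrizers, the one of la being inverted for Ext^1, where S_la is in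
    contravariant position.  This operator is a multiple of a projection, so
    in characteristic 0 its rank is read off its trace ([trace_rank]).  The
    trace does not see the inversion, which proves the isomorphism, and it is a
    sum of products of characters.  Littlewood-Richardson coefficients are
    traces of the same kind ([LR_trace]).  For c the two sums agree directly
    ([cas_dim]); for the bracket the sum over S_d is expanded by Parseval's
    identity into a sum over the partitions rho of n - 2 ([br_dim]).  Parseval's
    identity ([ysym_parseval]) rests on the theory of Young symmetrizers: they
    are orthogonal and quasi-idempotent, and their central averages span the
    class functions because there are at most as many conjugacy classes as
    cycle types. *)

Set Implicit Arguments.
Unset Strict Implicit.
Unset Printing Implicit Defensive.

Import GRing.Theory.
Local Open Scope ring_scope.

(** * Linear maps *)

Section LinearFunctions.
Import VectorInternalTheory.
Variable k : fieldType.

Lemma linear_funN (U V : lmodType k) (f : U -> V) :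
  linear f -> {morph f : u / - u}.
Proof. by move=> lf u; rewrite -scaleN1r linear_funZ // scaleN1r. Qed.

Lemma linear_funB (U V : lmodType k) (f : U -> V) :
  linear f -> {morph f : u v / u - v}.
Proof. by move=> lf u v; rewrite linear_funD // linear_funN. Qed.

Lemma linear_fun_sum (U V : lmodType k) (f : U -> V) I (r : seq I) (Q : pred I) F :
  linear f -> f (\sum_(i <- r | Q i) F i) = \sum_(i <- r | Q i) f (F i).
Proof.
by move=> lf; apply: (big_morph f (linear_funD lf) (linear_fun0 lf)).
Qed.

Lemma linear_comb (U V : lmodType k) (f g : U -> V) c :
  linear f -> linear g -> linear (fun u => c *: f u + g u).
Proof.
move=> lf lg a u v; rewrite lf lg !scalerDr !scalerA [a * c]mulrC.
by rewrite addrACA.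
Qed.

Lemma linear_sum_fun (U V : lmodType k) I (r : seq I) (Q : pred I) (F : I -> U -> V) :
  (forall i, linear (F i)) -> linear (fun u => \sum_(i <- r | Q i) F i u).
Proof.
move=> lF a u v; rewrite scaler_sumr -big_split; apply: eq_bigr => i _.
exact: lF.
Qed.

Lemma linear_scale_fun (U V : lmodType k) c (f : U -> V) :
  linear f -> linear (fun u => c *: f u).
Proof.
by move=> lf a u v; rewrite lf scalerDr !scalerA mulrC.
Qed.

Lemma linear_inj (U V : lmodType k) (f : U -> V) :
  linear f -> (forall u, f u = 0 -> u = 0) -> injective f.
Proof.
move=> lf f0 u v fuv; apply/eqP; rewrite -subr_eq0; apply/eqP/f0.
by rewrite linear_funB // fuv subrr.
Qed.

Definition lin_iso (V W : lmodType k) : Prop :=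
  exists f : V -> W, linear f /\ bijective f.

Lemma lin_iso_sym (V W : lmodType k) : lin_iso V W -> lin_iso W V.
Proof.
move=> [f [lf [g fK gK]]]; exists g; split; last by exists f.
by move=> a u v; apply: (can_inj fK); rewrite gK lf !gK.
Qed.

Lemma lin_iso_trans (U V W : lmodType k) :
  lin_iso U V -> lin_iso V W -> lin_iso U W.
Proof.
move=> [f [lf bf]] [g [lg bg]]; exists (g \o f); split; last exact: ssrfun.bij_comp.
exact: linear_cmp.
Qed.

Lemma vect_row_iso (V : vectType k) n : dim V = n -> lin_iso V 'rV[k]_n.
Proof.
move=> <-; exists v2r; split; first by move=> a u v; exact: linearP.
by exists r2v; [exact: v2rK | exact: r2vK].
Qed.

End LinearFunctions.

(** * Derivations and extensions *)

Section Derivations.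
Variables (k : fieldType) (P : lprop k).
Implicit Types A B : cmod P.

Record derivation A B := Derivation {
  der : forall p q, hom P p q -> cobj A p -> cobj B q;
  der_linl : forall p q a, linear (fun f : hom P p q => der f a);
  der_linr : forall p q (f : hom P p q), linear (der f);
  der_comp : forall p q r (g : hom P q r) (f : hom P p q) a,
    der (hcomp g f) a = cact g (der f a) + der g (cact f a)
}.

Lemma der_id A B (D : derivation A B) p a : der D (hid P p) a = 0.
Proof.
have := der_comp D (hid P p) (hid P p) a.
by rewrite {1}/hid hcomp1l !cact_id -{1}[der D _ _]addr0 => /addrI.
Qed.

Definition der_lin A B (c : k) (D D' : derivation A B) : derivation A B.
Proof.
refine (@Derivation A B (fun p q f a => c *: der D f a + der D' f a) _ _ _).
- by move=> p q a; apply: linear_comb; exact: der_linl.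
- by move=> p q f; apply: linear_comb; exact: der_linr.
- move=> p q r g f a; rewrite !der_comp (linear_funD (cact_linr g)).
  by rewrite (linear_funZ (cact_linr g)) scalerDr addrACA.
Defined.

(** The condition on derivations D and D' that corresponds to a morphism of
    the extensions that they define, with beta on the sub-objects and alpha on
    the quotients. *)
Definition intertwined A B A' B' (beta : cmor B B') (alpha : cmor A A')
    (D : derivation A B) (D' : derivation A' B') : Prop :=
  exists h : forall p, cobj A p -> cobj B' p, (forall p, linear (h p)) /\
    forall p q (f : hom P p q) a,
      cfun beta (der D f a) = der D' f (cfun alpha a) + (cact f (h p a) - h q (cact f a)).

(** The middle term of the extension defined by D: the matrix of f is
    triangular, with D(f) off the diagonal. *)
Definition der_mod A B (D : derivation A B) : cmod P.
Proof.
refine (@CMod k P (fun n => (cobj A n * cobj B n)%type)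
  (fun m n f v => (cact f v.1, cact f v.2 + der D f v.1)) _ _ _ _).
- move=> m n v a f g /=; rewrite !cact_linl (der_linl D v.1).
  by congr (_, _); rewrite /= scalerDr addrACA.
- move=> m n f a u v /=; rewrite !cact_linr (der_linr D f).
  by congr (_, _); rewrite /= scalerDr addrACA.
- by move=> n [u v] /=; rewrite !cact_id der_id addr0.
- move=> m n p g f [u v] /=; rewrite !cact_comp der_comp.
  by rewrite (linear_funD (cact_linr g)) addrA.
Defined.

Definition der_in A B (D : derivation A B) : cmor B (der_mod D).
Proof.
refine (@CMor k P B (der_mod D) (fun n b => (0, b)) _ _).
- by move=> n a u v; apply: injective_projections => //=; rewrite scaler0 addr0.
- move=> m n f v; apply: injective_projections => /=.
    by rewrite (linear_fun0 (cact_linr f)).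
  by rewrite (linear_fun0 (der_linr D f)) addr0.
Defined.

Definition der_out A B (D : derivation A B) : cmor (der_mod D) A.
Proof. by refine (@CMor k P (der_mod D) A (fun n e => e.1) _ _). Defined.

Definition der_ext A B (D : derivation A B) : extension A B.
Proof.
refine (@Extension k P A B (der_mod D) (der_in D) (der_out D) _ _ _).
- by move=> n u v [].
- by move=> n a; exists (a, 0).
- move=> n [a b] /=; split=> [->|[b' [<- _]] //]; by exists b.
Defined.

(** A splitting by linear maps, which need not commute with the morphisms of
    P. *)
Record section A B (E : extension A B) := Section_ {
  sect :> forall p, cobj A p -> cobj (ext_mod E) p;
  sect_lin : forall p, linear (@sect p);
  sectK : forall p a, cfun (ext_out E) (@sect p a) = a
}.

Section OneExtension.
Variables (A B : cmod P) (E : extension A B).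

Definition ext_pre n (e : cobj (ext_mod E) n) : cobj B n :=
  xget 0 [set b | cfun (ext_in E) b = e]%classic.

Lemma ext_preK n (e : cobj (ext_mod E) n) :
  cfun (ext_out E) e = 0 -> cfun (ext_in E) (ext_pre e) = e.
Proof. by move/ext_exact=> [b eb]; rewrite /ext_pre; case: xgetP => [_ -> //|/(_ b)]. Qed.

Lemma ext_inK n (b : cobj B n) : cfun (ext_out E) (cfun (ext_in E) b) = 0.
Proof. by apply/ext_exact; exists b. Qed.

Definition sect_defect (s : section E) p q (f : hom P p q) (a : cobj A p) :=
  cact f (s p a) - s q (cact f a).

Lemma sect_defect_out (s : section E) p q (f : hom P p q) a :
  cfun (ext_out E) (sect_defect s f a) = 0.
Proof. by rewrite (linear_funB (cfun_lin _ (n := q))) cfun_nat !sectK subrr. Qed.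

Definition der_of (s : section E) : derivation A B.
Proof.
refine (@Derivation A B (fun p q f a => ext_pre (sect_defect s f a)) _ _ _).
- move=> p q a c f g; apply: (@ext_inj _ _ _ _ E); rewrite (cfun_lin (ext_in E)) !ext_preK ?sect_defect_out //.
  by rewrite /sect_defect !cact_linl sect_lin scalerBr addrACA opprD.
- move=> p q f c a b; apply: (@ext_inj _ _ _ _ E); rewrite (cfun_lin (ext_in E)) !ext_preK ?sect_defect_out //.
  by rewrite /sect_defect sect_lin !cact_linr sect_lin scalerBr addrACA opprD.
- move=> p q r g f a; apply: (@ext_inj _ _ _ _ E).
  rewrite (linear_funD (cfun_lin _ (n := r))) cfun_nat !ext_preK ?sect_defect_out //.
  by rewrite /sect_defect !cact_comp (linear_funB (cact_linr g)) addrA subrK.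
Defined.

Lemma der_ofE (s : section E) p q (f : hom P p q) a :
  cfun (ext_in E) (der (der_of s) f a) = cact f (s p a) - s q (cact f a).
Proof. exact/ext_preK/sect_defect_out. Qed.

Lemma sect_decomp (s : section E) n e :
  cfun (ext_in E) (ext_pre (e - s n (cfun (ext_out E) e))) = e - s n (cfun (ext_out E) e).
Proof.
by apply: ext_preK; rewrite (linear_funB (cfun_lin _ (n := n))) sectK subrr.
Qed.

End OneExtension.

(** A morphism of extensions is determined by the difference of the two
    splittings, so it exists exactly when some h corrects the difference of
    the derivations. *)
Lemma ext_morphismP A B A' B' (E : extension A B) (E' : extension A' B')
    (beta : cmor B B') (alpha : cmor A A') (s : section E) (s' : section E') :
  ext_morphism E E' beta alpha <-> intertwined beta alpha (der_of s) (der_of s').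
Proof.
split=> [[phi [phi_in phi_out]]|[h [lh hE]]].
- pose d p (a : cobj A p) := cfun phi (s p a) - s' p (cfun alpha a).
  have d0 p a : cfun (ext_out E') (d p a) = 0.
    by rewrite (linear_funB (cfun_lin _ (n := p))) phi_out !sectK subrr.
  exists (fun p a => ext_pre (d p a)); split=> [p c a b|p q f a].
    apply: (@ext_inj _ _ _ _ E'); rewrite (cfun_lin (ext_in E')) !ext_preK //.
    rewrite /d (cfun_lin alpha) !sect_lin (cfun_lin phi).
    by rewrite scalerBr addrACA opprD.
  apply: (@ext_inj _ _ _ _ E'); rewrite -phi_in der_ofE.
  rewrite (linear_funD (cfun_lin (ext_in E') (n := q))).
  rewrite (linear_funB (cfun_lin (ext_in E') (n := q))).
  rewrite der_ofE [cfun _ (cact f (ext_pre _))]cfun_nat !ext_preK // /d !(linear_funB (cact_linr f)).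
  rewrite (linear_funB (cfun_lin phi (n := q))) !cfun_nat.
  set u := cact f (s' p _); set v := s' q _.
  by rewrite opprB addrACA [u + _]addrC subrK addKr.
pose ph n (e : cobj (ext_mod E) n) : cobj (ext_mod E') n :=
  s' n (cfun alpha (cfun (ext_out E) e))
  + cfun (ext_in E') (h n (cfun (ext_out E) e)
                      + cfun beta (ext_pre (e - s n (cfun (ext_out E) e)))).
have lpre n (c : k) (x y : cobj (ext_mod E) n) :
    ext_pre (c *: x + y - s n (cfun (ext_out E) (c *: x + y)))
    = c *: ext_pre (x - s n (cfun (ext_out E) x)) + ext_pre (y - s n (cfun (ext_out E) y)).
  apply: (@ext_inj _ _ _ _ E); rewrite (cfun_lin (ext_in E)) !sect_decomp.
  by rewrite (cfun_lin (ext_out E)) sect_lin scalerBr addrACA opprD.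
have phl n : linear (@ph n).
  move=> c x y; rewrite /ph lpre !(cfun_lin (ext_out E)) !(cfun_lin alpha) sect_lin lh.
  rewrite (cfun_lin beta) addrACA -scalerDr (cfun_lin (ext_in E')) addrACA.
  by rewrite -scalerDr.
have phn p q (f : hom P p q) v : ph q (cact f v) = cact f (ph p v).
  have epre : ext_pre (cact f v - s q (cact f (cfun (ext_out E) v)))
      = cact f (ext_pre (v - s p (cfun (ext_out E) v)))
        + der (der_of s) f (cfun (ext_out E) v).
    apply: (@ext_inj _ _ _ _ E).
    rewrite (linear_funD (cfun_lin _ (n := q))) der_ofE [cfun _ (cact f (ext_pre _))]cfun_nat.
    rewrite sect_decomp -(cfun_nat (ext_out E)) sect_decomp (cfun_nat (ext_out E)).
    by rewrite (linear_funB (cact_linr f)) addrA subrK.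
  rewrite /ph (cfun_nat (ext_out E)) (cfun_nat alpha) epre.
  rewrite [in RHS](linear_funD (cact_linr f)) -(cfun_nat (ext_in E')).
  set a := cfun (ext_out E) v; set b := ext_pre _.
  rewrite (linear_funD (cfun_lin beta (n := q))) hE (cfun_nat beta).
  rewrite [cact f (h p a + _)](linear_funD (cact_linr f)).
  set bb := cact f (cfun beta b).
  set dd := der (der_of s') f _; set hp := cact f (h p a).
  have -> : h q (cact f a) + (bb + (dd + (hp - h q (cact f a)))) = dd + (hp + bb).
    by rewrite addrC -!addrA addNr addr0 addrCA [bb + _]addrC.
  rewrite (linear_funD (cfun_lin (ext_in E') (n := q))) der_ofE addrA.
  by rewrite [X in X + _]addrC subrK.
exists (@CMor k P _ _ ph phl phn); split=> n x /=.
  have oi : cfun (ext_out E) (cfun (ext_in E) x) = 0 by exact: ext_inK.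
  rewrite /ph oi (linear_fun0 (cfun_lin alpha (n := n))) !(linear_fun0 (sect_lin _ (p := n))).
  rewrite (linear_fun0 (lh n)) !add0r subr0; congr (cfun _ (cfun _ _)).
  by apply: (@ext_inj _ _ _ _ E); rewrite ext_preK.
by rewrite /ph (linear_funD (cfun_lin _ (n := n))) sectK ext_inK addr0.
Qed.

(** Equivalently, the splitting can be modified by h into a morphism of
    modules. *)
Definition inner A B (D : derivation A B) : Prop :=
  exists h : forall p, cobj A p -> cobj B p, (forall p, linear (h p)) /\
    forall p q (f : hom P p q) a, der D f a = cact f (h p a) - h q (cact f a).

(** Scaling an extension by c scales its derivation, up to an inner
    derivation; the combination of derivations on the right is c D - D'. *)
Lemma intertwined_cscal A B (c : k) (D D' : derivation A B) :
  intertwined (cscal B c) (cidm A) D D' <-> inner (der_lin (- 1) D' (der_lin (c - 1) D D)).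
Proof.
split=> -[h [lh hE]]; exists h; split=> // p q f a /=; have /= := hE p q f a.
  by rewrite scalerBl scale1r subrK => ->; rewrite scaleN1r addKr.
by rewrite scalerBl scale1r subrK scaleN1r => <-; rewrite addNKr.
Qed.

Lemma intertwined_id A B (D D' : derivation A B) :
  intertwined (cidm B) (cidm A) D D' <-> intertwined (cscal B 1) (cidm A) D D'.
Proof.
by split=> -[h [lh hE]]; exists h; split=> // p q f a; have /= := hE p q f a;
  rewrite scale1r.
Qed.

Lemma ext_morphism_refl A B (E : extension A B) : ext_morphism E E (cidm B) (cidm A).
Proof. by exists (cidm (ext_mod E)). Qed.

Definition der_pair A B B' (D : derivation A B) (D' : derivation A B') :
  derivation A (csum B B').
Proof.
refine (@Derivation A (csum B B') (fun p q f a => (der D f a, der D' f a)) _ _ _).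
- by move=> p q a c f g /=; rewrite !der_linl.
- by move=> p q f c a b /=; rewrite !der_linr.
- by move=> p q r g f a /=; rewrite !der_comp.
Defined.

Definition der_section A B (D : derivation A B) : section (der_ext D).
Proof.
refine (@Section_ A B (der_ext D) (fun p a => (a, 0)) _ _) => //.
by move=> p c a b; apply: injective_projections; rewrite /= ?scaler0 ?addr0.
Defined.

Lemma der_sectionE A B (D : derivation A B) p q (f : hom P p q) a :
  der (der_of (der_section D)) f a = der D f a.
Proof.
apply: (@ext_inj _ _ _ _ (der_ext D)); rewrite der_ofE.
apply: injective_projections; rewrite /= ?subrr //.
by rewrite (linear_fun0 (cact_linr f)) add0r subr0.
Qed.

Definition sum_section A B A' B' (E : extension A B) (E' : extension A' B')
  (s : section E) (s' : section E') : section (ext_sum E E').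
Proof.
refine (@Section_ _ _ (ext_sum E E') (fun p a => (s p a.1, s' p a.2)) _ _).
- by move=> p c a b /=; rewrite !sect_lin.
- by move=> p [a a'] /=; rewrite !sectK.
Defined.

Lemma sum_sectionE A B A' B' (E : extension A B) (E' : extension A' B')
    (s : section E) (s' : section E') p q (f : hom P p q) a :
  der (der_of (sum_section s s')) f a = (der (der_of s) f a.1, der (der_of s') f a.2).
Proof.
apply: (@ext_inj _ _ _ _ (ext_sum E E')); rewrite der_ofE.
by apply: injective_projections; rewrite /= der_ofE.
Qed.

Section Classification.
Variables (A B : cmod P) (V : lmodType k).
Variable sec : forall B' (E : extension A B'), section E.
Variable L : derivation A B -> V.
Hypothesis L_lin : forall c D D', L (der_lin c D D') = c *: L D + L D'.
Hypothesis L_ker : forall D, L D = 0 <-> inner D.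
Hypothesis L_surj : forall v, exists D, L D = v.

Lemma class_eqP c D D' :
  L D' = c *: L D <-> intertwined (cscal B c) (cidm A) D D'.
Proof.
rewrite intertwined_cscal -L_ker !L_lin scaleN1r scalerBl scale1r subrK.
by split=> [->|/eqP]; rewrite ?addNr // addrC subr_eq0 => /eqP.
Qed.

Lemma class_eq1P D D' : L D' = L D <-> intertwined (cidm B) (cidm A) D D'.
Proof. by rewrite intertwined_id -class_eqP scale1r. Qed.

Lemma class_ext_eq D D' :
  (forall p q (f : hom P p q) a, der D f a = der D' f a) -> L D = L D'.
Proof.
move=> e; apply/class_eq1P; exists (fun _ _ => 0).
split=> [p c a b|p q f a /=]; first by rewrite scaler0 addr0.
by rewrite e (linear_fun0 (cact_linr f)) subrr addr0.
Qed.

Lemma class_section (E : extension A B) (s s' : section E) :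
  L (der_of s) = L (der_of s').
Proof. by apply/class_eq1P/ext_morphismP/ext_morphism_refl. Qed.

(** Baer sums become sums of derivations: on the diagonal, the derivation of a
    direct sum of extensions is a pair, and the codiagonal adds its
    components. *)
Lemma intertwined_diag D1 D2 (D : derivation A (csum B B))
    (D12 : derivation (csum A A) (csum B B)) :
  (forall p q (f : hom P p q) a, der D12 f (a, a) = (der D1 f a, der D2 f a)) ->
  intertwined (cidm (csum B B)) (cdiag A) D D12 ->
  intertwined (ccodiag B) (cidm A) D (der_lin 1 D1 D2).
Proof.
move=> D12E [h [lh hE]]; exists (fun p a => (h p a).1 + (h p a).2).
split=> [p c a b|p q f a]; first by rewrite lh /= scalerDr addrACA.
have /= -> := hE p q f a; rewrite D12E /= scale1r (linear_funD (cact_linr f)).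
by rewrite opprD [X in _ = _ + X]addrACA [RHS]addrACA.
Qed.

(** The class of an extension is the value of L at the derivation of any
    splitting.  The target V is kept abstract so that each case of the theorem
    can supply its own description of derivations modulo inner ones. *)
Theorem Ext1_classification : Ext1_iso A B V.
Proof.
exists (fun E => L (der_of (sec E))); split.
- move=> v; have [D <-] := L_surj v; exists (der_ext D).
  rewrite (class_section _ (der_section D)); apply: class_ext_eq.
  exact: der_sectionE.
- move=> E E'; split=> [/esym/class_eq1P e|e]; first exact/ext_morphismP/e.
  by apply/esym/class_eq1P/ext_morphismP.
- move=> E1 E2 E3.
  set s1 := sec E1; set s2 := sec E2; set s3 := sec E3.
  pose s12 := sum_section s1 s2; pose D12 := der_lin 1 (der_of s1) (der_of s2).
  have LD : L D12 = L (der_of s1) + L (der_of s2) by rewrite L_lin scale1r.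
  have D12E p q (f : hom P p q) a :
      der (der_of s12) f (a, a) = (der (der_of s1) f a, der (der_of s2) f a).
    exact: sum_sectionE.
  rewrite -LD; split=> [/class_eq1P [h [lh hE]]|].
    pose D := der_pair (der_of s1) (der_of s2); exists (der_ext D).
    have F12 : intertwined (cidm (csum B B)) (cdiag A) (der_of (der_section D)) (der_of s12).
      exists (fun _ _ => 0); split=> [p c a b|p q f a].
        by rewrite scaler0 addr0.
      rewrite der_sectionE [cfun (cidm _) _]/= (linear_fun0 (cact_linr f)) subrr addr0.
      by rewrite [cfun _ a]/= D12E.
    split; first exact/(ext_morphismP _ _ (der_section D) s12).
    apply/(ext_morphismP _ _ (der_section D) s3).
    exists h; split=> // p q f a; rewrite der_sectionE.
    by have /= <- := hE p q f a; rewrite scale1r.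
  move=> [F [/(ext_morphismP _ _ (sec F) s12) F12 /(ext_morphismP _ _ (sec F) s3) F3]].
  have [h [lh hE]] := intertwined_diag D12E F12; have [h' [lh' hE']] := F3.
  apply/class_eq1P; exists (fun p a => h' p a - h p a).
  split=> [p c a b|p q f a]; first by rewrite lh lh' scalerBr addrACA opprD.
  have /= e := hE p q f a; have /= := hE' p q f a; rewrite e /= => e3.
  rewrite (linear_funB (cact_linr f)); apply/(addIr (cact f (h p a) - h q (cact f a))).
  by rewrite e3 -addrA; congr (_ + _); rewrite opprB addrACA subrK addrAC subrr add0r.
- move=> c E E'; split=> [/class_eqP e|e]; first exact/ext_morphismP/e.
  by apply/class_eqP/ext_morphismP.
Qed.

End Classification.
End Derivations.

(** * Ranks and traces *)

Section FiniteDimension.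
Variable k : fieldType.

Lemma linear_section (V : vectType k) (E : lmodType k) (g : E -> V) :
  linear g -> (forall v, exists e, g e = v) ->
  exists s : V -> E, linear s /\ forall v, g (s v) = v.
Proof.
move=> lg gs; pose b := vbasis {:V}.
have bb : basis_of {:V} b by exact: vbasisP.
pose e i := projT1 (cid (gs b`_i)); have ge i : g (e i) = b`_i := projT2 (cid (gs b`_i)).
exists (fun v => \sum_i coord b i v *: e i); split=> [a u v|v].
  rewrite scaler_sumr -big_split; apply: eq_bigr => i _.
  by rewrite linearP scalerDl scalerA.
rewrite linear_fun_sum // [RHS](coord_basis bb (memvf v)).
by apply: eq_bigr => i _; rewrite (linear_funZ lg) ge.
Qed.

Definition limage (U W : vectType k) (T : U -> W) : {vspace W} := limg (linfun T).

Lemma limageP (U W : vectType k) (T : U -> W) (f : W) :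
  linear T -> reflect (exists g, f = T g) (f \in limage T).
Proof.
move=> lT; pose Tl : {linear U -> W} := HB.pack T (GRing.isLinear.Build k U W _ T lT).
have TE g : linfun T g = T g by exact: (lfunE Tl).
apply: (iffP memv_imgP) => [[g _ ->]|[g ->]]; first by exists g; rewrite TE.
by exists g; rewrite ?memvf ?TE.
Qed.

Lemma limage_iso (V : lmodType k) (U W : vectType k) (T : U -> W) (f : V -> W) :
  linear T -> linear f -> injective f ->
  (forall u, exists v, f v = T u) -> (forall v, exists u, f v = T u) ->
  lin_iso V (subvs_of (limage T)).
Proof.
move=> lT lf fi fT Tf; pose D := limage T.
have fD v : f v \in D by have [u ->] := Tf v; apply/limageP => //; exists u.
exists (fun v => vsproj D (f v)); split.
  by move=> a u v; rewrite lf linearP.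
have pre (w : subvs_of D) : exists v, f v = vsval w.
  by have /(limageP _ lT)[u ->] := subvsP w; exact: fT.
exists (fun w => projT1 (cid (pre w))) => [v|w].
  by apply: fi; case: cid => /= v' ->; rewrite vsprojK.
by case: cid => /= v ->; rewrite vsvalK.
Qed.

Lemma fdelta_decomp (X : finType) (f : {ffun X -> k^o}) :
  f = \sum_x f x *: (fdelta k x : {ffun X -> k^o}).
Proof.
apply/ffunP => y; rewrite sum_ffunE -[LHS](sum_delta f).
by apply: eq_bigr => x _; rewrite !ffunE mulrC.
Qed.

(** An operator with T^2 = kappa T acts by kappa on its image, so its trace is
    kappa times its rank.  This turns all the dimension counts below into
    identities between characters. *)
Lemma trace_rank (X : finType) (T : {ffun X -> k^o} -> {ffun X -> k^o}) kappa :
  linear T -> (forall f, T (T f) = kappa *: T f) ->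
  \sum_x T (fdelta k x) x = kappa * (\dim (limage T))%:R.
Proof.
move=> lT TT; set D := limage T; pose b := vbasis D.
have bb : basis_of D b by exact: vbasisP.
have TD f : T f \in D by apply/limageP => //; exists f.
pose phi i f := coord b i (T f).
have lphi i : linear (phi i : _ -> k^o) by move=> a f g; rewrite /phi lT linearP.
have Tb (i : 'I_(\dim D)) : T b`_i = kappa *: b`_i.
  have /(limageP _ lT)[g ->] : b`_i \in D.
    by apply: (basis_mem bb); apply: mem_nth; rewrite size_tuple.
  exact: TT.
have -> : \sum_x T (fdelta k x) x = \sum_x \sum_i phi i (fdelta k x) * b`_i x.
  apply: eq_bigr => x _; rewrite [T _ in LHS](coord_basis bb (TD _)) sum_ffunE.
  by apply: eq_bigr => i _; rewrite ffunE.
have -> : (\dim D)%:R = \sum_(i < \dim D) 1 :> k by rewrite sumr_const card_ord.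
rewrite exchange_big /= mulr_sumr.
apply: eq_bigr => i _; rewrite mulr1.
transitivity (phi i b`_i).
  rewrite {2}[b`_i]fdelta_decomp (linear_fun_sum (V := k^o) _ _ _ (lphi i)).
  by apply: eq_bigr => x _; rewrite (linear_funZ (V := k^o) (lphi i)) mulrC.
by rewrite /phi Tb linearZ /= coord_free ?eqxx ?mulr1 // (basis_free bb).
Qed.

End FiniteDimension.

Section CharZero.
Variables (k : fieldType) (char0 : [pchar k] =i pred0).

Lemma natr_neq0 n : (0 < n)%N -> n%:R != 0 :> k.
Proof. by move=> n0; rewrite ((pcharf0P k).1 char0) -lt0n. Qed.

Lemma natr_eq m n : m%:R = n%:R :> k -> m = n.
Proof.
wlog mn : m n / (m <= n)%N => [H|e].
  by case/orP: (leq_total m n) => [/H//|/H + /esym e] => /(_ e).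
apply/eqP; rewrite eqn_leq mn /= -subn_eq0 -((pcharf0P k).1 char0).
by rewrite natrB // e subrr.
Qed.

End CharZero.

(** * The algebra of the groupoid of bijections *)

Notation "g ** f" := (bij_comp g f) (at level 40, left associativity).

Definition bij_inv m n (f : bij m n) : bij n m :=
  mk_bij (can_inj (bij_invfK f)) (esym (bij_dim f)).

Lemma bij_invfE m n (f : bij m n) : bij_inv f =1 bij_invf f.
Proof. exact: mk_bijE. Qed.

Lemma bij_compA m n p q (h : bij p q) (g : bij n p) (f : bij m n) :
  h ** (g ** f) = h ** g ** f.
Proof. by apply: bijP => i; rewrite !bij_compE. Qed.

Lemma bij_comp1l m n (f : bij m n) : bij1 n ** f = f.
Proof. by apply: bijP => i; rewrite bij_compE bij1E. Qed.

Lemma bij_comp1r m n (f : bij m n) : f ** bij1 m = f.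
Proof. by apply: bijP => i; rewrite bij_compE bij1E. Qed.

Lemma bij_compVl m n (f : bij m n) : bij_inv f ** f = bij1 m.
Proof. by apply: bijP => i; rewrite bij_compE bij_invfE bij_funK bij1E. Qed.

Lemma bij_compVr m n (f : bij m n) : f ** bij_inv f = bij1 n.
Proof. by apply: bijP => i; rewrite bij_compE bij_invfE bij_invfK bij1E. Qed.

Lemma bij_compKl m n p (g : bij n p) (f : bij m n) : bij_inv g ** (g ** f) = f.
Proof. by rewrite bij_compA bij_compVl bij_comp1l. Qed.

Lemma bij_compKVl m n p (g : bij p n) (f : bij m n) : g ** (bij_inv g ** f) = f.
Proof. by rewrite bij_compA bij_compVr bij_comp1l. Qed.

Lemma bij_compKr m n p (g : bij m n) (f : bij n p) : f ** g ** bij_inv g = f.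
Proof. by rewrite -bij_compA bij_compVr bij_comp1r. Qed.

Lemma bij_compKVr m n p (g : bij n m) (f : bij n p) : f ** bij_inv g ** g = f.
Proof. by rewrite -bij_compA bij_compVl bij_comp1r. Qed.

Lemma bij_inv_uniql m n (f : bij m n) (g : bij n m) : g ** f = bij1 m -> g = bij_inv f.
Proof. by move=> gf; rewrite -[g](bij_compKr f) gf bij_comp1l. Qed.

Lemma bij_invK m n (f : bij m n) : bij_inv (bij_inv f) = f.
Proof. exact/esym/bij_inv_uniql/bij_compVr. Qed.

Lemma bij_inv_comp m n p (g : bij n p) (f : bij m n) :
  bij_inv (g ** f) = bij_inv f ** bij_inv g.
Proof. by apply/esym/bij_inv_uniql; rewrite bij_compA bij_compKVr bij_compVl. Qed.

Lemma bij_inv1 n : bij_inv (bij1 n) = bij1 n.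
Proof. by apply/esym/bij_inv_uniql; rewrite bij_comp1l. Qed.

Lemma bij_sum_comp m n p m' n' p' (g : bij n p) (f : bij m n) (g' : bij n' p')
    (f' : bij m' n') : bij_sum g g' ** bij_sum f f' = bij_sum (g ** f) (g' ** f').
Proof.
by apply: bijP; apply: ord_splitP => i; rewrite !(bij_compE, bij_suml, bij_sumr).
Qed.

Lemma bij_sum1 m n : bij_sum (bij1 m) (bij1 n) = bij1 (m + n).
Proof.
by apply: bijP; apply: ord_splitP => i; rewrite !(bij_suml, bij_sumr, bij1E).
Qed.

Lemma bij_inv_sum m n m' n' (f : bij m n) (f' : bij m' n') :
  bij_inv (bij_sum f f') = bij_sum (bij_inv f) (bij_inv f').
Proof. by apply/esym/bij_inv_uniql; rewrite bij_sum_comp !bij_compVl bij_sum1. Qed.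

Lemma bijVK m n (f : bij m n) : cancel (bij_inv f) f.
Proof. by move=> i; rewrite bij_invfE bij_invfK. Qed.

Lemma bijKV m n (f : bij m n) : cancel f (bij_inv f).
Proof. by move=> i; rewrite bij_invfE bij_funK. Qed.

Lemma bij_comp_eql m n p (g : bij n p) (f : bij m n) h : (g ** f == h) = (f == bij_inv g ** h).
Proof. by apply/eqP/eqP => [<-|->]; rewrite ?bij_compKl ?bij_compKVl. Qed.

Lemma bij_comp_eqr m n p (g : bij n p) (f : bij m n) h : (g ** f == h) = (g == h ** bij_inv f).
Proof. by apply/eqP/eqP => [<-|->]; rewrite ?bij_compKr ?bij_compKVr. Qed.

Section Reindex.
Variable V : nmodType.

Lemma sum_bijl m n p (h : bij n p) (F : bij m p -> V) :
  \sum_(g : bij m p) F g = \sum_(g : bij m n) F (h ** g).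
Proof.
rewrite (reindex (fun g : bij m n => h ** g)) //; apply: onW_bij.
by exists (fun g => bij_inv h ** g) => g; rewrite ?bij_compKl ?bij_compKVl.
Qed.

Lemma sum_bijr m n p (h : bij m n) (F : bij m p -> V) :
  \sum_(g : bij m p) F g = \sum_(g : bij n p) F (g ** h).
Proof.
rewrite (reindex (fun g : bij n p => g ** h)) //; apply: onW_bij.
by exists (fun g => g ** bij_inv h) => g; rewrite ?bij_compKr ?bij_compKVr.
Qed.

Lemma sum_bijV m n (F : bij m n -> V) :
  \sum_(g : bij m n) F g = \sum_(g : bij n m) F (bij_inv g).
Proof.
rewrite (reindex (fun g : bij n m => bij_inv g)) //; apply: onW_bij.
by exists (fun g : bij m n => bij_inv g) => g; rewrite bij_invK.
Qed.
End Reindex.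

Section GroupoidAlgebra.
Variable k : fieldType.
Local Notation ga m n := {ffun bij m n -> k^o}.

Definition kmul m n p (x : ga n p) (y : ga m n) : ga m p :=
  hcomp (x : hom (kSym k) n p) (y : hom (kSym k) m n).
Definition kdelta m n (g : bij m n) : ga m n := fdelta k g.
Local Notation "x \k* y" := (kmul x y) (at level 40, left associativity).

Lemma kmul_linl m n p (y : ga m n) : linear (fun x : ga n p => x \k* y).
Proof. exact: (@hcomp_linl k (kSym k)). Qed.
Lemma kmul_linr m n p (x : ga n p) : linear (fun y : ga m n => x \k* y).
Proof. exact: (@hcomp_linr k (kSym k)). Qed.
Lemma kmulZl m n p a (x : ga n p) (y : ga m n) : (a *: x) \k* y = a *: (x \k* y).
Proof. exact: (linear_funZ (kmul_linl y)). Qed.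
Lemma kmulZr m n p a (x : ga n p) (y : ga m n) : x \k* (a *: y) = a *: (x \k* y).
Proof. exact: (linear_funZ (kmul_linr x)). Qed.
Lemma kmul0l m n p (y : ga m n) : (0 : ga n p) \k* y = 0.
Proof. exact: (linear_fun0 (kmul_linl y)). Qed.
Lemma kmul0r m n p (x : ga n p) : x \k* (0 : ga m n) = 0.
Proof. exact: (linear_fun0 (kmul_linr x)). Qed.
Lemma kmul_sumDl I (r : seq I) (Q : pred I) m n p (F : I -> ga n p) (y : ga m n) :
  (\sum_(i <- r | Q i) F i) \k* y = \sum_(i <- r | Q i) F i \k* y.
Proof. exact: (linear_fun_sum r Q F (kmul_linl y)). Qed.
Lemma kmul_sumDr I (r : seq I) (Q : pred I) m n p (x : ga n p) (F : I -> ga m n) :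
  x \k* (\sum_(i <- r | Q i) F i) = \sum_(i <- r | Q i) x \k* F i.
Proof. exact: (linear_fun_sum r Q F (kmul_linr x)). Qed.
Lemma kmulA m n p q (x : ga p q) (y : ga n p) (z : ga m n) :
  x \k* (y \k* z) = x \k* y \k* z.
Proof. exact: (@hcompA k (kSym k)). Qed.
Lemma kmul1l m n (x : ga m n) : kdelta (bij1 n) \k* x = x.
Proof. exact: (@hcomp1l k (kSym k)). Qed.
Lemma kmul1r m n (x : ga m n) : x \k* kdelta (bij1 m) = x.
Proof. exact: (@hcomp1r k (kSym k)). Qed.
Lemma kdeltaM m n p (g : bij n p) (f : bij m n) : kdelta g \k* kdelta f = kdelta (g ** f).
Proof. exact/esym/(@hbij_comp k (kSym k)). Qed.

Lemma kmulE m n p (x : ga n p) (y : ga m n) c :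
  (x \k* y) c = \sum_(b : bij m n) x (c ** bij_inv b) * y b.
Proof.
rewrite /kmul /= /bilext ffunE exchange_big; apply: eq_bigr => b _ /=.
rewrite (bigD1 (c ** bij_inv b)) //= big1 ?addr0 => [|a]; rewrite bij_comp_eqr.
  by rewrite eqxx mulr1.
by move/negbTE->; rewrite mulr0.
Qed.

Lemma kmulE' m n p (x : ga n p) (y : ga m n) c :
  (x \k* y) c = \sum_(a : bij n p) x a * y (bij_inv a ** c).
Proof.
rewrite kmulE sum_bijV (sum_bijl (bij_inv c)).
by apply: eq_bigr => b _; rewrite bij_invK bij_compKVl bij_inv_comp bij_invK.
Qed.

Lemma kdeltaE m n (g h : bij m n) : kdelta g h = (h == g)%:R.
Proof. by rewrite ffunE. Qed.

Lemma kmul_deltal m n p (g : bij n p) (y : ga m n) c :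
  (kdelta g \k* y) c = y (bij_inv g ** c).
Proof.
rewrite kmulE' (bigD1 g) //= kdeltaE eqxx mul1r big1 ?addr0 // => a /negbTE ga.
by rewrite kdeltaE ga mul0r.
Qed.

Lemma kmul_deltar m n p (x : ga n p) (g : bij m n) c :
  (x \k* kdelta g) c = x (c ** bij_inv g).
Proof.
rewrite kmulE (bigD1 g) //= kdeltaE eqxx mulr1 big1 ?addr0 // => a /negbTE ga.
by rewrite kdeltaE ga mulr0.
Qed.

Lemma kdelta_decomp m n (x : ga m n) : x = \sum_g x g *: kdelta g.
Proof. exact: fdelta_decomp. Qed.

Lemma kmul_suml m n p (x : ga n p) (y : ga m n) :
  x \k* y = \sum_g x g *: (kdelta g \k* y).
Proof.
rewrite {1}[x]kdelta_decomp kmul_sumDl.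
by apply: eq_bigr => g _; rewrite kmulZl.
Qed.

Lemma kmul_sumr m n p (x : ga n p) (y : ga m n) :
  x \k* y = \sum_g y g *: (x \k* kdelta g).
Proof.
rewrite {1}[y]kdelta_decomp kmul_sumDr.
by apply: eq_bigr => g _; rewrite kmulZr.
Qed.

(** The anti-involution that inverts group elements, exchanging left and right
    modules. *)
Definition kstar m n (x : ga m n) : ga n m := [ffun g => x (bij_inv g)].

Lemma kstarK m n (x : ga m n) : kstar (kstar x) = x.
Proof. by apply/ffunP => g; rewrite !ffunE bij_invK. Qed.

Lemma kstarM m n p (x : ga n p) (y : ga m n) : kstar (x \k* y) = kstar y \k* kstar x.
Proof.
apply/ffunP => c; rewrite ffunE kmulE kmulE' sum_bijV; apply: eq_bigr => b _.
by rewrite !ffunE mulrC bij_inv_comp !bij_invK.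
Qed.

Lemma kstar_lin m n : linear (@kstar m n).
Proof. by move=> a x y; apply/ffunP => g; rewrite !ffunE. Qed.

(** For x = ysym la and N = p this is ynorm times the character of the Specht
    module.  Summing over the bijections from N to p, and not over a group,
    gives it a meaning at every p, with no transport along an equality N = p.
    *)
Definition chi N (x : ga N N) p (h : bij p p) : k :=
  \sum_(g : bij N p) x (bij_inv g ** bij_inv h ** g).

Lemma chi_conj N (x : ga N N) p q (g : bij q p) (h : bij p q) :
  chi x (g ** h) = chi x (h ** g).
Proof.
rewrite /chi (sum_bijl g); apply: eq_bigr => l _.
by rewrite !bij_inv_comp -!bij_compA !bij_compKl !bij_compA.
Qed.

(** Traces do not see the order of a product; applied to the row and column
    factors of a Young symmetrizer, this makes its character invariant under
    kstar. *)
Lemma chi_mulC N M (x : ga N M) (y : ga M N) p (h : bij p p) :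
  chi (x \k* y) h = chi (y \k* x) h.
Proof.
rewrite /chi; under eq_bigr => g _ do rewrite kmulE.
under [RHS]eq_bigr => g _ do rewrite kmulE'.
rewrite exchange_big [RHS]exchange_big /=; apply: eq_bigr => l _.
rewrite [RHS](sum_bijr (bij_inv l)); apply: eq_bigr => g _.
by rewrite mulrC bij_inv_comp bij_invK -!bij_compA bij_compKl.
Qed.

Lemma chi_star N (x : ga N N) p (h : bij p p) : chi (kstar x) h = chi x (bij_inv h).
Proof.
by apply: eq_bigr => g _; rewrite ffunE !bij_inv_comp !bij_invK bij_compA.
Qed.

Lemma kdim0 m n (x : ga m n) : m != n -> x = 0.
Proof. by move=> mn; apply/ffunP => g; case/eqP: mn; exact: bij_dim g. Qed.

Lemma kmul_trC m n (x : ga m n) (y : ga n m) :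
  (x \k* y) (bij1 n) = (y \k* x) (bij1 m).
Proof.
rewrite kmulE kmulE'; apply: eq_bigr => g _.
by rewrite mulrC bij_comp1l bij_comp1r.
Qed.

End GroupoidAlgebra.

(** * Boxes of Young diagrams *)

Notation row la i := (reshape_index la i).
Notation col la i := (reshape_offset la i).

Section Boxes.
Variable la : seq nat.
Hypothesis part_la : is_partition la.
Local Notation N := (sumn la).

Lemma rowcol_inj (i j : nat) : row la i = row la j -> col la i = col la j -> i = j.
Proof. by move=> er ec; rewrite -(reshape_indexK la i) er ec reshape_indexK. Qed.

Lemma box_exists r c : (c < nth 0%N la r)%N ->
  exists i : 'I_N, row la i = r /\ col la i = c.
Proof.
move=> cr; exists (Ordinal (flatten_indexP cr)) => /=.
by rewrite flatten_indexKl // flatten_indexKr.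
Qed.

Lemma part_nonincr r s : (r <= s)%N -> (nth 0%N la s <= nth 0%N la r)%N.
Proof.
case/andP: part_la => sla _ rs; case: (ltnP s (size la)) => [sl|/(nth_default 0%N)-> //].
have tr : transitive geq by move=> x y z xy yz; exact: leq_trans yz xy.
by apply: (sorted_leq_nth tr (fun x => leqnn x) 0%N sla); rewrite ?inE // (leq_ltn_trans rs).
Qed.

(** Row lengths decrease, so a column meets an initial segment of the rows. *)
Lemma box_above (i : 'I_N) r : (r <= row la i)%N ->
  exists j : 'I_N, row la j = r /\ col la j = col la i.
Proof.
move=> ri; apply: box_exists; apply: leq_trans (part_nonincr ri).
exact/reshape_offsetP/ltn_ord.
Qed.

(** The function k |-> la_0 + ... + la_(k - 1), which carries the dominance
    order. *)
Definition rows_below k := #|[set i : 'I_N | (row la i < k)%N]|.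

Lemma rows_belowS k : (rows_below k.+1 = rows_below k + nth 0 la k)%N.
Proof.
rewrite /rows_below -(cardsID [set i : 'I_N | (row la i < k)%N]).
congr (_ + _)%N; first by apply: eq_card => i; rewrite !inE andbC ltnS andb_idr // => /ltnW.
have fl (c : 'I_(nth 0%N la k)) : (flatten_index la k c < N)%N by apply: flatten_indexP.
rewrite -[RHS]card_ord -(card_imset _ (f := fun c => Ordinal (fl c))).
  apply: eq_card => i; rewrite !inE -leqNgt ltnS -eqn_leq.
  apply/eqP/imsetP => [ki|[c _ ->]] /=; last by rewrite flatten_indexKl.
  have ck : (col la i < nth 0 la k)%N by rewrite ki; exact/reshape_offsetP/ltn_ord.
  by exists (Ordinal ck) => //; apply/val_inj; rewrite /= ki reshape_indexK.
move=> c d /(congr1 (fun i : 'I_N => col la i)) /=.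
by rewrite !flatten_indexKr // => /val_inj.
Qed.

(** By [box_above], a column with a box in row k or below meets each of the
    first k rows. *)
Lemma column_full k j :
  (forall i : 'I_N, col la i = j -> (row la i < k)%N) \/
  (k <= #|[set i : 'I_N | (row la i < k)%N & col la i == j]|)%N.
Proof.
have [|] := boolP [exists i : 'I_N, (col la i == j) && (k <= row la i)%N]; last first.
  move=> /existsPn h; left => i ij; have := h i.
  by rewrite ij eqxx /= -ltnNge.
move=> /existsP[i /andP[/eqP ij ki]]; right.
have ex (r : 'I_k) : exists y : 'I_N, row la y = r /\ col la y = col la i.
  by apply: box_above; rewrite ltnW // (leq_trans (ltn_ord r)).
pose f r := projT1 (cid (ex r)).
have fE r : row la (f r) = r /\ col la (f r) = col la i := projT2 (cid (ex r)).
rewrite -[leqLHS]card_ord -(card_imset _ (f := f)); last first.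
  by move=> r s /(congr1 (fun y : 'I_N => row la y)); rewrite !(fE _).1 => /val_inj.
apply/subset_leq_card/fintype.subsetP => y /imsetP[r _ ->]; rewrite inE (fE r).1 (fE r).2 ij.
by rewrite ltn_ord eqxx.
Qed.

End Boxes.

Lemma part_eq la mu : is_partition la -> is_partition mu ->
  (forall k, rows_below la k = rows_below mu k) -> la = mu.
Proof.
move=> /andP[_ zla] /andP[_ zmu] e.
have en k : nth 0%N la k = nth 0%N mu k.
  by have := e k.+1; rewrite !rows_belowS e => /addnI.
have sz l l' : 0%N \notin l' -> nth 0%N l =1 nth 0%N l' -> (size l' <= size l)%N.
  move=> zl' ll'; rewrite leqNgt; apply/negP => lt; case/negP: zl'.
  by rewrite -[X in X \in _](nth_default 0%N (leqnn (size l))) ll' mem_nth.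
by apply: (@eq_from_nth _ 0%N) => // ; apply/eqP; rewrite eqn_leq !sz // => x; rewrite en.
Qed.

Section RowColumn.
Variables la mu : seq nat.
Hypotheses (part_la : is_partition la) (part_mu : is_partition mu).
Local Notation N := (sumn la).
Local Notation M := (sumn mu).
Variable g : bij N M.
Hypothesis sep : forall x y : 'I_N, row la x = row la y ->
  col mu (g x) = col mu (g y) -> x = y.

Definition crossing k j := #|[set x : 'I_N | (row la x < k)%N & col mu (g x) == j]|.
Definition boxes k j := #|[set y : 'I_M | (row mu y < k)%N & col mu y == j]|.

(** The combinatorial core of dominance: the boxes of the first k rows of la
    that g sends to column j of mu lie in distinct rows of la, so there are at
    most k of them, and at most as many as the boxes of column j. *)
Lemma crossing_le k j : (crossing k j <= boxes k j)%N.
Proof.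
have [full|le_k] := column_full part_mu k j.
  rewrite /crossing -(card_imset _ (@bij_inj _ _ g)); apply: subset_leq_card.
  apply/fintype.subsetP => y /imsetP[x]; rewrite !inE => /andP[_ xj] ->.
  by rewrite xj full //; apply/eqP.
apply: leq_trans le_k; rewrite -[leqRHS]card_ord.
have [k0|k0] := posnP k.
  rewrite /crossing k0 eq_card0 // => x; by rewrite !inE ltn0.
pose r (x : 'I_N) : 'I_k := insubd (Ordinal k0) (row la x).
rewrite /crossing -(@card_in_imset _ _ r); first exact: max_card.
move=> x y; rewrite !inE => /andP[xk /eqP xj] /andP[yk /eqP yj].
move=> /(congr1 val); rewrite !val_insubd xk yk => exy.
by apply: sep; rewrite // xj yj.
Qed.

Lemma card_by_column (T : finType) (A : {set T}) (q : T -> nat) b :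
  (forall x, (q x < b)%N) -> #|A| = (\sum_(j < b) #|[set x in A | q x == j]|)%N.
Proof.
move=> qb; pose q' x := Ordinal (qb x).
rewrite -sum1_card (partition_big q' xpredT) //=; apply: eq_bigr => j _.
by rewrite -sum1_card; apply: eq_bigl => x; rewrite !inE -val_eqE.
Qed.

Lemma col_bound (y : 'I_M) : (col mu y < M)%N.
Proof. by apply: leq_ltn_trans (ltn_ord y); rewrite /reshape_offset leq_subr. Qed.

Lemma rows_below_crossing k : rows_below la k = (\sum_(j < M) crossing k j)%N.
Proof.
rewrite /rows_below (card_by_column _ (fun x => col_bound (g x))).
by apply: eq_bigr => j _; apply: eq_card => x; rewrite !inE.
Qed.

Lemma rows_below_boxes k : rows_below mu k = (\sum_(j < M) boxes k j)%N.
Proof.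
rewrite /rows_below (card_by_column _ col_bound).
by apply: eq_bigr => j _; apply: eq_card => x; rewrite !inE.
Qed.

(** The inequalities of [crossing_le] are added over the columns. *)
Lemma dominated k : (rows_below la k <= rows_below mu k)%N.
Proof.
rewrite rows_below_crossing rows_below_boxes.
by apply: leq_sum => j _; exact: crossing_le.
Qed.

End RowColumn.

Section VonNeumann.
Variable la : seq nat.
Hypothesis part_la : is_partition la.
Local Notation N := (sumn la).
Variable g : bij N N.
Hypothesis sep : forall x y : 'I_N, row la x = row la y ->
  col la (g x) = col la (g y) -> x = y.

Lemma crossing_eq k (j : 'I_N) : crossing g k j = boxes la k j.
Proof.
have := rows_below_crossing g k; rewrite rows_below_boxes => /esym/eqP.
rewrite (eq_sym) => /eqP e.
have : (forall j : 'I_N, true -> crossing g k j <= boxes la k j ?= iff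
         (crossing g k j == boxes la k j))%N.
  by move=> i _; split; [exact: crossing_le|].
move/leqif_sum => [_]; rewrite e eqxx => /esym/forallP/(_ j)/implyP/(_ isT).
by move/eqP.
Qed.

(** For la = mu the inequalities of [crossing_le] add up to an equality, so
    they are equalities; counting row by row then shows that the box in the
    row of x and in the column of g x exists. *)
Lemma crossing_box (x : 'I_N) : exists y : 'I_N, row la y = row la x /\ col la y = col la (g x).
Proof.
pose k := row la x; pose j : 'I_N := Ordinal (col_bound (g x)).
have step (q : 'I_N -> nat) : (#|[set z : 'I_N | (row la z < k.+1)%N & q z == j]|
   = #|[set z : 'I_N | (row la z < k)%N & q z == j]|
     + #|[set z : 'I_N | (row la z == k) && (q z == j)]|)%N.
  rewrite -(cardsID [set z : 'I_N | (row la z < k)%N]); congr (_ + _)%N; apply: eq_card => z;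
  rewrite !inE ltnS; case: ltngtP => //=; rewrite ?andbT ?andbF //.
have : (0 < #|[set z : 'I_N | (row la z == k) && (col la (g z) == j)]|)%N.
  by apply/card_gt0P; exists x; rewrite inE !eqxx.
have -> : #|[set z : 'I_N | (row la z == k) && (col la (g z) == j)]|
        = #|[set z : 'I_N | (row la z == k) && (col la z == j)]|.
  have := crossing_eq k.+1 j; rewrite /crossing /boxes !step.
  by have := crossing_eq k j; rewrite /crossing /boxes => -> /addnI.
by move=> /card_gt0P[y]; rewrite inE => /andP[/eqP yk /eqP yj]; exists y.
Qed.

(** Von Neumann's lemma: in the factorization of g, p is the row permutation
    and g p^-1 the column permutation. *)
Lemma row_column_factor : exists p : bij N N,
  (forall x, row la (p x) = row la x) /\ (forall x, col la (p x) = col la (g x)).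
Proof.
pose p x := projT1 (cid (crossing_box x)).
have pE x : row la (p x) = row la x /\ col la (p x) = col la (g x) :=
  projT2 (cid (crossing_box x)).
have pI : injective p.
  move=> x y pxy; apply: sep; first by rewrite -(pE x).1 pxy (pE y).1.
  by rewrite -(pE x).2 pxy (pE y).2.
by exists (mk_bij pI erefl); split=> x; rewrite mk_bijE ?(pE x).1 ?(pE x).2.
Qed.

End VonNeumann.

(** * Young symmetrizers *)

Notation "x \k* y" := (kmul x y) (at level 40, left associativity).

Section SignOfBijections.
Variable k : fieldType.

Definition bij_perm n (g : bij n n) : 'S_n := perm (@bij_inj _ _ g).

Lemma bij_permK n : cancel (@bij_perm n) (@perm_bij n).
Proof. by move=> g; apply: bijP => i; rewrite mk_bijE permE. Qed.

Lemma perm_bijK n : cancel (@perm_bij n) (@bij_perm n).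
Proof. by move=> s; apply/permP => i; rewrite permE mk_bijE. Qed.

Definition bsgn n (g : bij n n) : k := (-1) ^+ bij_perm g.

Lemma bsgnM n (g h : bij n n) : bsgn (g ** h) = bsgn g * bsgn h.
Proof.
rewrite /bsgn; have -> : bij_perm (g ** h) = (bij_perm h * bij_perm g)%g.
  by apply/permP => i; rewrite permM !permE bij_compE.
by rewrite odd_permM signr_addb mulrC.
Qed.

Lemma bsgn1 n : bsgn (bij1 n) = 1.
Proof.
rewrite /bsgn (_ : bij_perm _ = 1%g) ?odd_perm1 //.
by apply/permP => i; rewrite permE bij1E perm1.
Qed.

Lemma bsgn_sq n (g : bij n n) : bsgn g * bsgn g = 1.
Proof. by rewrite /bsgn -expr2 sqrr_sign. Qed.

Lemma bsgnV n (g : bij n n) : bsgn (bij_inv g) = bsgn g.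
Proof.
by rewrite -[RHS]mul1r -(bsgn1 n) -(bij_compVl g) bsgnM -mulrA bsgn_sq mulr1.
Qed.

Lemma bsgn_tperm n (x y : 'I_n) : x != y -> bsgn (perm_bij (tperm x y)) = -1.
Proof. by move=> xy; rewrite /bsgn perm_bijK odd_tperm xy expr1. Qed.

End SignOfBijections.

Lemma perm_bijE n (s : 'S_n) i : perm_bij s i = s i.
Proof. exact: mk_bijE. Qed.

Lemma tperm_conj m n (g : bij m n) (x y : 'I_n) :
  perm_bij (tperm x y) ** g = g ** perm_bij (tperm (bij_inv g x) (bij_inv g y)).
Proof.
have e z : g (bij_inv g z) = z by rewrite -bij_compE bij_compVr bij1E.
apply: bijP => i; rewrite !bij_compE !perm_bijE inj_tperm ?e //; exact: bij_inj.
Qed.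

(** Locking keeps rewriting from seeing a product inside the Young
    symmetrizer. *)
Fact young_key : unit. Proof. exact: tt. Qed.

Section YoungSymmetrizer.
Variables (k : fieldType) (char0 : [pchar k] =i pred0).
Local Notation ga m n := {ffun bij m n -> k^o}.
Local Notation "'\d' g" := (kdelta k g) (at level 10).

Definition rowp la (g : bij (sumn la) (sumn la)) := [forall i, row la (g i) == row la i].
Definition colp la (g : bij (sumn la) (sumn la)) := [forall i, col la (g i) == col la i].

Definition rsum la : ga (sumn la) (sumn la) :=
  locked_with young_key [ffun g => (rowp g)%:R].
Definition csum_ la : ga (sumn la) (sumn la) :=
  locked_with young_key [ffun g => (colp g)%:R * bsgn k g].
Definition ysym la : ga (sumn la) (sumn la) :=
  locked_with young_key (rsum la \k* csum_ la).

Lemma rsumE la g : rsum la g = (rowp g)%:R.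
Proof. by rewrite /rsum unlock ffunE. Qed.

Lemma csumE la g : csum_ la g = (colp g)%:R * bsgn k g.
Proof. by rewrite /csum_ unlock ffunE. Qed.

Lemma sum_perm_bij n (Q : pred 'S_n) (F : 'S_n -> k) (g : bij n n) :
  ((\sum_(s : 'S_n | Q s) F s *: hperm (kSym k) s : hom (kSym k) n n) : ga n n) g
  = if Q (bij_perm g) then F (bij_perm g) else 0.
Proof.
rewrite /= sum_ffunE (big_mkcond Q) (bigD1 (bij_perm g)) //= big1 ?addr0 => [|s sg].
  by case: ifP => // _; rewrite !ffunE bij_permK eqxx; exact: mulr1.
case: ifP => // _; rewrite !ffunE; case: eqP => [e|_]; last exact: mulr0.
by case/eqP: sg; rewrite e /= perm_bijK.
Qed.

Lemma ysym_def la : ysym la = rsum la \k* csum_ la.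
Proof. by rewrite /ysym unlock. Qed.

Lemma row_sumE la : row_sum k la = rsum la.
Proof.
apply/ffunP => g; rewrite rsumE.
have := sum_perm_bij [pred s : 'S_(sumn la) | [forall i, row la (s i) == row la i]] (fun=> 1) g.
rewrite /row_sum; under eq_bigr do rewrite scale1r.
move->; rewrite /= (_ : [forall i, _] = rowp g); first by case: rowp.
by apply: eq_forallb => i; rewrite permE.
Qed.

Lemma col_sumE la : col_sum k la = csum_ la.
Proof.
apply/ffunP => g; rewrite csumE.
have := sum_perm_bij [pred s : 'S_(sumn la) | [forall i, col la (s i) == col la i]]
  (fun s => (-1) ^+ s) g.
rewrite /col_sum => ->; rewrite /= (_ : [forall i, _] = colp g).
  by case: colp; rewrite ?mul1r ?mul0r.
by apply: eq_forallb => i; rewrite permE.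
Qed.

Lemma ysymE la : ysym la = young_symmetrizer k la.
Proof. by rewrite /young_symmetrizer row_sumE col_sumE ysym_def. Qed.

Lemma rowpM la (g h : bij (sumn la) (sumn la)) : rowp h -> rowp (g ** h) = rowp g.
Proof.
move=> /forallP hr; apply/forallP/forallP => gr i; last first.
  by rewrite bij_compE (eqP (gr _)).
by have := gr (bij_inv h i); rewrite bij_compE -(eqP (hr (bij_inv h i))) bijVK.
Qed.

Lemma colpM la (g h : bij (sumn la) (sumn la)) : colp h -> colp (g ** h) = colp g.
Proof.
move=> /forallP hr; apply/forallP/forallP => gr i; last first.
  by rewrite bij_compE (eqP (gr _)).
by have := gr (bij_inv h i); rewrite bij_compE -(eqP (hr (bij_inv h i))) bijVK.
Qed.

Lemma rowp1 la : rowp (bij1 (sumn la)).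
Proof. by apply/forallP => i; rewrite bij1E. Qed.

Lemma colp1 la : colp (bij1 (sumn la)).
Proof. by apply/forallP => i; rewrite bij1E. Qed.

Lemma rowpV la (g : bij (sumn la) (sumn la)) : rowp (bij_inv g) = rowp g.
Proof.
have V h : rowp h -> rowp (bij_inv h) by move=> hr; rewrite -(rowpM _ hr) bij_compVl rowp1.
by apply/idP/idP => [/V|/V //]; rewrite bij_invK.
Qed.

Lemma colpV la (g : bij (sumn la) (sumn la)) : colp (bij_inv g) = colp g.
Proof.
have V h : colp h -> colp (bij_inv h) by move=> hr; rewrite -(colpM _ hr) bij_compVl colp1.
by apply/idP/idP => [/V|/V //]; rewrite bij_invK.
Qed.

Lemma rsum_star la : kstar (rsum la) = rsum la.
Proof. by apply/ffunP => g; rewrite ffunE !rsumE rowpV. Qed.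

Lemma csum_star la : kstar (csum_ la) = csum_ la.
Proof. by apply/ffunP => g; rewrite ffunE !csumE colpV bsgnV. Qed.

Lemma rsum_mulr la g : rowp g -> rsum la \k* \d g = rsum la.
Proof.
move=> gr; apply/ffunP => c; rewrite kmul_deltar !rsumE rowpM //.
by rewrite rowpV.
Qed.

Lemma csum_mull la g : colp g -> \d g \k* csum_ la = bsgn k g *: csum_ la.
Proof.
move=> gc; apply/ffunP => c; rewrite kmul_deltal [RHS]ffunE !csumE bsgnM bsgnV.
have -> : colp (bij_inv g ** c) = colp c.
  rewrite -colpV bij_inv_comp bij_invK colpM ?colpV //.
by rewrite /GRing.scale /= mulrCA.
Qed.

Lemma ysym_coef1 la : ysym la (bij1 _) = 1.
Proof.
rewrite ysym_def kmulE' (bigD1 (bij1 _)) //= big1 ?addr0.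
  by rewrite bij_comp1r bij_inv1 rsumE csumE rowp1 colp1 bsgn1 !mulr1.
move=> g gn1; rewrite rsumE csumE bij_comp1r colpV.
have [gr|] := boolP (rowp g); last by rewrite mul0r.
have [gc|] := boolP (colp g); last by rewrite mul0r mulr0.
case/eqP: gn1; apply: bijP => i; rewrite bij1E; apply/val_inj.
by apply: (@rowcol_inj la); apply/eqP; [exact: (forallP gr)|exact: (forallP gc)].
Qed.

(** The transposition of x and y is even on the row side and odd on the column
    side, so the product is its own opposite. *)
Lemma sandwich_delta0 la mu (g : bij (sumn mu) (sumn la)) (x y : 'I_(sumn la)) :
  x != y -> row la x = row la y -> col mu (bij_inv g x) = col mu (bij_inv g y) ->
  rsum la \k* \d g \k* csum_ mu = 0.
Proof.
move=> xy rxy cxy; set t := perm_bij (tperm x y).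
pose t' := perm_bij (tperm (bij_inv g x) (bij_inv g y)).
have tr : rowp t by apply/forallP => i; rewrite perm_bijE; case: tpermP => [->|->|]; rewrite ?rxy.
have tc : colp t' by apply/forallP => i; rewrite perm_bijE; case: tpermP => [->|->|]; rewrite ?cxy.
set z := _ \k* _; have ez : z = - z.
  rewrite -scaleN1r -(bsgn_tperm k (x := bij_inv g x) (y := bij_inv g y)); last first.
    by rewrite (inj_eq (@bij_inj _ _ _)).
  rewrite /z -kmulZr -csum_mull //.
  by rewrite kmulA -[_ \k* \d g \k* \d t']kmulA kdeltaM -tperm_conj -kdeltaM kmulA rsum_mulr.
have : 2%:R *: z = 0 by rewrite scaler_nat mulr2n {2}ez subrr.
by move/eqP; rewrite scaler_eq0 (negbTE (natr_neq0 char0 _)) //= => /eqP.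
Qed.

(** The previous lemma and the pigeonhole argument of [dominated]: if la is
    not dominated by mu, any g sends two boxes of some row to one column. *)
Lemma sandwich_dominated la mu (part_mu : is_partition mu) (x : ga (sumn mu) (sumn la)) :
  rsum la \k* x \k* csum_ mu != 0 -> forall i, (rows_below la i <= rows_below mu i)%N.
Proof.
apply: contraNP => /existsNP[i]; move/negP; rewrite -ltnNge => lt_i.
rewrite [x]kdelta_decomp kmul_sumDr kmul_sumDl big1 // => g _.
rewrite kmulZr kmulZl.
suff [a [b [ab rab cab]]] : exists a b : 'I_(sumn la), [/\ a != b, row la a = row la b
    & col mu (bij_inv g a) = col mu (bij_inv g b)].
  by rewrite (sandwich_delta0 ab) ?scaler0.
apply: contrapT => no; move: lt_i; rewrite ltnNge => /negP; apply.
apply: (@dominated la mu part_mu (bij_inv g)) => a b rab cab.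
by apply: contrapT => /eqP ab; apply: no; exists a, b.
Qed.

(** A nonzero product gives dominance in both directions, by applying
    [sandwich_dominated] to it and to its image under kstar, hence equality of
    the partitions. *)
Lemma ysym_orth la mu (part_la : is_partition la) (part_mu : is_partition mu)
  (x : ga (sumn mu) (sumn la)) : la != mu -> ysym la \k* x \k* ysym mu = 0.
Proof.
move=> lamu; apply: contraNeq lamu => nz; apply/eqP/part_eq => // i.
have e : ysym la \k* x \k* ysym mu
    = rsum la \k* (csum_ la \k* x \k* rsum mu) \k* csum_ mu.
  by rewrite !ysym_def !kmulA.
have nz1 : rsum la \k* (csum_ la \k* x \k* rsum mu) \k* csum_ mu != 0 by rewrite -e.
have nz2 : rsum mu \k* kstar x \k* csum_ la != 0.
  apply: contraNneq nz => /(congr1 (@kstar _ _ _)).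
  rewrite !kstarM kstarK rsum_star csum_star (linear_fun0 (@kstar_lin _ _ _)) kmulA e => ->.
  by rewrite kmul0r kmul0l.
by apply/eqP; rewrite eqn_leq (sandwich_dominated part_mu nz1) (sandwich_dominated part_la nz2).
Qed.

End YoungSymmetrizer.

Section YoungIdempotent.
Variables (k : fieldType) (char0 : [pchar k] =i pred0).
Local Notation ga m n := {ffun bij m n -> k^o}.
Local Notation "'\d' g" := (kdelta k g) (at level 10).

Section OneShape.
Variables (la : seq nat) (part_la : is_partition la).
Local Notation N := (sumn la).
Local Notation c := (ysym k la).

(** The scalar by which ysym la is quasi-idempotent, namely the product of the
    hook lengths. *)
Definition ynorm : k := (c \k* c) (bij1 N).

(** By von Neumann's lemma each g either factors through rows and columns, and
    contributes a multiple of c, or contributes 0. *)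
Lemma rsum_csum_sandwich (y : ga N N) :
  rsum k la \k* y \k* csum_ k la = (rsum k la \k* y \k* csum_ k la) (bij1 N) *: c.
Proof.
suff [e ->] : exists e, rsum k la \k* y \k* csum_ k la = e *: c.
  by rewrite ffunE ysym_coef1 [_ *: 1]mulr1.
suff dl g : exists e, rsum k la \k* \d g \k* csum_ k la = e *: c.
  exists (\sum_g y g * projT1 (cid (dl g))).
  rewrite {1}[y]kdelta_decomp kmul_sumDr kmul_sumDl scaler_suml.
  apply: eq_bigr => g _; rewrite kmulZr kmulZl -scalerA.
  by case: (cid (dl g)) => e /= ->.
have [sep|] := pselect (forall x y : 'I_N, row la x = row la y ->
    col la (bij_inv g x) = col la (bij_inv g y) -> x = y).
  have [p [pr pc]] := row_column_factor part_la sep.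
  have rp : rowp p by apply/forallP => x; rewrite pr.
  have cq : colp (p ** g) by apply/forallP => x; rewrite bij_compE pc bijKV.
  exists (bsgn k (p ** g)).
  have -> : g = bij_inv p ** (p ** g) by rewrite bij_compKl.
  rewrite -kdeltaM kmulA rsum_mulr ?rowpV // -kmulA csum_mull ?bij_compKVl //.
  by rewrite kmulZr ysym_def.
move=> nsep; exists 0; rewrite scale0r.
suff [a [b [ab rab cab]]] : exists a b : 'I_N, [/\ a != b, row la a = row la b
    & col la (bij_inv g a) = col la (bij_inv g b)].
  exact: (sandwich_delta0 char0 ab rab cab).
apply: contrapT => no; apply: nsep => a b rab cab.
by apply: contrapT => /eqP ab; apply: no; exists a, b.
Qed.

Lemma ysym_sandwich (x : ga N N) : c \k* x \k* c = (c \k* x \k* c) (bij1 N) *: c.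
Proof.
have -> : c \k* x \k* c = rsum k la \k* (csum_ k la \k* x \k* rsum k la) \k* csum_ k la.
  by rewrite !ysym_def !kmulA.
exact: rsum_csum_sandwich.
Qed.

Lemma ysymM : c \k* c = ynorm *: c.
Proof. by have := ysym_sandwich (\d (bij1 N)); rewrite kmul1r. Qed.

(** The trace of right multiplication by c is d!, as c has coefficient 1 at
    the identity, and it is ynorm times a rank. *)
Lemma ynorm_neq0 : ynorm != 0.
Proof.
have TT (x : ga N N) : x \k* c \k* c = ynorm *: (x \k* c) by rewrite -kmulA ysymM kmulZr.
have := trace_rank (kmul_linl c) TT.
under eq_bigr => g _ do rewrite kmul_deltal bij_compVl ysym_coef1.
rewrite sumr_const => e; apply: contraTneq (natr_neq0 char0 (n := #|{: bij N N}|) _).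
  by move=> n0; rewrite e n0 mul0r eqxx.
by apply/card_gt0P; exists (bij1 N).
Qed.

(** The scalar is moved into a single product with the trace property, which
    gives it as a coefficient of x c. *)
Lemma ysym_sandwichE (x : ga N N) : c \k* x \k* c = (ynorm * (x \k* c) (bij1 N)) *: c.
Proof.
by rewrite ysym_sandwich -kmulA kmul_trC -kmulA ysymM kmulZr ffunE.
Qed.

Lemma ysym_sandwich_delta (g : bij N N) : c \k* \d g \k* c = (ynorm * c (bij_inv g)) *: c.
Proof. by rewrite ysym_sandwichE kmul_deltal bij_comp1r. Qed.

(** A multiple of the central idempotent of the Specht module, in a form that
    makes sense at every p. *)
Definition ycentral p : ga p p := \sum_(g : bij N p) \d g \k* c \k* \d (bij_inv g).

Lemma ycentral_ysym p (h : bij N p) :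
  ycentral p \k* (\d h \k* c) = ynorm ^+ 2 *: (\d h \k* c).
Proof.
rewrite kmul_sumDl.
under eq_bigr => g _.
  rewrite -!kmulA (kmulA (\d (bij_inv g))) kdeltaM (kmulA c) ysym_sandwich_delta kmulZr.
  rewrite bij_inv_comp bij_invK; over.
rewrite (sum_bijl h) expr2 -scalerA -kmulZr -ysymM -kmulZr.
under eq_bigr => g _ do rewrite bij_compKl -scalerA -kdeltaM -kmulA -kmulZr.
by rewrite -scaler_sumr -kmul_sumDr -kmul_suml kmulZr.
Qed.

End OneShape.

Lemma ycentral_orth la mu p (h : bij (sumn mu) p) :
  is_partition la -> is_partition mu -> la != mu ->
  ycentral la p \k* (\d h \k* ysym k mu) = 0.
Proof.
move=> pla pmu lamu; rewrite kmul_sumDl big1 // => g _.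
rewrite -!kmulA (kmulA (\d (bij_inv g))) kdeltaM (kmulA (ysym k la)).
by rewrite ysym_orth // kmul0r.
Qed.

End YoungIdempotent.

(** * Cycle types *)

Section CycleType.
Variable d : nat.

Definition orbit_reps (g : bij d d) : seq 'I_d :=
  sort (fun x y => fingraph.order g x >= fingraph.order g y)%N (enum (froots g)).

Definition cycle_type (g : bij d d) : seq nat := [seq fingraph.order g x | x <- orbit_reps g].

Lemma cycle_type_part g : is_partition (cycle_type g).
Proof.
apply/andP; split.
  rewrite /cycle_type sorted_map; apply: sort_sorted => x y; exact: leq_total.
apply/mapP => -[x _ /esym/eqP]; rewrite -leqn0 leqNgt; exact/negP/negPn/fingraph.order_gt0.
Qed.

Lemma cycle_type_sum g : sumn (cycle_type g) = d.
Proof.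
rewrite /cycle_type sumnE big_map (perm_big _ (permEl (perm_sort _ _))) /= big_enum /=.
rewrite -[RHS]card_ord -sum1_card [RHS](partition_big (froot g) (froots g)) /=; last first.
  by move=> x _; exact/roots_root/fconnect_sym/bij_inj.
apply: eq_bigr => x rx; rewrite sum1_card /fingraph.order; apply: eq_card => y.
have rxx : froot g x = x by exact/eqP.
change (fconnect g x y = (froot g y == x)); rewrite -[x in RHS]rxx.
by rewrite (root_connect (fconnect_sym (@bij_inj _ _ g))) fconnect_sym //; exact: bij_inj.
Qed.

Lemma orbit_repsP (g : bij d d) x y : x \in orbit_reps g -> y \in orbit_reps g ->
  fconnect g x y -> x = y.
Proof.
rewrite !mem_sort !mem_enum => /eqP <- /eqP <- xy.
have sg := fconnect_sym (@bij_inj _ _ g).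
by move/(fingraph.rootP sg): xy; rewrite !(fingraph.root_root sg).
Qed.

Section Listing.
Variables (g : bij d d) (la : seq nat).
Hypothesis ela : cycle_type g = la.

Definition rep (i : 'I_d) : 'I_d := nth i (orbit_reps g) (row la i).
(** Lists the cycles of g in the boxes of its cycle type, one cycle per row;
    two bijections of the same cycle type are conjugate through the comparison
    of their listings. *)
Definition listing (i : 'I_d) : 'I_d := iter (col la i) g (rep i).

Lemma row_lt (i : 'I_d) : (row la i < size (orbit_reps g))%N.
Proof.
rewrite -(size_map (fingraph.order g)) -/(cycle_type g) ela.
by apply: reshape_indexP; rewrite -ela cycle_type_sum ltn_ord.
Qed.

Lemma col_lt (i : 'I_d) : (col la i < fingraph.order g (rep i))%N.
Proof.
rewrite /rep -(nth_map i 0%N) ?row_lt // -/(cycle_type g) ela.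
by apply: reshape_offsetP; rewrite -ela cycle_type_sum ltn_ord.
Qed.

Lemma rep_eq (i j : 'I_d) : row la i = row la j -> rep i = rep j.
Proof. by move=> e; rewrite /rep e; apply: set_nth_default; exact: row_lt. Qed.

Lemma listing_inj : injective listing.
Proof.
move=> i j ij; have rij : rep i = rep j.
  apply: (@orbit_repsP g); try exact/mem_nth/row_lt.
  apply: connect_trans (fconnect_iter g (col la i) _) _; rewrite -/(listing i) ij.
  by rewrite fconnect_sym ?fconnect_iter //; exact: bij_inj.
apply/val_inj/(@rowcol_inj la).
  have := rij; rewrite /rep (set_nth_default i) ?row_lt // => /eqP.
  by rewrite nth_uniq ?row_lt ?sort_uniq ?enum_uniq // => /eqP.
have /(congr1 (findex g (rep i))) := ij; rewrite /listing -rij !findex_iter //.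
  by rewrite rij col_lt.
exact: col_lt.
Qed.

Lemma listing_next (i j : 'I_d) : row la j = row la i ->
  col la j = ((col la i).+1 %% nth 0%N la (row la i))%N -> g (listing i) = listing j.
Proof.
move=> rj cj; rewrite /listing (rep_eq rj) cj -iterS.
have -> : nth 0%N la (row la i) = fingraph.order g (rep i).
  by rewrite -{1}ela (nth_map i) ?row_lt.
rewrite {1}(divn_eq (col la i).+1 (fingraph.order g (rep i))) addnC iterD.
congr (iter _ g _); elim: (_ %/ _)%N => //= q IH.
by rewrite mulSn iterD IH iter_order //; exact: bij_inj.
Qed.
End Listing.

Lemma cycle_type_conj (g h : bij d d) : cycle_type g = cycle_type h ->
  exists x : bij d d, h = x ** g ** bij_inv x.
Proof.
move=> egh; set la := cycle_type h.
pose lg : bij d d := mk_bij (listing_inj egh) erefl.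
pose lh : bij d d := mk_bij (listing_inj (erefl : cycle_type h = la)) erefl.
exists (lh ** bij_inv lg); suff e : h ** lh = lh ** (bij_inv lg ** g ** lg).
  rewrite bij_inv_comp bij_invK -[LHS](bij_compKr lh) e.
  by rewrite -!bij_compA.
apply: bijP => i; rewrite !bij_compE.
have lai : (0 < nth 0 la (row la i))%N.
  apply: leq_ltn_trans (leq0n (col la i)) (reshape_offsetP _).
  by rewrite cycle_type_sum ltn_ord.
have [j' [rj cj]] := box_exists (ltn_pmod (col la i).+1 lai).
have jd : (j' < d)%N by rewrite -(cycle_type_sum h) ltn_ord.
pose j := Ordinal jd; have lE : (lg i = listing g la i) * (lh i = listing h la i) by rewrite !mk_bijE.
rewrite !lE (@listing_next h la erefl i j rj cj) (@listing_next g la egh i j rj cj).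
by rewrite -[listing g la j](mk_bijE (listing_inj egh) erefl) bijKV mk_bijE.
Qed.
End CycleType.

(** * Completeness and Parseval's identity *)

(** Partitions of d as the sequences of nonzero entries of functions from d to
    {0, ..., d}: a finite enumeration that may contain repetitions before
    undup. *)
Definition parts d : seq (seq nat) :=
  undup [seq la <- [seq [seq x <- [seq val y | y <- codom f] | x != 0%N]
                   | f : {ffun 'I_d -> 'I_d.+1}]
        | is_partition la && (sumn la == d)].

Lemma parts_uniq d : uniq (parts d).
Proof. exact: undup_uniq. Qed.

Lemma mem_parts d la : (la \in parts d) = is_partition la && (sumn la == d).
Proof.
rewrite mem_undup mem_filter; apply: andb_idr => /andP[pla /eqP sla].
have nz : all (fun x => x != 0%N) la.
  by apply/allP => x xla; apply: contraTneq xla => ->; case/andP: pla.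
have le_d : all (fun x => x <= d)%N la.
  apply/allP => x xla; rewrite -sla sumnE (big_rem x xla) /= leq_addr //.
have sz : (size la <= d)%N.
  rewrite -sla; elim: (la) nz => //= x l IH /andP[x0 /IH]; rewrite -lt0n in x0.
  by rewrite -add1n => /(leq_add x0).
apply/mapP; exists [ffun i : 'I_d => inord (nth 0%N la i)]; first exact: mem_enum.
have -> : [seq val y | y <- codom [ffun i : 'I_d => inord (nth 0%N la i) : 'I_d.+1]]
        = la ++ nseq (d - size la) 0%N.
  apply: (@eq_from_nth _ 0%N).
    by rewrite size_map size_codom card_ord size_cat size_nseq subnKC.
  rewrite size_map size_codom card_ord => i id; pose i' := Ordinal id.
  have id' : (i < #|'I_d|)%N by rewrite card_ord.
  rewrite (nth_map ord0) ?size_codom // /codom (nth_map i') -?cardE //.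
  rewrite ffunE nth_enum_ord // nth_cat nth_nseq if_same [LHS]inordK.
    by case: ltnP => // /(nth_default 0%N)->.
  rewrite ltnS; case: (ltnP i (size la)) => [il|/(nth_default 0%N)-> //].
  by apply: (allP le_d); exact: mem_nth.
rewrite filter_cat (all_filterP nz) (eq_in_filter (a2 := pred0)) ?filter_pred0 ?cats0 //.
by move=> x /nseqP[-> _].
Qed.

Section Completeness.
Variables (k : fieldType) (char0 : [pchar k] =i pred0).
Local Notation ga m n := {ffun bij m n -> k^o}.
Local Notation "'\d' g" := (kdelta k g) (at level 10).

Definition cast_bij m n (e : m = n) : bij m n := mk_bij (cast_ord_inj (eq_n := e)) e.

Lemma kdelta_ysym_neq0 la p (h : bij (sumn la) p) : \d h \k* ysym k la != 0.
Proof.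
apply/eqP => /ffunP/(_ h); rewrite kmul_deltal bij_compVl ysym_coef1 ffunE.
exact/eqP/oner_neq0.
Qed.

Lemma ycentral_class la p (x : bij p p) (g : bij p p) :
  ycentral k la p (x ** g ** bij_inv x) = ycentral k la p g.
Proof.
have e : \d x \k* ycentral k la p \k* \d (bij_inv x) = ycentral k la p.
  rewrite /ycentral kmul_sumDr kmul_sumDl [RHS](sum_bijl x); apply: eq_bigr => h _.
  by rewrite -!kdeltaM bij_inv_comp -kdeltaM !kmulA.
rewrite -{1}e kmul_deltar kmul_deltal bij_invK; congr (ycentral _ _ _ _).
by rewrite -!bij_compA bij_compVl bij_comp1r bij_compKl.
Qed.

Section Degree.
Variable d : nat.

Let Z := [seq ycentral k la d | la <- parts d].
Let I := [seq ([ffun g => (cycle_type g == la)%:R] : ga d d) | la <- parts d].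

(** Multiplication by the element of Z of shape la separates the shapes, by
    orthogonality; this gives freeness and the coefficients of the unit. *)
Lemma ycentral_comb (c : 'I_(size Z) -> k) (i : 'I_(size Z))
    (la := nth [::] (parts d) i) (h : bij (sumn la) d) :
  (\sum_(j < size Z) c j *: Z`_j) \k* (\d h \k* ysym k la)
  = (c i * ynorm k la ^+ 2) *: (\d h \k* ysym k la).
Proof.
have sz : size Z = size (parts d) by rewrite size_map.
have nz (j : 'I_(size Z)) : (j < size (parts d))%N by rewrite -sz ltn_ord.
have pl (j : 'I_(size Z)) : is_partition (nth [::] (parts d) j).
  by have := mem_nth [::] (nz j); rewrite mem_parts => /andP[].
rewrite kmul_sumDl (bigD1 i) //= big1 ?addr0 => [|j ji].
  by rewrite kmulZl (nth_map [::]) ?nz // (ycentral_ysym char0 (pl i)) scalerA.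
rewrite kmulZl (nth_map [::]) ?nz // (ycentral_orth char0 _ (pl j) (pl i)) ?scaler0 //.
by rewrite nth_uniq // parts_uniq.
Qed.

Lemma Z_shape (i : 'I_(size Z)) : exists h : bij (sumn (nth [::] (parts d) i)) d, True.
Proof.
have il : (i < size (parts d))%N by have := ltn_ord i; rewrite {2}size_map.
have := mem_nth [::] il; rewrite mem_parts => /andP[_ /eqP e].
by exists (cast_bij e).
Qed.

Lemma Z_ynorm_neq0 (i : 'I_(size Z)) : ynorm k (nth [::] (parts d) i) ^+ 2 != 0.
Proof.
have il : (i < size (parts d))%N by have := ltn_ord i; rewrite {2}size_map.
have := mem_nth [::] il; rewrite mem_parts => /andP[pla _].
by rewrite expf_neq0 // ynorm_neq0.
Qed.

Lemma ycentral_free : free Z.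
Proof.
apply/(@freeP _ _ _ (in_tuple Z)) => c c0 i; have [h _] := Z_shape i.
have := ycentral_comb c h; rewrite c0 kmul0l => /esym/eqP.
rewrite scaler_eq0 (negbTE (kdelta_ysym_neq0 _)) orbF mulf_eq0.
by rewrite (negbTE (Z_ynorm_neq0 _)) orbF => /eqP.
Qed.

Lemma class_function_span (f : ga d d) :
  (forall x g, f (x ** g ** bij_inv x) = f g) -> f \in <<I>>%VS.
Proof.
move=> fc.
pose v la := if pselect (exists g : bij d d, cycle_type g = la) is left e
  then f (projT1 (cid e)) else 0.
have -> : f = \sum_(la <- parts d) v la *: ([ffun g => (cycle_type g == la)%:R] : ga d d).
  apply/ffunP => g; rewrite sum_ffunE (bigD1_seq (cycle_type g)) ?parts_uniq //=; last first.
    by rewrite mem_parts cycle_type_part cycle_type_sum eqxx.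
  rewrite !ffunE eqxx big1 ?addr0 => [|la nla].
    rewrite /v; case: pselect => [e|[]]; last by exists g.
    case: (cid e) => g' /= /cycle_type_conj[x ->].
    by rewrite fc; exact/esym/mulr1.
  by rewrite !ffunE eq_sym (negbTE nla); exact: mulr0.
rewrite big_seq; apply: memv_suml => la lain; apply/memvZ/memv_span.
exact: (map_f (fun la => [ffun g => (cycle_type g == la)%:R] : ga d d)).
Qed.

(** The elements of Z are free and are class functions, and there are as many
    of them as indicators of cycle types, which span the class functions.  So
    Z is a basis, and the unit decomposes in it. *)
Lemma ycentral_complete :
  \d (bij1 d) = \sum_(la <- parts d) (ynorm k la ^- 2) *: ycentral k la d.
Proof.
have ZI : (<<Z>> = <<I>>)%VS.
  apply/eqP; rewrite eqEdim; apply/andP; split.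
    apply/span_subvP => z /mapP[la _ ->]; apply: class_function_span => x g.
    exact: ycentral_class.
  rewrite (eqnP ycentral_free); apply: leq_trans (dim_span I) _.
  by rewrite !size_map.
have : \d (bij1 d) \in <<Z>>%VS.
  rewrite ZI; apply: class_function_span => x g; rewrite !kdeltaE.
  by rewrite -bij_compA bij_comp_eql bij_comp1r bij_comp_eqr bij_compVr.
move=> /(@coord_span _ _ _ (in_tuple Z)) e1.
have sz : size Z = size (parts d) by rewrite size_map.
rewrite (big_nth [::]) -sz big_mkord {1}e1; apply: eq_bigr => i _.
have [h _] := Z_shape i; rewrite (nth_map [::]) -?sz //; congr (_ *: _).
have := ycentral_comb (fun j => coord (in_tuple Z) j (\d (bij1 d))) h.
rewrite -e1 kmul1l -[X in X = _]scale1r => /eqP.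
rewrite -subr_eq0 -scalerBl scaler_eq0 (negbTE (kdelta_ysym_neq0 _)) orbF subr_eq0.
by move=> /eqP/esym/(canRL (mulfK (Z_ynorm_neq0 i))); rewrite mul1r.
Qed.

End Degree.

Definition class_family (f : forall p, bij p p -> k) : Prop :=
  forall p q (g : bij q p) (h : bij p q), f p (g ** h) = f q (h ** g).

Definition kpair (f : forall p, bij p p -> k) p (x : ga p p) : k :=
  \sum_(s : bij p p) x s * f p s.
Arguments kpair f [p] x.

Lemma kpair_conj f p q (x : ga p p) (g : bij p q) : class_family f ->
  kpair f (\d g \k* x \k* \d (bij_inv g)) = kpair f x.
Proof.
move=> fc; rewrite /kpair (sum_bijl g) (sum_bijr (bij_inv g)); apply: eq_bigr => s _.
by rewrite kmul_deltar kmul_deltal bij_invK -(bij_compA g) !bij_compKVr bij_compKl fc bij_compKVr.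
Qed.

(** The unit is decomposed into central elements.  Multiplication by a class
    function F preserves each factor and, by the sandwich property of c, acts
    on it as the scalar kpair f c. *)
Theorem ysym_parseval d (f f' : forall p, bij p p -> k) :
  class_family f -> class_family f' ->
  #|{: bij d d}|%:R *
    \sum_(la <- parts d) ynorm k la ^- 2 * (kpair f (ysym k la) * kpair f' (ysym k la))
  = \sum_(s : bij d d) f d (bij_inv s) * f' d s.
Proof.
move=> fc fc'.
pose F p : ga p p := [ffun s => f p (bij_inv s)].
have Fcom p q (g : bij p q) : F q \k* \d g = \d g \k* F p.
  apply/ffunP => s; rewrite kmul_deltar kmul_deltal !ffunE.
  by rewrite !bij_inv_comp !bij_invK fc.
have FcomE p (x : ga p p) : F p \k* x = x \k* F p.
  by rewrite kmul_sumr kmul_suml; apply: eq_bigr => g _; rewrite Fcom.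
have -> : \sum_(s : bij d d) f d (bij_inv s) * f' d s = kpair f' (F d).
  by apply: eq_bigr => s _; rewrite ffunE.
have lp p : linear (@kpair f' p : ga p p -> k^o).
  move=> a x y; rewrite /kpair scaler_sumr -big_split; apply: eq_bigr => s _.
  by rewrite !ffunE mulrDl; congr (_ + _); exact/esym/mulrA.
rewrite -[F d]kmul1r ycentral_complete kmul_sumDr.
rewrite (linear_fun_sum _ _ _ (lp d)) mulr_sumr !big_seq.
apply: eq_bigr => la; rewrite mem_parts => /andP[pla /eqP sla].
rewrite kmulZr (linear_funZ (lp d)) mulrCA; congr (_ * _).
have FE : F (sumn la) \k* ysym k la = kpair f (ysym k la) *: ysym k la.
  have e : ynorm k la *: (F (sumn la) \k* ysym k la)
      = (ynorm k la * (F (sumn la) \k* ysym k la) (bij1 _)) *: ysym k la.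
    by rewrite -ysym_sandwichE // -FcomE -kmulA ysymM // kmulZr.
  move: e; rewrite -scalerA => /(scalerI (ynorm_neq0 char0 pla)) ->.
  congr (_ *: _); rewrite kmulE /kpair; apply: eq_bigr => s _.
  by rewrite bij_comp1l ffunE bij_invK mulrC.
have -> : F d \k* ycentral k la d = \sum_(g : bij (sumn la) d)
    kpair f (ysym k la) *: (\d g \k* ysym k la \k* \d (bij_inv g)).
  rewrite /ycentral kmul_sumDr; apply: eq_bigr => g _.
  by rewrite !kmulA Fcom -(kmulA (\d g)) FE kmulZr kmulZl.
rewrite (linear_fun_sum _ _ _ (lp d)).
under eq_bigr => g _ do rewrite (linear_funZ (lp d)) kpair_conj //.
have -> : #|{: bij d d}| = #|{: bij (sumn la) d}| by case: _ / sla.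
by rewrite sumr_const -[RHS]mulr_natl (eq_card (B := {: bij (sumn la) d})) //.
Qed.

End Completeness.

(** * Specht modules *)

Section SpechtElements.
Variables (k : fieldType) (char0 : [pchar k] =i pred0).
Local Notation ga m n := {ffun bij m n -> k^o}.
Local Notation "'\d' g" := (kdelta k g) (at level 10).
Variable la : seq nat.
Local Notation N := (sumn la).
Local Notation S := (Specht k la).
Local Notation c := (ysym k la).

(** Elements of the Specht module are multiples x c of the Young symmetrizer:
    spv reads the element of the group algebra, and sp multiplies by c and
    forms the element of the module. *)
Definition spv p (v : cobj S p) : ga N p := vsval (v : subvs_of (specht_space k la p)).
Definition sp p (x : ga N p) : cobj S p := vsproj (specht_space k la p) (x \k* c).

Lemma spE p (x : ga N p) : spv (sp x) = x \k* c.
Proof. by apply: vsprojK; apply/specht_spaceP; exists x; rewrite ysymE. Qed.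

Lemma spv_lin p : linear (@spv p).
Proof. by move=> a u v; rewrite /spv linearP. Qed.

Lemma sp_lin p : linear (@sp p).
Proof. by move=> a x y; rewrite /sp kmul_linl linearP. Qed.

Lemma spv_inj p : injective (@spv p).
Proof. exact: subvs_inj. Qed.

Lemma spv_act p q (y : ga p q) (v : cobj S p) :
  spv (cact (y : hom (kSym k) p q) v) = y \k* spv v.
Proof. exact: specht_actE. Qed.

Lemma sp_act p q (y : ga p q) (x : ga N p) :
  cact (y : hom (kSym k) p q) (sp x) = sp (y \k* x).
Proof. by apply: spv_inj; rewrite spv_act !spE kmulA. Qed.

Lemma sp0 p : N != p -> forall v : cobj S p, v = 0.
Proof. by move=> Np v; apply: spv_inj; apply: etrans (kdim0 _ Np) (esym (kdim0 _ Np)). Qed.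

Hypothesis part_la : is_partition la.

Lemma spv_ysym p (v : cobj S p) : spv v \k* c = ynorm k la *: spv v.
Proof.
have /specht_spaceP[x e] := subvsP v.
have -> : spv v = x \k* c by rewrite /spv e ysymE.
by rewrite -kmulA ysymM // kmulZr.
Qed.

Lemma spK p (v : cobj S p) : sp (spv v) = ynorm k la *: v.
Proof. by apply: spv_inj; rewrite spE spv_ysym (linear_funZ (@spv_lin p)). Qed.

Lemma sp_surj p (v : cobj S p) : exists x, v = sp x.
Proof.
exists ((ynorm k la)^-1 *: spv v); rewrite (linear_funZ (@sp_lin p)) spK scalerA.
by rewrite mulVf ?scale1r // ynorm_neq0.
Qed.

End SpechtElements.
Arguments sp {k} la {p} x.
Arguments spv {k la p} v.

Section Multiplicity.
Variables (k : fieldType) (char0 : [pchar k] =i pred0).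
Local Notation ga m n := {ffun bij m n -> k^o}.
Local Notation "'\d' g" := (kdelta k g) (at level 10).
Variable nu : seq nat.
Hypothesis part_nu : is_partition nu.
Local Notation N := (sumn nu).
Local Notation S := (Specht k nu).
Local Notation c := (ysym k nu).

Lemma rV_dim_le r r' (f : 'rV[k]_r -> 'rV[k]_r') : linear f -> injective f -> (r <= r')%N.
Proof.
move=> lf fi; pose F : {linear 'rV[k]_r -> 'rV[k]_r'} := HB.pack f (GRing.isLinear.Build k _ _ _ f lf).
have FE v : linfun F v = f v by rewrite lfunE.
have : (\dim (limg (linfun F)) <= \dim {: 'rV[k]_r'})%N by exact/dimvS/subvf.
rewrite limg_dim_eq ?dimvf /dim /= ?mul1n //.
apply/eqP; rewrite -subv0; apply/subvP => v; rewrite memv_cap memv_ker => /andP[_ /eqP].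
by rewrite FE -[RHS](linear_fun0 lf) => /fi ->; rewrite mem0v.
Qed.

Definition act_mor (M : cmod (kSym k)) (n : cobj M N) : cmor S M.
Proof.
refine (@CMor k _ S M (fun p v => cact (spv v : hom (kSym k) N p) n) _ _).
- by move=> p a u v; rewrite spv_lin cact_linl.
- by move=> p q f v; rewrite (spv_act (f : ga p q)) -cact_comp.
Defined.

(** A vector n of M defines the morphism v |-> v n from the Specht module to
    M, and c n is its value at the generator. *)
Lemma no_mult_ysym (M : cmod (kSym k)) :
  (forall (f : cmor S M) n (v : cobj S n), cfun f v = 0) ->
  forall n : cobj M N, cact (c : hom (kSym k) N N) n = 0.
Proof.
move=> f0 n; have /= := f0 (act_mor n) N (sp nu (\d (bij1 N))).
by rewrite spE kmul1l.
Qed.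

(** The space of vectors on which c acts by ynorm has dimension the
    multiplicity.  It is preserved by isomorphisms, and on r' copies of the
    Specht module its elements are determined by r' coefficients, by the
    sandwich property of c. *)
Lemma has_mult_le (M : cmod (kSym k)) r r' :
  has_mult S M r -> has_mult S M r' -> (r <= r')%N.
Proof.
move=> [A [[f fb] A0]] [B [[g gb] B0]].
have [g' g'K gK'] := fb N.
pose e : cobj S N := sp nu (\d (bij1 N)).
have eE : spv e = c by rewrite spE kmul1l.
(* On the vectors t_i e of the r copies, c acts by ynorm. *)
pose emb (t : 'rV[k]_r) : cobj (csum (cpow S r) A) N := ([ffun i => t 0 i *: e], 0).
have lemb : linear emb.
  move=> a u v; apply: injective_projections; rewrite /= ?scaler0 ?addr0 //.
  by apply/ffunP => i; rewrite !ffunE !mxE scalerDl scalerA.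
have cemb t : cact (c : hom (kSym k) N N) (emb t) = ynorm k nu *: emb t.
  apply: injective_projections => /=; last by rewrite (linear_fun0 (cact_linr _)) scaler0.
  apply/ffunP => i; rewrite !ffunE; apply: spv_inj.
  rewrite (spv_act (la := nu)) !(linear_funZ (@spv_lin k nu N)) eE kmulZr ysymM //.
  by rewrite !scalerA mulrC.
have lg' : linear g'.
  by move=> a u v; apply: (can_inj g'K); rewrite (cfun_lin f) !gK'.
pose phi t := cfun g (g' (emb t)).
have lphi : linear phi by exact: linear_cmp (cfun_lin g (n := N)) (linear_cmp lg' lemb).
have cphi t : cact (c : hom (kSym k) N N) (phi t) = ynorm k nu *: phi t.
  rewrite /phi -cfun_nat; have -> : cact (c : hom (kSym k) N N) (g' (emb t)) = ynorm k nu *: g' (emb t).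
    apply: (can_inj g'K); rewrite cfun_nat gK' cemb.
    by rewrite (linear_funZ (cfun_lin f (n := N))) gK'.
  by rewrite (linear_funZ (cfun_lin g (n := N))).
have yn0 := ynorm_neq0 char0 part_nu.
(* The coefficient at 1 determines an element of c k[S_N] c. *)
pose C (z : cobj (csum (cpow S r') B) N) : 'rV[k]_r' := \row_j spv (z.1 j) (bij1 N).
have lC : linear C.
  move=> a u v; apply/rowP => j; rewrite !mxE.
  have -> : (a *: u + v).1 j = a *: u.1 j + v.1 j by rewrite /= !ffunE.
  by rewrite spv_lin !ffunE.
have C0 z : cact (c : hom (kSym k) N N) z = ynorm k nu *: z -> C z = 0 -> z = 0.
  case: z => x n [cx cn] /rowP Cz.
  have n0 : n = 0.
    by apply: (scalerI yn0); rewrite -cn scaler0; exact: no_mult_ysym.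
  rewrite n0; congr (_, _); apply/ffunP => j; rewrite [RHS]ffunE; apply: spv_inj.
  have ex : c \k* spv (x j) = ynorm k nu *: spv (x j).
    by have /ffunP/(_ j) := cx; rewrite !ffunE => /(congr1 spv); rewrite (spv_act (la := nu)) (linear_funZ (@spv_lin k nu N)).
  have : c \k* spv (x j) \k* c = 0.
    rewrite ysym_sandwichE // spv_ysym // ffunE; have := Cz j; rewrite !mxE /= => ->.
    by rewrite scaler0 mulr0 scale0r.
  rewrite ex kmulZl spv_ysym // => /eqP; rewrite !scaler_eq0 (negbTE yn0) /= => /eqP ->.
  exact/esym/(linear_fun0 (@spv_lin k nu N)).
apply: (@rV_dim_le _ _ (fun t => C (phi t))); first exact: linear_cmp.
apply: linear_inj => [|t /(C0 _ (cphi t)) phi0]; first exact: linear_cmp.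
have : emb t = 0.
  rewrite -[emb t](gK' ); suff -> : g' (emb t) = 0 by rewrite (linear_fun0 (cfun_lin f (n := N))).
  have [h hK _] := gb N; rewrite -[LHS]hK -/(phi t) phi0 -[X in h X](linear_fun0 (cfun_lin g (n := N))).
  exact: hK.
move=> [/ffunP e0]; apply/rowP => i; have := e0 i; rewrite !ffunE mxE => /(congr1 spv).
rewrite (linear_funZ (@spv_lin k nu N)) (linear_fun0 (@spv_lin k nu N)) eE.
move/ffunP/(_ (bij1 N)); rewrite !ffunE ysym_coef1 => <-; exact/esym/mulr1.
Qed.

Lemma has_mult_uniq (M : cmod (kSym k)) r r' :
  has_mult S M r -> has_mult S M r' -> r = r'.
Proof. by move=> h h'; apply/eqP; rewrite eqn_leq !(@has_mult_le M). Qed.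

End Multiplicity.

(** * Multiplicity in a left ideal *)

Lemma inj_surj_bij (X Y : Type) (f : X -> Y) :
  injective f -> (forall y, exists x, f x = y) -> bijective f.
Proof.
move=> fi fs; exists (fun y => projT1 (cid (fs y))) => [x|y].
  by apply: fi; case: cid.
by case: cid.
Qed.

Section CentralElement.
Variables (k : fieldType) (char0 : [pchar k] =i pred0).
Local Notation ga m n := {ffun bij m n -> k^o}.
Local Notation "'\d' g" := (kdelta k g) (at level 10).
Variable nu : seq nat.
Hypothesis part_nu : is_partition nu.
Local Notation N := (sumn nu).
Local Notation c := (ysym k nu).
Local Notation z := (ycentral k nu).

Lemma ycentral_comm p q (y : ga p q) : y \k* z p = z q \k* y.
Proof.
rewrite kmul_suml kmul_sumr; apply: eq_bigr => h _; congr (_ *: _).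
rewrite /ycentral kmul_sumDl kmul_sumDr [RHS](sum_bijl h); apply: eq_bigr => g _.
by rewrite bij_inv_comp -!kmulA !kdeltaM bij_compKVr !kmulA kdeltaM.
Qed.

Lemma ycentral_ideal p (x : ga N p) : z p \k* (x \k* c) = ynorm k nu ^+ 2 *: (x \k* c).
Proof.
rewrite [x \k* c]kmul_suml kmul_sumDr scaler_sumr; apply: eq_bigr => g _.
by rewrite kmulZr ycentral_ysym // !scalerA mulrC.
Qed.

Lemma ycentral_sq p : z p \k* z p = ynorm k nu ^+ 2 *: z p.
Proof.
rewrite {2}/ycentral kmul_sumDr scaler_sumr; apply: eq_bigr => g _.
by rewrite kmulA ycentral_ideal // kmulZl.
Qed.

Lemma ysym_ycentral : c \k* z N = ynorm k nu ^+ 2 *: c.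
Proof. by rewrite ycentral_comm -[c in LHS]kmul1l ycentral_ideal kmul1l. Qed.

End CentralElement.

Section IdealModule.
Variables (k : fieldType) (q : nat).
Local Notation ga m n := {ffun bij m n -> k^o}.
Variable E : forall p, ga q p -> ga q p.
Hypothesis E_lin : forall p, linear (@E p).
Hypothesis E_act : forall p p' (y : ga p p') x, E (y \k* x) = y \k* E x.

Definition ideal_act m n (y : hom (kSym k) m n) (v : subvs_of (limage (@E m))) :
  subvs_of (limage (@E n)) := vsproj (limage (@E n)) ((y : ga m n) \k* vsval v).

Lemma ideal_actE m n (y : ga m n) v : vsval (@ideal_act m n y v) = y \k* vsval v.
Proof.
apply: vsprojK; have /(limageP _ (E_lin (p := m)))[x ->] := subvsP v.
by apply/(limageP _ (E_lin (p := n))); exists (y \k* x); rewrite E_act.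
Qed.

Lemma ideal_valP p a (u v : subvs_of (limage (@E p))) :
  vsval (a *: u + v) = a *: vsval u + vsval v.
Proof. by rewrite linearP. Qed.

Definition ideal_mod : cmod (kSym k).
Proof.
refine (@CMod k (kSym k) (fun n => subvs_of (limage (@E n))) ideal_act _ _ _ _).
- move=> m n v a y y'; apply: subvs_inj; rewrite ideal_valP !ideal_actE.
  exact: (@kmul_linl k).
- move=> m n y a v v'; apply: subvs_inj; rewrite ideal_valP !ideal_actE ideal_valP.
  exact: (@kmul_linr k).
- by move=> n v; apply: subvs_inj; rewrite ideal_actE; exact: (@kmul1l k).
- move=> m n p y' y v; apply: subvs_inj; rewrite !ideal_actE.
  exact/esym/(@kmulA k).
Defined.

End IdealModule.

Section MultiplicityInIdeal.
Variables (k : fieldType) (char0 : [pchar k] =i pred0).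
Local Notation ga m n := {ffun bij m n -> k^o}.
Local Notation "'\d' g" := (kdelta k g) (at level 10).
Variable nu : seq nat.
Hypothesis part_nu : is_partition nu.
Local Notation N := (sumn nu).
Local Notation S := (Specht k nu).
Local Notation c := (ysym k nu).
Local Notation z := (ycentral k nu).
Local Notation yn := (ynorm k nu).

Variables (q : nat) (R : ga q q).

Definition sandwich (x : ga q N) : ga q N := c \k* x \k* R.

Lemma sandwich_lin : linear sandwich.
Proof. by move=> a x y; rewrite /sandwich kmul_linr kmul_linl. Qed.

Variables (M : cmod (kSym k)) (Psi : forall p, cobj M p -> ga q p).
Hypotheses (Psi_lin : forall p, linear (@Psi p)) (Psi_inj : forall p, injective (@Psi p)).
Hypothesis Psi_act : forall p p' (y : ga p p') v,
  Psi (cact (y : hom (kSym k) p p') v) = y \k* Psi v.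
Hypothesis Psi_im : forall p (v : cobj M p), exists x, Psi v = x \k* R.
Hypothesis Psi_onto : forall p x, exists v : cobj M p, Psi v = x \k* R.

Let yn0 : yn != 0 := ynorm_neq0 char0 part_nu.

(** The projection away from the nu-isotypic part, which ycentral spans. *)
Definition compl p (x : ga q p) : ga q p := x \k* R - yn ^- 2 *: (z p \k* (x \k* R)).

Lemma compl_lin p : linear (@compl p).
Proof.
move=> a x y; rewrite /compl kmul_linl kmul_linr !scalerDr scalerA mulrC -scalerA.
by rewrite scalerN opprD addrACA.
Qed.

Lemma compl_act p p' (y : ga p p') x : compl (y \k* x) = y \k* compl x.
Proof.
rewrite /compl (linear_funB (kmul_linr y)) kmulZr !kmulA -ycentral_comm.
by rewrite -!kmulA.
Qed.

Local Notation D := (limage sandwich).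
Local Notation r := (\dim D).
Local Notation b := (vbasis D).

Let lS : linear sandwich := sandwich_lin.
Let inD x : sandwich x \in D. Proof. by apply/(limageP _ lS); exists x. Qed.
Let bD (i : 'I_r) : exists x, b`_i = sandwich x.
Proof. by apply/(limageP _ lS)/vbasis_mem/mem_nth; rewrite size_tuple. Qed.
Let cb (i : 'I_r) : c \k* b`_i = yn *: b`_i.
Proof. by have [x ->] := bD i; rewrite /sandwich !kmulA ysymM // !kmulZl. Qed.

(** The components of x in the copies of the Specht module that are indexed by
    a basis of c R-sandwiches; its inverse, up to a scalar, is [reassemble].
    *)
Definition isotypic p (x : ga q p) (i : 'I_r) : cobj S p :=
  \sum_(g : bij N p) coord b i (c \k* (\d (bij_inv g) \k* x)) *: sp nu (\d g).

Lemma isotypic_lin p i : linear (fun x : ga q p => isotypic x i).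
Proof.
move=> a x y; rewrite /isotypic scaler_sumr -big_split; apply: eq_bigr => g _.
by rewrite !kmul_linr linearP scalerDl scalerA.
Qed.

Lemma isotypic_act p p' (y : ga p p') x i :
  isotypic (y \k* x) i = cact (y : hom (kSym k) p p') (isotypic x i).
Proof.
have lc (v : cobj S p) : linear (fun y : ga p p' => cact (y : hom (kSym k) p p') v).
  exact: (@cact_linl k (kSym k) S p p' v).
rewrite [y \k* x]kmul_suml (linear_fun_sum _ _ _ (isotypic_lin i)).
rewrite [y in RHS]kdelta_decomp (linear_fun_sum _ _ _ (lc _)).
apply: eq_bigr => h _; rewrite (linear_funZ (isotypic_lin i)) (linear_funZ (lc _)).
congr (_ *: _); rewrite /isotypic (linear_fun_sum _ _ _ (cact_linr _)) (sum_bijl h).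
apply: eq_bigr => g _; rewrite (linear_funZ (cact_linr _)) (sp_act (la := nu)) kdeltaM.
by rewrite bij_inv_comp (kmulA (\d (_ ** _))) kdeltaM bij_compKVr.
Qed.

Definition reassemble p (w : 'I_r -> cobj S p) : ga q p := \sum_i spv (w i) \k* b`_i.

Lemma reassemble_isotypic p (x : ga q p) :
  reassemble (isotypic (x \k* R)) = yn *: (z p \k* (x \k* R)).
Proof.
rewrite /reassemble /isotypic.
under eq_bigr => i _.
  rewrite (linear_fun_sum _ _ _ (@spv_lin k nu p)) kmul_sumDl.
  under eq_bigr => g _ do
    rewrite (linear_funZ (@spv_lin k nu p)) spE kmulZl -kmulA cb -kmulZr.
  over.
rewrite exchange_big /ycentral kmul_sumDl scaler_sumr; apply: eq_bigr => g _.
have mD : c \k* (\d (bij_inv g) \k* (x \k* R)) \in D.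
  by rewrite !kmulA -(kmulA c); exact: inD.
rewrite -!kmulA [in RHS](coord_vbasis mD) kmul_sumDr scaler_sumr; apply: eq_bigr => i _.
by rewrite !kmulZr !scalerA mulrC.
Qed.

Lemma sandwich_spv p (v : cobj S p) (g : bij N p) (i : 'I_r) :
  c \k* (\d (bij_inv g) \k* (spv v \k* b`_i)) = (yn ^+ 2 * spv v g) *: b`_i.
Proof.
apply: (scalerI yn0); rewrite -2!kmulZr -kmulZl -spv_ysym // !kmulA.
rewrite -(kmulA c) -(kmulA c) kmulA ysym_sandwichE // kmulZl cb.
rewrite -kmulA spv_ysym // kmulZr ffunE kmul_deltal bij_invK bij_comp1r.
by rewrite !scalerA; congr (_ *: _); rewrite expr2 [_ *: _]/(_ * _) !mulrA mulrAC.
Qed.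

Lemma isotypic_reassemble p (w : 'I_r -> cobj S p) i :
  isotypic (reassemble w) i = yn ^+ 3 *: w i.
Proof.
rewrite /isotypic /reassemble.
under eq_bigr => g _.
  rewrite !kmul_sumDr; under eq_bigr => j _ do rewrite sandwich_spv.
  rewrite (coord_sum_free _ _ (basis_free (vbasisP D))) -scalerA -(linear_funZ (@sp_lin k nu p)).
  over.
rewrite -scaler_sumr -(linear_fun_sum _ _ _ (@sp_lin k nu p)) -kdelta_decomp spK //.
by rewrite scalerA -exprSr.
Qed.

Lemma ysym_compl (x : ga q N) : c \k* compl x = 0.
Proof.
rewrite /compl (linear_funB (kmul_linr c)) kmulZr (kmulA c (z N)).
by rewrite ysym_ycentral // kmulZl scalerA mulVf ?expf_neq0 // scale1r subrr.
Qed.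

Lemma isotypic_compl p (x : ga q p) i : isotypic (compl x) i = 0.
Proof.
rewrite /isotypic big1 // => g _.
have -> : c \k* (\d (bij_inv g) \k* compl x) = 0.
  by rewrite -compl_act ysym_compl.
by rewrite linear0 scale0r.
Qed.

Lemma ycentral_reassemble p (w : 'I_r -> cobj S p) :
  z p \k* reassemble w = yn ^+ 2 *: reassemble w.
Proof.
rewrite /reassemble kmul_sumDr scaler_sumr; apply: eq_bigr => i _.
have e : z p \k* spv (w i) = yn ^+ 2 *: spv (w i).
  by apply: (scalerI yn0); rewrite -kmulZr -spv_ysym // ycentral_ideal // spv_ysym // !scalerA mulrC.
by rewrite kmulA e kmulZl.
Qed.

Lemma ycentral_compl p (x : ga q p) : z p \k* compl x = 0.
Proof.
rewrite /compl (linear_funB (kmul_linr _)) kmulZr (kmulA (z p) (z p)) ycentral_sq //.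
by rewrite kmulZl scalerA mulVf ?expf_neq0 // scale1r subrr.
Qed.

Lemma reassemble_ideal p (w : 'I_r -> cobj S p) : exists x, reassemble w = x \k* R.
Proof.
have ex (i : 'I_r) : exists x, b`_i = x \k* R by have [x ->] := bD i; exists (c \k* x).
exists (\sum_i spv (w i) \k* projT1 (cid (ex i))); rewrite /reassemble kmul_sumDl.
by apply: eq_bigr => i _; case: (cid (ex i)) => x /= ->; rewrite kmulA.
Qed.

(** M is identified by Psi with the left ideal of R.  The isotypic part is
    split off by the central element of nu and decomposed along a basis of the
    range of sandwich; c kills its complement. *)
Theorem has_mult_ideal : has_mult S M r.
Proof.
have complP p (x : ga q p) : compl x \in limage (@compl p).
  by apply/(limageP _ (@compl_lin p)); exists x.
pose A := ideal_mod compl_lin compl_act.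
pose f p (v : cobj M p) : cobj (csum (cpow S r) A) p :=
  ([ffun i => isotypic (Psi v) i],
   vsproj (limage (@compl p)) (Psi v - yn ^- 2 *: (z p \k* Psi v))).
have fE p (v : cobj M p) : vsval (f p v).2 = Psi v - yn ^- 2 *: (z p \k* Psi v).
  by apply: vsprojK; have [x ->] := Psi_im v; exact: complP.
have lf p : linear (f p).
  move=> a u v; apply: injective_projections.
    by apply/ffunP => i; rewrite !ffunE Psi_lin (isotypic_lin i).
  apply: subvs_inj; rewrite ideal_valP !fE Psi_lin kmul_linr.
  by rewrite !scalerDr scalerA mulrC -scalerA scalerN opprD addrACA.
have nf p p' (y : hom (kSym k) p p') (v : cobj M p) : f p' (cact y v) = cact y (f p v).
  apply: injective_projections.
    by apply/ffunP => i; rewrite !ffunE (Psi_act (y : ga p p')) isotypic_act.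
  apply: subvs_inj; rewrite (ideal_actE compl_lin compl_act (y : ga p p')) !fE.
  rewrite (Psi_act (y : ga p p')) (linear_funB (kmul_linr _)) kmulZr !kmulA.
  by rewrite -ycentral_comm.
exists A; split; last first.
  move=> g p v; have [x ->] := sp_surj char0 part_nu v.
  have -> : sp nu x = cact (x : hom (kSym k) N p) (sp nu (\d (bij1 N))).
    by rewrite (sp_act (la := nu) (x : ga N p)) kmul1r.
  have -> : sp nu (\d (bij1 N)) = yn^-1 *: cact (c : hom (kSym k) N N) (sp nu (\d (bij1 N))).
    rewrite (sp_act (la := nu)) kmul1r -[c]kmul1l -[\d (bij1 N) \k* c]spE spK //.
    by rewrite scalerA mulVf // scale1r.
  rewrite cfun_nat (linear_funZ (cfun_lin g (n := N))) cfun_nat.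
  set n := cfun g _; suff -> : cact (c : hom (kSym k) N N) n = 0.
    by rewrite scaler0 (linear_fun0 (cact_linr _)).
  apply: subvs_inj; rewrite (ideal_actE compl_lin compl_act) linear0.
  have /(limageP _ (@compl_lin N))[y ->] := subvsP n.
  exact: ysym_compl.
exists (@CMor k _ M (csum (cpow S r) A) f lf nf) => p /=.
apply: inj_surj_bij.
  apply: linear_inj => [|v fv0]; first exact: lf.
  have [x ex] := Psi_im v.
  have z0 : z p \k* Psi v = 0.
    apply: (scalerI yn0); rewrite scaler0 ex -reassemble_isotypic -ex /reassemble big1 // => i _.
    have -> : isotypic (Psi v) i = (f p v).1 i by rewrite ffunE.
    by rewrite fv0 ffunE (linear_fun0 (@spv_lin k nu p)) kmul0l.
  apply: (@Psi_inj p); rewrite (linear_fun0 (Psi_lin (p := p))).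
  by have := fE p v; rewrite fv0 z0 scaler0 subr0 linear0.
move=> [w n].
have [x ex] := reassemble_ideal (fun i => w i).
have /(limageP _ (@compl_lin p))[y ey] := subvsP n.
(* yn ^- 3 undoes [isotypic_reassemble]; the second summand is compl y. *)
have [v ev] := Psi_onto (yn ^- 3 *: x + (y - yn ^- 2 *: (z p \k* y))).
have {}ev : Psi v = yn ^- 3 *: reassemble (fun i => w i) + compl y.
  rewrite ev kmul_linl ex (linear_funB (kmul_linl R)) kmulZl; congr (_ + (_ - _ *: _)).
  by rewrite kmulA.
exists v; apply: injective_projections.
  apply/ffunP => i; rewrite ffunE ev (isotypic_lin i) isotypic_reassemble isotypic_compl.
  by rewrite scalerA mulVf ?expf_neq0 // scale1r addr0.
apply: subvs_inj; rewrite fE ev kmul_linr ycentral_compl addr0 ycentral_reassemble.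
rewrite !scalerA mulrCA mulVf ?expf_neq0 // mulr1.
by rewrite addrAC subrr add0r ey.
Qed.

End MultiplicityInIdeal.
Arguments sandwich {k} nu {q} R x.
Arguments sandwich_lin {k} nu {q} R.

(** * Littlewood-Richardson coefficients as traces *)

Section TensorProduct.
Variable k : fieldType.
Local Notation ga m n := {ffun bij m n -> k^o}.
Local Notation "'\d' g" := (kdelta k g) (at level 10).

Definition ktens m n m' n' (x : ga m n) (y : ga m' n') : ga (m + m') (n + n') :=
  htens (x : hom (kSym k) m n) (y : hom (kSym k) m' n').

Lemma ktens_linl m n m' n' (y : ga m' n') : linear (fun x : ga m n => ktens x y).
Proof. exact: (@htens_linl k (kSym k)). Qed.
Lemma ktens_linr m n m' n' (x : ga m n) : linear (fun y : ga m' n' => ktens x y).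
Proof. exact: (@htens_linr k (kSym k)). Qed.
Lemma ktensM m n p m' n' p' (g : ga n p) (f : ga m n) (g' : ga n' p') (f' : ga m' n') :
  ktens (g \k* f) (g' \k* f') = ktens g g' \k* ktens f f'.
Proof. exact: (@hinterchange k (kSym k)). Qed.
Lemma ktens_delta m n m' n' (f : bij m n) (g : bij m' n') :
  ktens (\d f) (\d g) = \d (bij_sum f g).
Proof. exact/esym/(@hbij_sum k (kSym k)). Qed.

Lemma ktensE m n m' n' (x : ga m n) (y : ga m' n') :
  ktens x y = \sum_s \sum_t (x s * y t) *: \d (bij_sum s t).
Proof.
rewrite {1}[x]kdelta_decomp (linear_fun_sum _ _ _ (ktens_linl y)); apply: eq_bigr => s _.
rewrite (linear_funZ (ktens_linl y)) {1}[y]kdelta_decomp.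
rewrite (linear_fun_sum _ _ _ (ktens_linr _)) scaler_sumr; apply: eq_bigr => t _.
by rewrite (linear_funZ (ktens_linr _)) ktens_delta scalerA.
Qed.

Lemma hperm_delta n (s : 'S_n) : hperm (kSym k) s = \d (perm_bij s).
Proof. by []. Qed.

End TensorProduct.

Section InducedModule.
Variables (k : fieldType) (char0 : [pchar k] =i pred0).
Local Notation ga m n := {ffun bij m n -> k^o}.
Local Notation "'\d' g" := (kdelta k g) (at level 10).
Variables (al be : seq nat).
Hypotheses (part_al : is_partition al) (part_be : is_partition be).
Local Notation a := (sumn al).
Local Notation b := (sumn be).
Local Notation M := (Ind (Specht k al) (Specht k be) a b).
Local Notation rel p := (@ind_balanced k (Specht k al) (Specht k be) a b p).

Definition ypair : ga (a + b) (a + b) := ktens (ysym k al) (ysym k be).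

Lemma ypairM : ypair \k* ypair = (ynorm k al * ynorm k be) *: ypair.
Proof.
rewrite /ypair -ktensM !ysymM // (linear_funZ (ktens_linl _)).
by rewrite (linear_funZ (ktens_linr _)) scalerA.
Qed.

Definition ind_ideal_fun p (x : hom (kSym k) (a + b) p) (v : cobj (Specht k al) a)
  (w : cobj (Specht k be) b) : ga (a + b) p := (x : ga (a + b) p) \k* ktens (spv v) (spv w).

Lemma ind_ideal_lin1 p v w : linear (fun x => @ind_ideal_fun p x v w).
Proof. exact: (@kmul_linl k). Qed.

Lemma ind_ideal_lin2 p x w : linear (fun v => @ind_ideal_fun p x v w).
Proof.
apply: linear_cmp (kmul_linr _) _; apply: linear_cmp (ktens_linl _) _.
exact: spv_lin.
Qed.

Lemma ind_ideal_lin3 p x v : linear (@ind_ideal_fun p x v).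
Proof.
apply: linear_cmp (kmul_linr _) _; apply: linear_cmp (ktens_linr _) _.
exact: spv_lin.
Qed.

Lemma ind_ideal_rel p x v w x' v' w' : rel p x v w x' v' w' ->
  ind_ideal_fun x v w = ind_ideal_fun x' v' w'.
Proof.
case=> s t {}x {}v {}w; rewrite /ind_ideal_fun (spv_act (la := al)) (spv_act (la := be)).
rewrite ktensM kmulA; congr (_ \k* _).
Qed.

(** The induced module is the left ideal generated by ypair, through x (x) v
    (x) w |-> x (v (x) w). *)
Definition ind_ideal p : cobj M p -> ga (a + b) p := lift3 (@ind_ideal_fun p).

Lemma ind_ideal_lin p : linear (@ind_ideal p).
Proof.
apply: lift3_lin; [exact: ind_ideal_lin1 | exact: ind_ideal_lin2
  | exact: ind_ideal_lin3 | exact: ind_ideal_rel].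
Qed.

Lemma ind_ideal_pure p x v w :
  @ind_ideal p (pure3 (rel p) x v w) = (x : ga (a + b) p) \k* ktens (spv v) (spv w).
Proof.
apply: lift3_pure; [exact: ind_ideal_lin1 | exact: ind_ideal_lin2
  | exact: ind_ideal_lin3 | exact: ind_ideal_rel].
Qed.

Definition ideal_ind p (x : ga (a + b) p) : cobj M p :=
  pure3 (rel p) x (sp al (\d (bij1 a))) (sp be (\d (bij1 b))).

Lemma ideal_ind_lin p : linear (@ideal_ind p).
Proof. exact: pure3_lin1. Qed.

Lemma ind_idealE p x : @ind_ideal p (ideal_ind x) = x \k* ypair.
Proof. by rewrite ind_ideal_pure !spE !kmul1l. Qed.

Lemma ideal_ind_delta p (x : ga (a + b) p) (s : bij a a) (t : bij b b) :
  ideal_ind (x \k* \d (bij_sum s t)) = pure3 (rel p) x (sp al (\d s)) (sp be (\d t)).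
Proof.
have := pure3_rel (ind_bal (bij_perm s) (bij_perm t) x (sp al (\d (bij1 a))) (sp be (\d (bij1 b)))).
rewrite !hperm_delta !bij_permK (sp_act (la := al)) (sp_act (la := be)) !kmul1r => <-.
by rewrite -ktens_delta.
Qed.

Lemma ind_idealK p (q : cobj M p) :
  ideal_ind (ind_ideal q) = (ynorm k al * ynorm k be) *: q.
Proof.
move: q; apply: tens3_ext.
- exact: linear_cmp (ideal_ind_lin (p := p)) (ind_ideal_lin (p := p)).
- by move=> c u v; rewrite scalerDr !scalerA mulrC.
move=> x v w; rewrite ind_ideal_pure ktensE kmul_sumDr (linear_fun_sum _ _ _ (ideal_ind_lin (p := p))).
under eq_bigr => s _.
  rewrite kmul_sumDr (linear_fun_sum _ _ _ (ideal_ind_lin (p := p))).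
  under eq_bigr => t _ do rewrite kmulZr (linear_funZ (ideal_ind_lin (p := p))) ideal_ind_delta
    -scalerA -(linear_funZ (pure3_lin3 _ _ _)) -(linear_funZ (@sp_lin k be b)).
  rewrite -scaler_sumr -(linear_fun_sum _ _ _ (pure3_lin3 _ _ _)).
  rewrite -(linear_fun_sum _ _ _ (@sp_lin k be b)) -kdelta_decomp spK //.
  rewrite -(linear_funZ (pure3_lin2 _ _ _)) -(linear_funZ (@sp_lin k al a)).
  over.
rewrite -(linear_fun_sum _ _ _ (pure3_lin2 _ _ _)) -(linear_fun_sum _ _ _ (@sp_lin k al a)).
rewrite -kdelta_decomp spK // (linear_funZ (pure3_lin2 _ _ _)) (linear_funZ (pure3_lin3 _ _ _)).
by rewrite scalerA.
Qed.

Let nn0 : ynorm k al * ynorm k be != 0.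
Proof. by rewrite mulf_neq0 // ynorm_neq0. Qed.

Lemma has_mult_Ind nu : is_partition nu ->
  has_mult (Specht k nu) M (\dim (limage (sandwich nu ypair))).
Proof.
move=> part_nu; apply: (has_mult_ideal char0 part_nu (Psi := ind_ideal)).
- exact: ind_ideal_lin.
- move=> p; apply: linear_inj; first exact: ind_ideal_lin.
  move=> q q0; apply: (scalerI nn0); rewrite scaler0 -ind_idealK q0.
  exact: (linear_fun0 (ideal_ind_lin (p := p))).
- move=> p p' y; apply: tens3_ext.
  + exact: linear_cmp (ind_ideal_lin (p := p')) (cact_linr _).
  + exact: linear_cmp (kmul_linr y) (ind_ideal_lin (p := p)).
  move=> x v w; rewrite [cact _ _](ind_act_pure (y : hom (kSym k) p p')) !ind_ideal_pure kmulA.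
  by [].
- move=> p q; exists ((ynorm k al * ynorm k be)^-1 *: ind_ideal q).
  rewrite kmulZl -ind_idealE ind_idealK (linear_funZ (ind_ideal_lin (p := p))).
  by rewrite scalerA mulVf // scale1r.
- by move=> p x; exists (ideal_ind x); rewrite ind_idealE.
Qed.

Lemma LR_dim nu : is_partition nu -> LR k nu al be = \dim (limage (sandwich nu ypair)).
Proof.
move=> part_nu; have h := has_mult_Ind part_nu.
rewrite /LR; case: xgetP => [r _ hr|/(_ _ h)//].
exact: (has_mult_uniq char0 part_nu hr h).
Qed.

(** The coefficient is the rank of x |-> c_nu x (c_al (x) c_be), which is the
    trace of this quasi-idempotent operator up to a scalar. *)
Theorem LR_trace nu : is_partition nu ->
  ynorm k nu * (ynorm k al * ynorm k be) * (LR k nu al be)%:R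
  = \sum_(s : bij a a) \sum_(t : bij b b)
      ysym k al s * ysym k be t * chi (ysym k nu) (bij_sum s t).
Proof.
move=> part_nu; rewrite LR_dim //.
rewrite -(trace_rank (sandwich_lin nu ypair)) => [|f]; last first.
  rewrite /sandwich !kmulA ysymM // -!kmulA ypairM !kmulZr !kmulZl scalerA.
  by rewrite mulrC.
under eq_bigr => x _.
  rewrite /sandwich {1}/ypair ktensE kmul_sumDr sum_ffunE.
  under eq_bigr => s _.
    rewrite kmul_sumDr sum_ffunE.
    under eq_bigr => t _ do rewrite kmulZr ffunE -kmulA kdeltaM kmul_deltar bij_inv_comp bij_compA.
    over.
  over.
rewrite exchange_big; apply: eq_bigr => s _; rewrite exchange_big; apply: eq_bigr => t _ /=.
rewrite -scaler_sumr; congr (_ * _).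
by rewrite sum_bijV /chi; apply: eq_bigr => g _; rewrite bij_invK.
Qed.

End InducedModule.

(** * Functions of two bijections with a symmetry *)

Section SmallShapes.
Variable k : fieldType.
Local Notation ga m n := {ffun bij m n -> k^o}.

Lemma bij_val_inj n (g : bij n n) : (forall i, g i = i :> nat) -> g = bij1 n.
Proof. by move=> gi; apply: bijP => i; rewrite bij1E; apply/val_inj/gi. Qed.

Lemma ysym_sign la (t : bij (sumn la) (sumn la)) :
  (forall g, @rowp la g -> g = bij1 _) -> (forall g, @colp la g) -> ysym k la t = bsgn k t.
Proof.
move=> r1 c1; rewrite ysym_def kmulE' (bigD1 (bij1 _)) //= big1 ?addr0.
  by rewrite rsumE rowp1 mul1r bij_inv1 bij_comp1l csumE c1 mul1r.
move=> g gn1; rewrite rsumE; case: (boolP (rowp g)) => [/r1 g1|]; last by rewrite mul0r.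
by rewrite g1 eqxx in gn1.
Qed.

Lemma ysym_triv la (t : bij (sumn la) (sumn la)) :
  (forall g, @colp la g -> g = bij1 _) -> (forall g, @rowp la g) -> ysym k la t = 1.
Proof.
move=> c1 r1; rewrite ysym_def kmulE (bigD1 (bij1 _)) //= big1 ?addr0.
  by rewrite csumE colp1 bsgn1 rsumE r1 !mulr1.
move=> g gn1; rewrite csumE; case: (boolP (colp g)) => [/c1 g1|]; last by rewrite mul0r mulr0.
by rewrite g1 eqxx in gn1.
Qed.

Lemma ysym_col2 (t : bij 2 2) : ysym k [:: 1; 1]%N t = bsgn k t.
Proof.
have rE (i : 'I_2) : row [:: 1; 1]%N i = i by case: i => [[|[|//]] ?].
have cE (i : 'I_2) : col [:: 1; 1]%N i = 0%N by case: i => [[|[|//]] ?].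
apply: (@ysym_sign [:: 1; 1]%N) => g; last by apply/forallP => i; rewrite !cE.
by move/forallP => rg; apply: bij_val_inj => i; have := eqP (rg i); rewrite !rE.
Qed.

Lemma ysym_row2 (t : bij 2 2) : ysym k [:: 2]%N t = 1.
Proof.
have rE (i : 'I_2) : row [:: 2]%N i = 0%N by case: i => [[|[|//]] ?].
have cE (i : 'I_2) : col [:: 2]%N i = i by case: i => [[|[|//]] ?].
apply: (@ysym_triv [:: 2]%N) => g; last by apply/forallP => i; rewrite !rE.
by move/forallP => rg; apply: bij_val_inj => i; have := eqP (rg i); rewrite !cE.
Qed.

Lemma ynormE la : ynorm k la = \sum_g ysym k la (bij_inv g) * ysym k la g.
Proof. by rewrite /ynorm kmulE; apply: eq_bigr => g _; rewrite bij_comp1l. Qed.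

Lemma ynorm_col2 : ynorm k [:: 1; 1]%N = #|{: bij 2 2}|%:R.
Proof.
rewrite ynormE (eq_bigr (fun=> 1)) => [|g _]; last by rewrite !ysym_col2 bsgnV bsgn_sq.
by rewrite sumr_const.
Qed.

Lemma ynorm_row2 : ynorm k [:: 2]%N = #|{: bij 2 2}|%:R.
Proof.
rewrite ynormE (eq_bigr (fun=> 1)) => [|g _]; last by rewrite !ysym_row2 mulr1.
by rewrite sumr_const.
Qed.

Lemma bij11 (t : bij 1 1) : t = bij1 1.
Proof. by apply: bij_val_inj => i; rewrite [t i]ord1 [i]ord1. Qed.

Lemma sum_bij11 (F : bij 1 1 -> k) : \sum_t F t = F (bij1 1).
Proof. by rewrite (big_pred1 (bij1 1)) // => t; rewrite [t]bij11 /= eqxx. Qed.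

Lemma ysym_box (t : bij 1 1) : ysym k [:: 1]%N t = 1.
Proof. by rewrite [t]bij11 (ysym_coef1 k [:: 1]%N). Qed.

Lemma ynorm_box : ynorm k [:: 1]%N = 1.
Proof. by rewrite ynormE (sum_bij11 (fun g => ysym k [:: 1]%N (bij_inv g) * _)) !ysym_box mulr1. Qed.

Lemma chi_ysym_star la p (h : bij p p) : chi (kstar (ysym k la)) h = chi (ysym k la) h.
Proof. by rewrite ysym_def kstarM rsum_star csum_star chi_mulC. Qed.

End SmallShapes.

Section KernelSpace.
Variables (k : fieldType) (char0 : [pchar k] =i pred0).
Local Notation ga m n := {ffun bij m n -> k^o}.
Local Notation "'\d' g" := (kdelta k g) (at level 10).

Variables (M N q0 p0 : nat).
(** The space that contains both sides of the isomorphism: a function of two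
    bijections is the kernel of a linear map between group algebras, and also
    a tensor of two elements of them. *)
Definition kernels := {ffun bij M q0 * bij N p0 -> k^o}.

Definition tp (u : ga M q0) (v : ga N p0) : kernels := [ffun z => u z.1 * v z.2].

Lemma tpZE a u v z : (a *: tp u v) z = a * (u z.1 * v z.2).
Proof. by rewrite !ffunE. Qed.

Lemma tp_linl v : linear (fun u => tp u v).
Proof.
move=> a u u'; apply/ffunP => z; rewrite !ffunE mulrDl; congr (_ + _).
exact/esym/mulrA.
Qed.

Lemma tp_linr u : linear (tp u).
Proof.
by move=> a v v'; apply/ffunP => z; rewrite !ffunE mulrDr; congr (_ + _); rewrite mulrCA.
Qed.

Lemma tp_delta z : tp (\d z.1) (\d z.2) = fdelta k z.
Proof.
by apply/ffunP => w; rewrite !ffunE -natrM mulnb -pair_eqE.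
Qed.

Variables (H : finType) (hmul : H -> H -> H) (sg : H -> bij q0 q0) (ta : H -> bij p0 p0).
Variable ch : H -> k.
Hypotheses (hmul_inj : forall j, injective (hmul^~ j))
  (sgM : forall i j, sg (hmul i j) = sg i ** sg j)
  (taM : forall i j, ta (hmul i j) = ta i ** ta j)
  (chM : forall i j, ch (hmul i j) = ch i * ch j)
  (ch_sq : forall i, ch i * ch i = 1).

Section Operator.
Variables (x : ga M M) (y : ga N N).

Definition ksym_tp (u : ga M q0) (v : ga N p0) : kernels :=
  \sum_j ch j *: tp (\d (sg j) \k* u \k* x) (\d (ta j) \k* v \k* y).

(** The average over the symmetries j in H of the pair (sg j, ta j) with sign
    ch j, combined with right multiplication by x and y.  It is defined on a
    basis and computed on pure tensors by [ksym_tpE]. *)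
Definition ksym (f : kernels) : kernels := \sum_z f z *: ksym_tp (\d z.1) (\d z.2).

Lemma ksym_lin : linear ksym.
Proof.
move=> a f g; rewrite /ksym scaler_sumr -big_split; apply: eq_bigr => z _.
by rewrite !ffunE scalerDl scalerA.
Qed.

Lemma ksym_tp_linl v : linear (fun u => ksym_tp u v).
Proof.
apply: linear_sum_fun => j; apply: linear_scale_fun; apply: linear_cmp (tp_linl _) _.
by move=> a u u'; rewrite kmul_linr kmul_linl.
Qed.

Lemma ksym_tp_linr u : linear (ksym_tp u).
Proof.
apply: linear_sum_fun => j; apply: linear_scale_fun; apply: linear_cmp (tp_linr _) _.
by move=> a v v'; rewrite kmul_linr kmul_linl.
Qed.

Lemma ksym_tpE u v : ksym (tp u v) = ksym_tp u v.
Proof.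
rewrite /ksym; under eq_bigr => z _ do rewrite ffunE.
rewrite -(pair_bigA _ (fun g h => (u g * v h) *: ksym_tp (\d g) (\d h))) /=.
rewrite [u in RHS]kdelta_decomp (linear_fun_sum _ _ _ (ksym_tp_linl v)).
apply: eq_bigr => g _; rewrite (linear_funZ (ksym_tp_linl v)).
rewrite [v in RHS]kdelta_decomp (linear_fun_sum _ _ _ (ksym_tp_linr _)) scaler_sumr.
by apply: eq_bigr => h _; rewrite (linear_funZ (ksym_tp_linr _)) scalerA.
Qed.

Lemma ksym_tp_act j u v :
  ksym_tp (\d (sg j) \k* u) (\d (ta j) \k* v) = ch j *: ksym_tp u v.
Proof.
pose F i := ch i *: tp (\d (sg i) \k* u \k* x) (\d (ta i) \k* v \k* y).
have e : ksym_tp u v = \sum_i F (hmul i j) by exact: (reindex_inj (@hmul_inj j)).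
rewrite e scaler_sumr; apply: eq_bigr => i _.
by rewrite /F chM sgM taM -!kdeltaM !kmulA scalerA mulrCA ch_sq mulr1.
Qed.

Variables nx ny : k.
Hypotheses (xx : x \k* x = nx *: x) (yy : y \k* y = ny *: y).

(** Averaging twice multiplies by the order of H, and x and y are quasi-
    idempotent. *)
Lemma ksym_sq f : ksym (ksym f) = (#|H|%:R * (nx * ny)) *: ksym f.
Proof.
rewrite {2}/ksym (linear_fun_sum _ _ _ ksym_lin) {2}/ksym scaler_sumr; apply: eq_bigr => z _.
rewrite (linear_funZ ksym_lin) !scalerA mulrC -scalerA; congr (_ *: _).
rewrite {1}/ksym_tp (linear_fun_sum _ _ _ ksym_lin).
rewrite (eq_bigr (fun=> (nx * ny) *: ksym_tp (\d z.1) (\d z.2))) => [|j _].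
  by rewrite sumr_const -scaler_nat scalerA.
rewrite (linear_funZ ksym_lin) ksym_tpE -!(kmulA (\d _)) ksym_tp_act scalerA ch_sq scale1r.
rewrite /ksym_tp scaler_sumr; apply: eq_bigr => i _.
rewrite -!kmulA xx yy !kmulZr (linear_funZ (tp_linl _)) (linear_funZ (tp_linr _)).
by rewrite !scalerA mulrC.
Qed.

(** The diagonal coefficients of one term of the average form a product of two
    values of chi. *)
Lemma ksym_dim : #|H|%:R * (nx * ny) * (\dim (limage ksym))%:R
  = \sum_j ch j * (chi x (sg j) * chi y (ta j)).
Proof.
rewrite -(trace_rank ksym_lin ksym_sq).
under eq_bigr => z _ do rewrite -tp_delta ksym_tpE sum_ffunE.
rewrite exchange_big; apply: eq_bigr => j _ /=.
rewrite (eq_bigr (fun z : bij M q0 * bij N p0 =>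
    ch j * (x (bij_inv z.1 ** bij_inv (sg j) ** z.1) * y (bij_inv z.2 ** bij_inv (ta j) ** z.2)))).
  rewrite -(pair_bigA _ (fun g h => ch j * (x (bij_inv g ** bij_inv (sg j) ** g)
      * y (bij_inv h ** bij_inv (ta j) ** h)))) /=.
  rewrite /chi big_distrlr mulr_sumr; apply: eq_bigr => g _.
  by rewrite mulr_sumr.
by move=> z _; rewrite tpZE !kdeltaM !kmul_deltal !bij_inv_comp.
Qed.

End Operator.
End KernelSpace.

Notation bij_pair d := (bij d d * bij 2 2)%type.

Section Dimensions.
Variables (k : fieldType) (char0 : [pchar k] =i pred0).
Local Notation ga m n := {ffun bij m n -> k^o}.

Definition pair_mul d (i j : bij_pair d) : bij_pair d := (i.1 ** j.1, i.2 ** j.2).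

Lemma pair_mul_inj d (j : bij_pair d) : injective (@pair_mul d ^~ j).
Proof.
move=> i i' e; have e1 : i.1 ** j.1 = i'.1 ** j.1 := congr1 fst e.
have e2 : i.2 ** j.2 = i'.2 ** j.2 := congr1 snd e.
apply: injective_projections.
  by rewrite -[i.1](bij_compKr j.1) e1 bij_compKr.
by rewrite -[i.2](bij_compKr j.2) e2 bij_compKr.
Qed.

Lemma card_bij_neq0 n : #|{: bij n n}|%:R != 0 :> k.
Proof. by apply: natr_neq0 => //; apply/card_gt0P; exists (bij1 n). Qed.

Lemma card_pair d : #|{: bij_pair d}|%:R = #|{: bij d d}|%:R * #|{: bij 2 2}|%:R :> k.
Proof. by rewrite card_prod natrM. Qed.

(** The symmetries of 1 + [,] : d + 2 -> d + 1, with the action on outputs, on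
    inputs, and the sign. *)
Definition br_out d (j : bij_pair d) : bij (d + 1) (d + 1) := bij_sum j.1 (bij1 1).
Definition br_in d (j : bij_pair d) : bij (d + 2) (d + 2) := bij_sum j.1 j.2.
Definition br_sgn d (j : bij_pair d) : k := bsgn k j.2.

(** The symmetries of 1 + c : d -> d + 2. *)
Definition cas_out d (j : bij_pair d) : bij (d + 2) (d + 2) := bij_sum j.1 j.2.
Definition cas_in d (j : bij_pair d) : bij d d := j.1.
Definition cas_sgn d (j : bij_pair d) : k := 1.

Lemma br_outM d (i j : bij_pair d) : br_out (pair_mul i j) = br_out i ** br_out j.
Proof. by rewrite /br_out bij_sum_comp bij_comp1l. Qed.
Lemma br_inM d (i j : bij_pair d) : br_in (pair_mul i j) = br_in i ** br_in j.
Proof. by rewrite /br_in bij_sum_comp. Qed.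
Lemma br_sgnM d (i j : bij_pair d) : br_sgn (pair_mul i j) = br_sgn i * br_sgn j.
Proof. exact: bsgnM. Qed.
Lemma br_sgn_sq d (i : bij_pair d) : br_sgn i * br_sgn i = 1.
Proof. exact: bsgn_sq. Qed.
Lemma cas_outM d (i j : bij_pair d) : cas_out (pair_mul i j) = cas_out i ** cas_out j.
Proof. by rewrite /cas_out bij_sum_comp. Qed.
Lemma cas_inM d (i j : bij_pair d) : cas_in (pair_mul i j) = cas_in i ** cas_in j.
Proof. by []. Qed.
Lemma cas_sgnM d (i j : bij_pair d) : cas_sgn (pair_mul i j) = cas_sgn i * cas_sgn j.
Proof. by rewrite /cas_sgn mulr1. Qed.
Lemma cas_sgn_sq d (i : bij_pair d) : cas_sgn i * cas_sgn i = 1.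
Proof. by rewrite /cas_sgn mulr1. Qed.

Lemma class_sum_r N (x : ga N N) b (t : bij b b) :
  @class_family k (fun p (s : bij p p) => chi x (bij_sum s t)).
Proof.
move=> p q g h; rewrite -[t in LHS]bij_comp1r -bij_sum_comp chi_conj bij_sum_comp.
by rewrite bij_comp1l.
Qed.

Variables (la mu : seq nat) (part_la : is_partition la) (part_mu : is_partition mu).

(** Right multiplication by kstar (ysym la) is the transpose of right
    multiplication by ysym la: it occurs for spaces of linear maps out of the
    Specht module, where ysym la occurs for tensor products with it. *)
Definition ysym_or_star (y : ga (sumn la) (sumn la)) :=
  y = ysym k la \/ y = kstar (ysym k la).

Lemma ysym_or_starM y : ysym_or_star y -> y \k* y = ynorm k la *: y.
Proof.
case=> ->; first exact: ysymM.
by rewrite -kstarM ysymM // (linear_funZ (@kstar_lin _ _ _)).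
Qed.

Lemma chi_ysym_or_star y p (h : bij p p) : ysym_or_star y -> chi y h = chi (ysym k la) h.
Proof. by case=> ->; rewrite ?chi_ysym_star. Qed.

Lemma chi_ysymV p (h : bij p p) : chi (ysym k la) (bij_inv h) = chi (ysym k la) h.
Proof. by rewrite -chi_star chi_ysym_star. Qed.

(** Frobenius reciprocity at the level of traces: expanding the character of
    la as a sum over conjugates of its Young symmetrizer gives the trace of
    [LR_trace]. *)
Lemma cas_dim y : ysym_or_star y ->
  \dim (limage (@ksym k _ _ _ _ _ (@cas_out (sumn la)) (@cas_in (sumn la)) (@cas_sgn _)
    (ysym k mu) y)) = LR k mu la [:: 2].
Proof.
move=> ey; apply: (natr_eq char0).
have p2 : is_partition [:: 2]%N by [].
have yla := ynorm_neq0 char0 part_la; have ymu := ynorm_neq0 char0 part_mu.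
have nz : #|{: bij_pair (sumn la)}|%:R * (ynorm k mu * ynorm k la) != 0.
  by rewrite card_pair !mulf_neq0 ?card_bij_neq0.
apply: (mulfI nz).
rewrite (ksym_dim (@pair_mul_inj _) (@cas_outM _) (@cas_inM _) (@cas_sgnM _) (@cas_sgn_sq _)
  (ysymM char0 part_mu) (ysym_or_starM ey)).
rewrite card_pair -ynorm_row2.
transitivity (#|{: bij (sumn la) (sumn la)}|%:R *
  (ynorm k mu * (ynorm k la * ynorm k [:: 2]%N) * (LR k mu la [:: 2])%:R)); last first.
  by ring.
rewrite (LR_trace char0 part_la p2 part_mu).
pose F (s : bij (sumn la) (sumn la)) := \sum_(t : bij 2 2) chi (ysym k mu) (bij_sum s t).
have Fconj g s : F (g ** s ** bij_inv g) = F s.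
  apply: eq_bigr => t _; have /= e := class_sum_r (ysym k mu) t g (s ** bij_inv g).
  by rewrite -bij_compA e bij_compKVr.
transitivity (\sum_s F s * chi (ysym k la) (bij_inv s)).
  rewrite -(pair_bigA _ (fun s t => cas_sgn (s, t) * (chi (ysym k mu) (cas_out (s, t))
    * chi y (cas_in (s, t))))) /=.
  apply: eq_bigr => s _; rewrite mulr_suml; apply: eq_bigr => t _.
  by rewrite mul1r chi_ysym_or_star // chi_ysymV.
under eq_bigr => s _ do rewrite /chi mulr_sumr bij_invK.
rewrite exchange_big /= mulr_natl -sumr_const; apply: eq_bigr => g _.
rewrite (sum_bijl g) (sum_bijr (bij_inv g)); apply: eq_bigr => s _.
rewrite bij_compA Fconj -!bij_compA bij_compVl bij_comp1r bij_compKl mulrC mulr_sumr.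
by apply: eq_bigr => t _; rewrite (ysym_row2 k t) mulr1.
Qed.

(** The trace is an inner product over S_d of the restrictions of the two
    characters, against the sign of S_2 and against S_1.  Parseval's identity
    expands it over rho, and the coefficients are Littlewood-Richardson
    traces. *)
Lemma br_dim d y : sumn la = (d + 2)%N -> ysym_or_star y ->
  \dim (limage (@ksym k _ _ _ _ _ (@br_out d) (@br_in d) (@br_sgn d) (ysym k mu) y))
  = (\sum_(rho <- parts d) LR k la rho [:: 1; 1] * LR k mu rho [:: 1])%N.
Proof.
move=> ela ey; apply: (natr_eq char0).
have p11 : is_partition [:: 1; 1]%N by [].
have p1 : is_partition [:: 1]%N by [].
have yla := ynorm_neq0 char0 part_la; have ymu := ynorm_neq0 char0 part_mu.
have nz : #|{: bij_pair d}|%:R * (ynorm k mu * ynorm k la) != 0.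
  by rewrite card_pair !mulf_neq0 ?card_bij_neq0.
apply: (mulfI nz).
rewrite (ksym_dim (@pair_mul_inj _) (@br_outM _) (@br_inM _) (@br_sgnM _) (@br_sgn_sq _)
  (ysymM char0 part_mu) (ysym_or_starM ey)).
pose f p (s : bij p p) := \sum_(t : bij 2 2) bsgn k t * chi (ysym k la) (bij_sum s t).
pose f' p (s : bij p p) := chi (ysym k mu) (bij_sum s (bij1 1)).
have fc : class_family f.
  move=> p q g h; apply: eq_bigr => t _; congr (_ * _).
  by have /= -> := class_sum_r (ysym k la) t g h.
have fc' : class_family f' by move=> p q g h; have /= := class_sum_r (ysym k mu) (bij1 1) g h.
transitivity (\sum_(s : bij d d) f d (bij_inv s) * f' d s).
  rewrite -(pair_bigA _ (fun s t => br_sgn (s, t) * (chi (ysym k mu) (br_out (s, t))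
    * chi y (br_in (s, t))))) /=.
  apply: eq_bigr => s _; rewrite /f [in RHS]sum_bijV mulr_suml; apply: eq_bigr => t _.
  rewrite -bij_inv_sum chi_ysymV bsgnV chi_ysym_or_star // /br_sgn /f' /br_out /br_in /=.
  by rewrite -mulrA; congr (_ * _); rewrite mulrC.
rewrite -(ysym_parseval char0 d fc fc') natr_sum card_pair -!mulrA; congr (_ * _).
rewrite !mulr_sumr big_seq [RHS]big_seq; apply: eq_bigr => rho.
rewrite mem_parts => /andP[prho _]; have yrho := ynorm_neq0 char0 prho.
have -> : kpair f (ysym k rho) = ynorm k la * (ynorm k rho * ynorm k [:: 1; 1]%N)
    * (LR k la rho [:: 1; 1])%:R.
  rewrite (LR_trace char0 prho p11 part_la) /kpair; apply: eq_bigr => s _.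
  by rewrite /f mulr_sumr; apply: eq_bigr => t _; rewrite (ysym_col2 k t) mulrA.
have -> : kpair f' (ysym k rho) = ynorm k mu * (ynorm k rho * ynorm k [:: 1]%N)
    * (LR k mu rho [:: 1])%:R.
  rewrite (LR_trace char0 prho p1 part_mu) /kpair; apply: eq_bigr => s _.
  by rewrite (sum_bij11 (fun t => ysym k rho s * _ * _)) (ysym_box k (bij1 1)) mulr1.
rewrite ynorm_box ynorm_col2 natrM mulr1.
by field.
Qed.

End Dimensions.

(** * Generation of presented PROPs *)

Section Generation.
Variables (k : fieldType) (G : signature).
Variable rel : forall m n, tm k G m n -> tm k G m n -> Prop.
Local Notation P := (presented rel).
Local Notation hhom := (fun m n => GRing.Lmodule.sort (hom P m n)).

Definition generator (g : gen G) : hom P (gdom g) (gcod g) := tclass rel (tgen g).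

Definition is_gen m n (x : hom P m n) : Prop :=
  exists g d, heq (H := hhom) (htens (hid P d) (generator g)) x.

(** Composites on the left are the only ones in the definition; closure under
    composition and tensor products is a consequence. *)
Inductive gspan p : forall q, hom P p q -> Prop :=
| gs_bij q (f : bij p q) : gspan (hbij P f)
| gs_bijc q r (f : bij q r) (x : hom P p q) : gspan x -> gspan (hcomp (hbij P f) x)
| gs_gen q r (y : hom P q r) (x : hom P p q) :
    is_gen y -> gspan x -> gspan (hcomp y x)
| gs_zero q : gspan (0 : hom P p q)
| gs_lin q a (x y : hom P p q) : gspan x -> gspan y -> gspan (a *: x + y).

Lemma gspan_comp p q r (x : hom P q r) (y : hom P p q) :
  gspan x -> gspan y -> gspan (hcomp x y).
Proof.
move=> gx gy; elim: gx => {r x}.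
- by move=> r f; exact: gs_bijc.
- by move=> r s f x _ IH; rewrite -hcompA; exact: gs_bijc.
- by move=> r s z x gz _ IH; rewrite -hcompA; exact: gs_gen.
- by move=> r; rewrite hcomp0l; exact: gs_zero.
- by move=> r a x x' _ IH _ IH'; rewrite hcomp_linl; exact: gs_lin.
Qed.

Lemma hid_sum d e : htens (hid P d) (hid P e) = hid P (d + e).
Proof. by rewrite /hid -hbij_sum bij_sum1. Qed.

Lemma htens_idM e m n p (x : hom P n p) (y : hom P m n) :
  htens (hid P e) (hcomp x y) = hcomp (htens (hid P e) x) (htens (hid P e) y).
Proof. by rewrite -hinterchange /hid hcomp1l. Qed.

Lemma is_gen_tens e m n (x : hom P m n) : is_gen x -> is_gen (htens (hid P e) x).
Proof.
move=> [g [d gx]]; case: gx; exists g, (e + d)%N; rewrite -hid_sum.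
exact: htensA.
Qed.

Lemma gspan_idtens e p q (x : hom P p q) : gspan x -> gspan (htens (hid P e) x).
Proof.
elim=> {q x}.
- by move=> q f; rewrite /hid -hbij_sum; exact: gs_bij.
- by move=> q r f x _ IH; rewrite htens_idM /hid -hbij_sum; exact: gs_bijc.
- by move=> q r y x gy _ IH; rewrite htens_idM; apply: gs_gen => //; exact: is_gen_tens.
- by move=> q; rewrite htens_0r; exact: gs_zero.
- by move=> q a x y _ IH _ IH'; rewrite htens_linr; exact: gs_lin.
Qed.

(** A tensor product is the composite of x + 1 and 1 + y, and the symmetry
    moves the identity of x + 1 to the left. *)
Lemma gspan_tens m n m' n' (x : hom P m n) (y : hom P m' n') :
  gspan x -> gspan y -> gspan (htens x y).
Proof.
move=> gx gy.
have -> : htens x y = hcomp (htens x (hid P n')) (htens (hid P m) y).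
  by rewrite -hinterchange /hid hcomp1l hcomp1r.
have -> : htens x (hid P n') = hcomp (hbij P (swap n' n))
    (hcomp (htens (hid P n') x) (hbij P (bij_inv (swap n' m)))).
  by rewrite hcompA hbij_swap -hcompA -hbij_comp bij_compVr hcomp1r.
apply: gspan_comp; last exact: gspan_idtens.
by apply/gs_bijc/gspan_comp; [exact: gspan_idtens | exact: gs_bij].
Qed.

Lemma gspan_generator g : gspan (generator g).
Proof.
rewrite -[generator g]hcomp1r; apply: gs_gen; last exact: gs_bij.
by exists g, 0%N; rewrite /hid htens0l; exact: heq_refl.
Qed.

Theorem gspan_all p q (x : hom P p q) : gspan x.
Proof.
case: (tclass_surj x) => t; elim: t => {p q x}.
- exact: gspan_generator.
- by move=> m n f; exact: gs_bij.
- move=> m n p t IHt u IHu.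
  by rewrite -[tclass _ _](pr_compE rel t u); exact: gspan_comp.
- move=> m n m' n' t IHt u IHu.
  by rewrite -[tclass _ _](pr_tensE rel t u); exact: gspan_tens.
- by move=> m n; exact: gs_zero.
- move=> m n t IHt u IHu.
  by rewrite tclassD -[tclass rel t]scale1r; exact: gs_lin.
- move=> m n a t IHt.
  by rewrite tclassZ -[_ *: _]addr0; apply: gs_lin => //; exact: gs_zero.
Qed.

Lemma presented_ext (Q : lprop k) (F F' : lprop_mor P Q) :
  (forall g, pmap F (generator g) = pmap F' (generator g)) ->
  forall p q (x : hom P p q), pmap F x = pmap F' x.
Proof.
move=> FF p q x; elim: (gspan_all x) => {q x}.
- by move=> q f; rewrite !pmap_bij.
- by move=> q r f x _ IH; rewrite !pmap_comp !pmap_bij IH.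
- move=> q r y x [g [d gy]] _ IH; rewrite !pmap_comp IH; congr (hcomp _ _).
  by case: gy; rewrite !pmap_tens /hid !pmap_bij FF.
- by move=> q; rewrite (linear_fun0 (@pmap_lin _ _ _ F p q)) (linear_fun0 (@pmap_lin _ _ _ F' p q)).
- by move=> q a x y _ IH _ IH'; rewrite !pmap_lin IH IH'.
Qed.

End Generation.

(** * PROPs in which only invertible morphisms preserve the object *)

Section Monotone.
Variables (k : fieldType) (W : finprop).

(** Under this condition a product is invertible only if its factors are, so
    the linear projection onto the invertible morphisms is a functor
    ([sym_mor]). *)
Definition monotone_prop : Prop :=
  [/\ (forall p q, fp_hom W p q -> (q <= p)%N) \/ (forall p q, fp_hom W p q -> (p <= q)%N),
      forall p q (w : fp_hom W p q), p = q -> exists f, w = fp_bij W f &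
      forall p q, injective (@fp_bij W p q)].

Hypothesis W_mono : monotone_prop.

Lemma comp_is_bij p q r (a : fp_hom W q r) (b : fp_hom W p q) f :
  fp_comp a b = fp_bij W f -> (exists g, a = fp_bij W g) /\ (exists g, b = fp_bij W g).
Proof.
case: W_mono => dir Wbij _ _; have pr := bij_dim f.
have qp : p = q.
  apply/eqP; rewrite eqn_leq; case: dir => dir; rewrite (dir _ _ b) ?andbT /= pr.
    exact: dir a.
  exact: dir a.
by split; apply: Wbij; rewrite -?qp.
Qed.

Lemma tens_is_bij m n m' n' (a : fp_hom W m n) (b : fp_hom W m' n') f :
  fp_tens a b = fp_bij W f -> (exists g, a = fp_bij W g) /\ (exists g, b = fp_bij W g).
Proof.
case: W_mono => dir Wbij _ _; have e := bij_dim f.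
have mn : m = n.
  apply/eqP; rewrite eqn_leq; case: dir => dir; rewrite (dir _ _ a) ?andbT /=;
    rewrite -(leq_add2r m') e leq_add2l; exact: dir b.
by split; apply: Wbij => //; move: e; rewrite mn => /addnI.
Qed.

Definition to_sym m n (x : hom (linearize k W) m n) : hom (kSym k) m n :=
  [ffun f => (x : {ffun fp_hom W m n -> k^o}) (fp_bij W f)] : {ffun bij m n -> k^o}.

Lemma to_sym_lin m n : linear (@to_sym m n).
Proof. by move=> a x y; apply/ffunP => f; rewrite !ffunE. Qed.

Lemma to_sym_bij m n (f : bij m n) : to_sym (hbij (linearize k W) f) = hbij (kSym k) f.
Proof.
case: W_mono => _ _ Winj.
by apply/ffunP => g; rewrite !ffunE (inj_eq (@Winj _ _)).
Qed.

Lemma to_sym_nbij m n (w : fp_hom W m n) :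
  (forall f, w <> fp_bij W f) -> to_sym (fdelta k w : hom (linearize k W) m n) = 0.
Proof.
by move=> wn; apply/ffunP => f; rewrite !ffunE; case: eqP => // e; case: (wn f).
Qed.

Lemma to_sym_comp m n p (x : hom (linearize k W) n p) (y : hom (linearize k W) m n) :
  to_sym (hcomp x y) = hcomp (to_sym x) (to_sym y).
Proof.
have lsym := to_sym_lin.
move: x; apply: (@fspan_ext k _ _ (fun x => to_sym (hcomp (x : hom (linearize k W) n p) y))
  (fun x => hcomp (to_sym (x : hom (linearize k W) n p)) (to_sym y))) => [||a].
- exact: linear_cmp (@lsym _ _) (hcomp_linl y).
- exact: linear_cmp (hcomp_linl (to_sym y)) (@lsym _ _).
move: y; apply: (@fspan_ext k _ _ (fun y => to_sym (hcomp (fdelta k a : hom (linearize k W) n p) (y : hom (linearize k W) m n)))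
  (fun y => hcomp (to_sym (fdelta k a : hom (linearize k W) n p)) (to_sym (y : hom (linearize k W) m n)))) => [||b].
- exact: linear_cmp (@lsym _ _) (hcomp_linr _).
- exact: linear_cmp (hcomp_linr _) (@lsym _ _).
have -> : hcomp (fdelta k a : hom (linearize k W) n p) (fdelta k b : hom (linearize k W) m n)
    = fdelta k (fp_comp a b) by exact: bilext_delta.
have [[g eg]|na] := pselect (exists g, a = fp_bij W g); last first.
  rewrite [X in hcomp X _]to_sym_nbij => [|f e]; last by apply: na; exists f.
  rewrite hcomp0l to_sym_nbij // => f /comp_is_bij[ea _]; exact: na.
have [[h eh]|nb] := pselect (exists g, b = fp_bij W g); last first.
  rewrite [X in hcomp _ X]to_sym_nbij => [|f e]; last by apply: nb; exists f.
  rewrite hcomp0r to_sym_nbij // => f /comp_is_bij[_ eb]; exact: nb.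
rewrite eg eh -fp_bij_comp [LHS]to_sym_bij [X in hcomp X _]to_sym_bij [X in hcomp _ X]to_sym_bij.
exact: hbij_comp.
Qed.

Lemma to_sym_tens m n m' n' (x : hom (linearize k W) m n) (y : hom (linearize k W) m' n') :
  to_sym (htens x y) = htens (to_sym x) (to_sym y).
Proof.
have lsym := to_sym_lin.
move: x; apply: (@fspan_ext k _ _ (fun x => to_sym (htens (x : hom (linearize k W) m n) y))
  (fun x => htens (to_sym (x : hom (linearize k W) m n)) (to_sym y))) => [||a].
- exact: linear_cmp (@lsym _ _) (htens_linl y).
- exact: linear_cmp (htens_linl (to_sym y)) (@lsym _ _).
move: y; apply: (@fspan_ext k _ _ (fun y => to_sym (htens (fdelta k a : hom (linearize k W) m n) (y : hom (linearize k W) m' n')))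
  (fun y => htens (to_sym (fdelta k a : hom (linearize k W) m n)) (to_sym (y : hom (linearize k W) m' n')))) => [||b].
- exact: linear_cmp (@lsym _ _) (htens_linr _).
- exact: linear_cmp (htens_linr _) (@lsym _ _).
have -> : htens (fdelta k a : hom (linearize k W) m n) (fdelta k b : hom (linearize k W) m' n')
    = fdelta k (fp_tens a b) by exact: bilext_delta.
have [[g eg]|na] := pselect (exists g, a = fp_bij W g); last first.
  rewrite [X in htens X _]to_sym_nbij => [|f e]; last by apply: na; exists f.
  rewrite htens_0l to_sym_nbij // => f /tens_is_bij[ea _]; exact: na.
have [[h eh]|nb] := pselect (exists g, b = fp_bij W g); last first.
  rewrite [X in htens _ X]to_sym_nbij => [|f e]; last by apply: nb; exists f.
  rewrite htens_0r to_sym_nbij // => f /tens_is_bij[_ eb]; exact: nb.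
rewrite eg eh -fp_bij_sum [LHS]to_sym_bij [X in htens X _]to_sym_bij [X in htens _ X]to_sym_bij.
exact: hbij_sum.
Qed.

Definition sym_mor : lprop_mor (linearize k W) (kSym k) :=
  @LPropMor k _ _ to_sym to_sym_lin to_sym_comp to_sym_tens to_sym_bij.

End Monotone.

(** * Coefficients on the translates of a morphism *)

Section Model.
Variables (k : fieldType) (char0 : [pchar k] =i pred0).
Local Notation ga m n := {ffun bij m n -> k^o}.
Local Notation "'\d' g" := (kdelta k g) (at level 10).
Variable W : finprop.
Hypothesis W_mono : monotone_prop W.
Local Notation LW := (linearize k W).
Local Notation wcomp := (@fp_comp W _ _ _).
Local Notation wbij := (@fp_bij W _ _).

Variables (p0 q0 : nat) (w0 : fp_hom W p0 q0).
Hypothesis p0q0 : p0 != q0.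
Hypothesis W_factor : forall q, fp_hom W p0 q -> fp_hom W q q0 -> p0 = q \/ q = q0.

Definition translate p q (s : bij q0 q) (t : bij p p0) : fp_hom W p q :=
  wcomp (wbij s) (wcomp w0 (wbij t)).

Definition wcoef p q (x : hom LW p q) (s : bij q0 q) (t : bij p p0) : k :=
  (x : {ffun fp_hom W p q -> k^o}) (translate s t).

Lemma wcoef_lin p q s t : linear (fun x : hom LW p q => wcoef x s t : k^o).
Proof. by move=> a x y; rewrite /wcoef !ffunE. Qed.

Lemma lin_deltal p q r (f : bij q r) (x : hom LW p q) (w : fp_hom W p q) :
  (hcomp (hbij LW f) x : {ffun fp_hom W p r -> k^o}) (wcomp (wbij f) w)
  = (x : {ffun fp_hom W p q -> k^o}) w.
Proof.
rewrite [LHS]bilext_deltal (bigD1 w) //= eqxx mulr1 big1 ?addr0 // => b bw.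
case: eqP => [e|]; last by rewrite mulr0.
case/eqP: bw; rewrite -[b]fp_comp1l -[w]fp_comp1l -(bij_compVl f) !fp_bij_comp.
by rewrite -!fp_compA e.
Qed.

Lemma lin_deltar p q r (f : bij p q) (x : hom LW q r) (w : fp_hom W q r) :
  (hcomp x (hbij LW f) : {ffun fp_hom W p r -> k^o}) (wcomp w (wbij f))
  = (x : {ffun fp_hom W q r -> k^o}) w.
Proof.
rewrite [LHS]bilext_deltar (bigD1 w) //= eqxx mulr1 big1 ?addr0 // => b bw.
case: eqP => [e|]; last by rewrite mulr0.
case/eqP: bw; rewrite -[b]fp_comp1r -[w]fp_comp1r -(bij_compVr f) !fp_bij_comp.
by rewrite !fp_compA e.
Qed.

Lemma wcoef_compl p q r (f : bij q r) (x : hom LW p q) (s : bij q0 q) t :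
  wcoef (hcomp (hbij LW f) x) (f ** s) t = wcoef x s t.
Proof. by rewrite /wcoef -(lin_deltal f) /translate fp_bij_comp -!fp_compA. Qed.

Lemma wcoef_compr p q r (f : bij p q) (x : hom LW q r) s (t : bij q p0) :
  wcoef (hcomp x (hbij LW f)) s (t ** f) = wcoef x s t.
Proof. by rewrite /wcoef -(lin_deltar f) /translate fp_bij_comp -!fp_compA. Qed.

Section Transport.
Variables (M N : nat) (u : ga N p0 -> ga M q0).
Hypothesis u_lin : linear u.

(** The action of x as a derivation would act if it sent w0 to u: the sum over
    the translates of w0 of their coefficients in x, each acting as s u t.  If
    w0 has symmetries, a translate is counted once for each pair (s, t). *)
Definition Phi p q (x : hom LW p q) (v : ga N p) : ga M q :=
  \sum_(s : bij q0 q) \sum_(t : bij p p0) wcoef x s t *: (\d s \k* u (\d t \k* v)).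

Lemma Phi_linl p q v : linear (fun x : hom LW p q => Phi x v).
Proof.
apply: linear_sum_fun => s; apply: linear_sum_fun => t a x y.
have := wcoef_lin s t a x y; rewrite /= => ->.
by rewrite scalerDl scalerA.
Qed.

Lemma Phi_linr p q (x : hom LW p q) : linear (Phi x).
Proof.
apply: linear_sum_fun => s; apply: linear_sum_fun => t; apply: linear_scale_fun.
exact: linear_cmp (kmul_linr _) (linear_cmp u_lin (kmul_linr _)).
Qed.

Lemma Phi0l p q (x : hom LW p q) v : q0 != q -> Phi x v = 0.
Proof. by move=> qq; rewrite /Phi big1 // => s _; case/eqP: qq; exact: bij_dim s. Qed.

Lemma Phi0r p q (x : hom LW p q) v : p != p0 -> Phi x v = 0.
Proof.
move=> pp; rewrite /Phi big1 // => s _; rewrite big1 // => t _.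
by case/eqP: pp; exact: bij_dim t.
Qed.

Lemma Phi_bijl p q r (f : bij q r) (x : hom LW p q) v :
  Phi (hcomp (hbij LW f) x) v = \d f \k* Phi x v.
Proof.
rewrite /Phi (sum_bijl f) kmul_sumDr; apply: eq_bigr => s _.
rewrite kmul_sumDr; apply: eq_bigr => t _.
by rewrite wcoef_compl kmulZr -kdeltaM kmulA.
Qed.

Lemma Phi_bijr p q r (f : bij p q) (x : hom LW q r) v :
  Phi (hcomp x (hbij LW f)) v = Phi x (\d f \k* v).
Proof.
rewrite /Phi; apply: eq_bigr => s _; rewrite (sum_bijr f); apply: eq_bigr => t _.
by rewrite wcoef_compr -kdeltaM kmulA.
Qed.

(** For basis vectors a and b, the composite a b can be a translate of w0 only
    if a or b is invertible; the two terms of the rule are these two cases. *)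
Lemma Phi_comp p q r (x : hom LW q r) (y : hom LW p q) v :
  Phi (hcomp x y) v = (to_sym x : ga q r) \k* Phi y v + Phi x ((to_sym y : ga p q) \k* v).
Proof.
case: W_mono => _ Wbij _.
have nofac : fp_hom W q r -> fp_hom W p q -> p != q -> q != r -> p = p0 -> q0 = r -> False.
  move=> a b npq nqr epp err; move: a b npq nqr; rewrite epp -err => a b.
  by case: (W_factor b a) => ->; rewrite eqxx.
pose sx (x : hom LW q r) : ga q r := to_sym x; pose sy (y : hom LW p q) : ga p q := to_sym y.
have lsx : linear sx by exact: to_sym_lin.
have lsy : linear sy by exact: to_sym_lin.
rewrite -/(sx x) -/(sy y).
move: x; apply: (@fspan_ext k _ _ (fun x => Phi (hcomp (x : hom LW q r) y) v)
  (fun x => sx x \k* Phi y v + Phi (x : hom LW q r) (sy y \k* v))) => [||a].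
- exact: linear_cmp (Phi_linl v) (hcomp_linl y).
- move=> c x x'; rewrite lsx kmul_linl (Phi_linl (sy y \k* v)) /= scalerDr.
  by rewrite addrACA.
move: y; apply: (@fspan_ext k _ _ (fun y => Phi (hcomp (fdelta k a : hom LW q r) (y : hom LW p q)) v)
  (fun y => sx (fdelta k a) \k* Phi (y : hom LW p q) v + Phi (fdelta k a : hom LW q r) (sy y \k* v))) => [||b].
- exact: linear_cmp (Phi_linl v) (hcomp_linr _).
- move=> c y y'; rewrite lsy kmul_linl (Phi_linl v) kmul_linr Phi_linr /= scalerDr.
  by rewrite addrACA.
have [epq|npq] := eqVneq p q.
  have [f ef] := Wbij _ _ b epq.
  have -> : fdelta k b = hbij LW f by rewrite ef.
  rewrite Phi_bijr [X in _ = _ + Phi _ (X \k* _)](to_sym_bij k W_mono).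
  suff -> : Phi (hbij LW f) v = 0 by rewrite kmul0r add0r.
  have [epp|] := eqVneq p p0; last exact: Phi0r.
  by apply: Phi0l; rewrite -epq epp eq_sym.
have sb : sy (fdelta k b) = 0.
  by apply: to_sym_nbij => f _; case/eqP: npq; exact: bij_dim f.
rewrite sb kmul0l (linear_fun0 (Phi_linr _)) addr0.
have [eqr|nqr] := eqVneq q r.
  have [f ef] := Wbij _ _ a eqr.
  have -> : fdelta k a = hbij LW f by rewrite ef.
  by rewrite Phi_bijl [X in _ = X \k* _](to_sym_bij k W_mono).
have sa : sx (fdelta k a) = 0.
  by apply: to_sym_nbij => f _; case/eqP: nqr; exact: bij_dim f.
rewrite sa kmul0l.
have [epp|] := eqVneq p p0; last exact: Phi0r.
have [err|nr] := eqVneq q0 r; last exact: Phi0l.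
by case: (nofac a b npq nqr epp err).
Qed.

End Transport.
End Model.

(** * Extensions of Specht modules *)

Lemma tpE (k : fieldType) M N q0 p0 (u : {ffun bij M q0 -> k^o}) (v : {ffun bij N p0 -> k^o}) z :
  tp u v z = u z.1 * v z.2.
Proof. exact: ffunE. Qed.

Lemma sum_pair (U : nmodType) (I J : finType) (F : I * J -> U) :
  \sum_z F z = \sum_i \sum_j F (i, j).
Proof. by rewrite (pair_bigA _ (fun i j => F (i, j))); apply: eq_bigr => -[]. Qed.

(** Both sides of the identity are derivations in x. *)
Lemma inner_generated (k : fieldType) (G : signature)
    (rel : forall m n, tm k G m n -> tm k G m n -> Prop) (A B : cmod (presented rel))
    (D : derivation A B) (h : forall p, cobj A p -> cobj B p) :
  (forall p, linear (h p)) ->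
  (forall p q (f : bij p q) a, der D (hbij (presented rel) f) a
     = cact (hbij (presented rel) f) (h p a) - h q (cact (hbij (presented rel) f) a)) ->
  (forall p q (y : hom (presented rel) p q), is_gen y ->
     forall a, der D y a = cact y (h p a) - h q (cact y a)) ->
  forall p q (x : hom (presented rel) p q) a, der D x a = cact x (h p a) - h q (cact x a).
Proof.
move=> lh hb hg p q x.
have step p' q' r (z : hom (presented rel) p' q') (y : hom (presented rel) q' r) a :
    der D z a = cact z (h p' a) - h q' (cact z a) ->
    (forall b, der D y b = cact y (h q' b) - h r (cact y b)) ->
    der D (hcomp y z) a = cact (hcomp y z) (h p' a) - h r (cact (hcomp y z) a).
  move=> zh yh; rewrite der_comp zh yh (linear_funB (cact_linr y)) !cact_comp.
  by rewrite addrA subrK.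
elim: (gspan_all x) => {q x}.
- by move=> q f a; exact: hb.
- by move=> q r f x _ IH a; apply: step.
- by move=> q r y x gy _ IH a; apply: step => // b; exact: hg.
- move=> q a; rewrite (linear_fun0 (der_linl D a)) (linear_fun0 (cact_linl (h p a))).
  by rewrite (linear_fun0 (cact_linl a)) (linear_fun0 (lh q)) subr0.
- move=> q c x y _ IH _ IH' a; rewrite (der_linl D a) IH IH' (cact_linl (h p a)) (cact_linl a).
  by rewrite (lh q) scalerBr opprD addrACA.
Qed.

(** The Specht modules are finite-dimensional, so a basis can be lifted. *)
Lemma specht_section (k : fieldType) (la : seq nat) (B : cmod (CLieC k))
  (E : extension (T_functor (SpechtLie k la)) B) : section E.
Proof.
have ex p : exists s : cobj (T_functor (SpechtLie k la)) p -> cobj (ext_mod E) p,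
    linear s /\ forall a, cfun (ext_out E) (s a) = a.
  apply: (@linear_section k (subvs_of (specht_space k la p)) _ (@cfun _ _ _ _ (ext_out E) p)).
    exact: (@cfun_lin _ _ _ _ (ext_out E) p).
  exact: (@ext_surj _ _ _ _ E p).
exact: (@Section_ _ _ _ _ E (fun p => projT1 (cid (ex p))) (fun p => proj1 (projT2 (cid (ex p))))
         (fun p => proj2 (projT2 (cid (ex p))))).
Qed.

Section ExtModel.
Variables (k : fieldType) (char0 : [pchar k] =i pred0).
Local Notation ga m n := {ffun bij m n -> k^o}.
Local Notation "'\d' g" := (kdelta k g) (at level 10).
Variables (la mu : seq nat) (part_la : is_partition la) (part_mu : is_partition mu).
Local Notation N := (sumn la).
Local Notation M := (sumn mu).
Local Notation A := (T_functor (SpechtLie k la)).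
Local Notation B := (T_functor (SpechtLie k mu)).

Variable W : finprop.
Hypothesis W_mono : monotone_prop W.
Local Notation LW := (linearize k W).
Variable V : lprop_mor (CLieC k) LW.
Hypothesis V_sym : forall p q (x : hom (CLieC k) p q),
  pmap (lie_to_sym k) (pmap (liec_to_lie k) x) = to_sym (pmap V x).

Variables (p0 q0 : nat) (w0 : fp_hom W p0 q0) (y0 : hom (CLieC k) p0 q0).
Hypotheses (Np0 : N = p0) (Mq0 : M = q0) (p0q0 : p0 != q0).
Hypothesis W_factor : forall q, fp_hom W p0 q -> fp_hom W q q0 -> p0 = q \/ q = q0.
Hypothesis y0_gen : forall m n (y : hom (CLieC k) m n),
  is_gen y -> m = p0 -> n = q0 -> heq (H := fun m n => GRing.Lmodule.sort (hom (CLieC k) m n)) y0 y.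

Variables (H : finType) (hmul : H -> H -> H) (sg : H -> bij q0 q0) (ta : H -> bij p0 p0).
Variable ch : H -> k.
Hypotheses (hmul_inj : forall j, injective (hmul^~ j))
  (sgM : forall i j, sg (hmul i j) = sg i ** sg j)
  (taM : forall i j, ta (hmul i j) = ta i ** ta j)
  (chM : forall i j, ch (hmul i j) = ch i * ch j)
  (ch_sq : forall i, ch i * ch i = 1) (H0 : (0 < #|H|)%N).
Hypothesis y0_coef : forall (U : lmodType k) (F : bij q0 q0 -> bij p0 p0 -> U),
  \sum_s \sum_t wcoef w0 (pmap V y0) s t *: F s t = \sum_j ch j *: F (sg j) (bij_inv (ta j)).
Hypothesis y0_sym : forall j, hcomp y0 (hbij (CLieC k) (ta j)) = ch j *: hcomp (hbij (CLieC k) (sg j)) y0.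

Lemma actE nu p q (x : hom (CLieC k) p q) (a : cobj (T_functor (SpechtLie k nu)) p) :
  cact x a = cact (to_sym (pmap V x)) (a : cobj (Specht k nu) p).
Proof. by rewrite -V_sym. Qed.

Lemma spv_actE nu p q (x : hom (CLieC k) p q) (a : cobj (T_functor (SpechtLie k nu)) p) :
  spv (cact x a : cobj (Specht k nu) q)
  = (to_sym (pmap V x) : ga p q) \k* spv (a : cobj (Specht k nu) p).
Proof. by rewrite actE (spv_act (la := nu)). Qed.

Definition kernel_map (f : kernels k M N q0 p0) (v : ga N p0) : ga M q0 :=
  [ffun g => \sum_h f (g, h) * v h].

Lemma kernel_map_lin f : linear (kernel_map f).
Proof.
move=> a u v; apply/ffunP => g; rewrite !ffunE scaler_sumr -big_split.
by apply: eq_bigr => h _; rewrite !ffunE mulrDr; congr (_ + _); rewrite mulrCA.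
Qed.

Definition kernel_der (f : kernels k M N q0 p0) : derivation A B.
Proof.
refine (@Derivation k (CLieC k) A B (fun p q x a =>
  sp mu (Phi w0 (kernel_map f) (pmap V x) (spv (a : cobj (Specht k la) p)))) _ _ _).
- move=> p q a.
  exact: linear_cmp (@sp_lin k mu q) (linear_cmp (Phi_linl w0 _ _) (@pmap_lin _ _ _ V p q)).
- move=> p q x.
  exact: linear_cmp (@sp_lin k mu q) (linear_cmp (Phi_linr w0 (kernel_map_lin f) _) (@spv_lin k la p)).
- move=> p q r g x a; rewrite actE (spv_actE (nu := la)) pmap_comp.
  rewrite (Phi_comp W_mono w0 p0q0 W_factor (kernel_map_lin f)).
  rewrite (linear_funD (@sp_lin k mu r)); congr (_ + _).
  by rewrite (sp_act (la := mu) (to_sym (pmap V g) : ga q r)).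
Defined.

(** The matrix of D(y0) between the generating elements of the two Specht
    modules. *)
Definition der_kernel (D : derivation A B) : kernels k M N q0 p0 :=
  [ffun z => spv (der D y0 (sp la (\d z.2)) : cobj (Specht k mu) q0) z.1].

Local Notation ks := (ksym sg ta ch (ysym k mu) (kstar (ysym k la))).

Lemma kernel_mapE f w : kernel_map f w = \sum_z (f z * w z.2) *: \d z.1.
Proof.
apply/ffunP => g; rewrite ffunE sum_ffunE.
rewrite sum_pair (bigD1 g) //= [X in _ = _ + X]big1 ?addr0 => [|g' g'g].
  by apply: eq_bigr => h _; rewrite !ffunE eqxx; exact/esym/mulr1.
by rewrite big1 // => h _; rewrite !ffunE eq_sym (negbTE g'g); exact: mulr0.
Qed.

(** The translates of w0 occur in the image of y0 through the symmetries of y0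
    only, so that evaluating the derivation of f at y0 averages f. *)
Lemma der_kernelK f : der_kernel (kernel_der f) = ks f.
Proof.
apply/ffunP => -[g h]; rewrite ffunE [der _ _ _]/= !spE /=.
have -> : Phi w0 (kernel_map f) (pmap V y0) (\d h \k* ysym k la)
    = \sum_j \sum_z (ch j * (f z * (\d (ta j) \k* \d z.2 \k* kstar (ysym k la)) h))
        *: (\d (sg j) \k* \d z.1).
  rewrite /Phi (y0_coef (fun s t => \d s \k* kernel_map f (\d t \k* (\d h \k* ysym k la)))).
  apply: eq_bigr => j _; rewrite kernel_mapE kmul_sumDr scaler_sumr; apply: eq_bigr => z _.
  rewrite kmulZr scalerA; congr (_ * (_ * _) *: _).
  rewrite [LHS]kmul_deltal [LHS]kmul_deltal bij_invK kdeltaM [RHS]kmul_deltal.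
  by rewrite [RHS]ffunE bij_inv_comp bij_invK.
rewrite kmul_sumDl sum_ffunE /ksym sum_ffunE.
under eq_bigr => j _ do rewrite kmul_sumDl sum_ffunE.
rewrite exchange_big /=; apply: eq_bigr => z _.
rewrite ffunE /ksym_tp sum_ffunE scaler_sumr; apply: eq_bigr => j _.
rewrite kmulZl ffunE tpZE /=.
pose X : k := (\d (sg j) \k* \d z.1 \k* ysym k mu) g.
pose Y : k := (\d (ta j) \k* \d z.2 \k* kstar (ysym k la)) h.
change ((ch j * ((f z : k) * Y)) * X = (f z : k) * (ch j * (X * Y))); ring.
Qed.

Lemma B0 (b : cobj B p0) : b = 0.
Proof. by apply: (sp0 (la := mu)); rewrite Mq0 eq_sym. Qed.

Lemma A0 (a : cobj A q0) : a = 0.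
Proof. by apply: (sp0 (la := la)); rewrite Np0. Qed.

Lemma Ap p (a : cobj A p) : p != p0 -> a = 0.
Proof. by move=> pp; apply: (sp0 (la := la)); rewrite Np0 eq_sym. Qed.

Lemma Bq q (b : cobj B q) : q != q0 -> b = 0.
Proof. by move=> qq; apply: (sp0 (la := mu)); rewrite Mq0 eq_sym. Qed.

Lemma der_bij (D : derivation A B) p q (f : bij p q) a : der D (hbij (CLieC k) f) a = 0.
Proof.
have epq := bij_dim f; have [epp|pp] := eqVneq p p0; last first.
  by rewrite (Ap a pp) (linear_fun0 (@der_linr _ _ _ _ D p q _)).
by apply: Bq; rewrite -epq epp.
Qed.

Lemma der_eq0 (D : derivation A B) : (forall a, der D y0 a = 0) ->
  forall p q (x : hom (CLieC k) p q) a, der D x a = 0.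
Proof.
move=> D0 p q x a; rewrite (@inner_generated _ _ _ _ _ D (fun _ _ => 0)).
- by rewrite (linear_fun0 (cact_linr x)) subrr.
- by move=> r c u v; rewrite scaler0 addr0.
- by move=> p' q' f b; rewrite der_bij (linear_fun0 (cact_linr _)) subrr.
move=> {x a} p' q' y gy a; rewrite (linear_fun0 (cact_linr _)) subrr.
have [ep|np] := eqVneq p' p0; last by rewrite (Ap a np) (linear_fun0 (@der_linr _ _ _ _ D p' q' _)).
have [eq|nq] := eqVneq q' q0; last exact: Bq.
by move: a; case: (y0_gen gy ep eq).
Qed.

Lemma inner_eq0 (D : derivation A B) : inner D ->
  forall p q (x : hom (CLieC k) p q) a, der D x a = 0.
Proof.
move=> [h [lh hE]]; apply: der_eq0 => a; rewrite hE (B0 (h p0 a)) (A0 (cact _ _)).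
by rewrite (linear_fun0 (cact_linr _)) (linear_fun0 (lh q0)) subrr.
Qed.

(** D vanishes on permutations, so it is equivariant; the symmetry of y0
    becomes one of D(y0). *)
Lemma der_y0_sym (D : derivation A B) j (h : bij N p0) :
  spv (der D y0 (sp la (\d (ta j ** h))) : cobj (Specht k mu) q0)
  = ch j *: (\d (sg j) \k* spv (der D y0 (sp la (\d h)) : cobj (Specht k mu) q0)).
Proof.
have cb nu p (f : bij p p) (a : cobj (T_functor (SpechtLie k nu)) p) :
    cact (hbij (CLieC k) f) a = cact (hbij (kSym k) f) (a : cobj (Specht k nu) p).
  by rewrite actE pmap_bij (to_sym_bij k W_mono).
have e := der_comp D y0 (hbij (CLieC k) (ta j)) (sp la (\d h) : cobj A p0).
have e' := der_comp D (hbij (CLieC k) (sg j)) y0 (sp la (\d h) : cobj A p0).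
rewrite (der_bij D) (linear_fun0 (cact_linr _)) add0r in e.
rewrite (A0 (cact y0 _)) (linear_fun0 (@der_linr _ _ _ _ D _ _ _)) addr0 in e'.
rewrite cb (sp_act (la := la) (\d (ta j))) kdeltaM in e.
rewrite -e y0_sym (linear_funZ (der_linl D _)) e' cb.
by rewrite (linear_funZ (@spv_lin k mu q0)) (spv_act (la := mu) (\d (sg j))).
Qed.

(** The matrix of D(y0) has the symmetry of y0, and its rows and columns lie
    in the ideals of the Young symmetrizers; so it is an eigenvector of ksym,
    hence in its range. *)
Lemma der_kernel_im (D : derivation A B) :
  ks (der_kernel D) = (#|H|%:R * (ynorm k mu * ynorm k la)) *: der_kernel D.
Proof.
pose U (v : ga N p0) : ga M q0 := spv (der D y0 (sp la v) : cobj (Specht k mu) q0).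
have lU : linear U.
  exact: linear_cmp (@spv_lin k mu q0) (linear_cmp (@der_linr _ _ _ _ D _ _ y0) (@sp_lin k la p0)).
have fE : der_kernel D = \sum_h tp (U (\d h)) (\d h).
  apply/ffunP => -[g h]; rewrite ffunE sum_ffunE (bigD1 h) //= big1 ?addr0 => [|h' h'h].
    by rewrite ffunE /= kdeltaE eqxx mulr1.
  by rewrite ffunE /= kdeltaE eq_sym (negbTE h'h) mulr0.
rewrite {1}fE (linear_fun_sum _ _ _ (ksym_lin _ _ _ _ _)).
under eq_bigr => h _ do rewrite ksym_tpE /ksym_tp.
rewrite exchange_big /=.
have step j : \sum_h ch j *: tp (\d (sg j) \k* U (\d h) \k* ysym k mu)
      (\d (ta j) \k* \d h \k* kstar (ysym k la))
    = (ynorm k mu * ynorm k la) *: der_kernel D.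
  transitivity (\sum_h tp (ynorm k mu *: U (\d h)) (\d h \k* kstar (ysym k la))).
    rewrite [RHS](sum_bijl (ta j)); apply: eq_bigr => h _.
    rewrite -kmulA [U _ \k* _]spv_ysym // kdeltaM -(linear_funZ (tp_linl _)).
    have -> : U (\d (ta j ** h)) = ch j *: (\d (sg j) \k* U (\d h)) := der_y0_sym D j h.
    by rewrite kmulZr; congr (tp _ _); rewrite !scalerA mulrC.
  have Uc h : U (\d h \k* ysym k la) = ynorm k la *: U (\d h).
    by rewrite -(linear_funZ lU) /U -[\d h \k* _]spE spK // (linear_funZ (@sp_lin k la p0)).
  rewrite -scalerA fE !scaler_sumr.
  apply/ffunP => -[g h0]; rewrite !sum_ffunE.
  rewrite [RHS](bigD1 h0) //= [X in _ = _ + X]big1 ?addr0 => [|h hh0]; last first.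
    by rewrite -!(linear_funZ (tp_linl _)) !ffunE /= eq_sym (negbTE hh0) mulr0.
  rewrite -!(linear_funZ (tp_linl _)) -Uc ffunE /= kdeltaE eqxx mulr1.
  rewrite [\d h0 \k* _]kdelta_decomp (linear_fun_sum _ _ _ lU) scaler_sumr sum_ffunE.
  apply: eq_bigr => h _; rewrite tpE /= (linear_funZ lU) !kmul_deltal.
  rewrite [kstar _ _]ffunE bij_inv_comp bij_invK scalerA [RHS]ffunE [X in X * _ = _]ffunE.
  pose X : k := U (\d h) g; pose Y : k := ysym k la (bij_inv h0 ** h).
  change ((ynorm k mu * X) * Y = (ynorm k mu * Y) * X); ring.
rewrite (eq_bigr _ (fun j _ => step j)) sumr_const -scaler_nat scalerA.
by [].
Qed.

(** A derivation is determined by D(y0), whose matrix lies in the range of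
    ksym, and the derivations of arbitrary kernels fill this range.  No
    derivation but 0 is inner, as each module vanishes at the object of the
    other. *)
Theorem Ext1_kernels : Ext1_iso A B (subvs_of (limage ks)).
Proof.
have nz : #|H|%:R * (ynorm k mu * ynorm k la) != 0.
  by rewrite !mulf_neq0 ?ynorm_neq0 // natr_neq0.
have imD D : der_kernel D \in limage ks.
  apply/(limageP _ (ksym_lin _ _ _ _ _)).
  exists ((#|H|%:R * (ynorm k mu * ynorm k la))^-1 *: der_kernel D).
  by rewrite (linear_funZ (ksym_lin _ _ _ _ _)) der_kernel_im scalerA mulVf // scale1r.
have spv0 g : spv (0 : cobj (Specht k mu) q0) g = 0.
  by rewrite (linear_fun0 (@spv_lin k mu q0)) ffunE.
apply: (Ext1_classification (@specht_section k la) (L := fun D => vsproj (limage ks) (der_kernel D))).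
- move=> c D D'; rewrite -linearP; congr (vsproj _ _); apply/ffunP => z.
  rewrite [LHS]ffunE.
  apply: etrans (congr1 (fun f : ga M q0 => f z.1) (@spv_lin k mu q0 c _ _)) _.
  by rewrite !ffunE.
- move=> D; split=> [/(congr1 vsval)|/inner_eq0 D0].
    rewrite vsprojK // linear0 => D0.
    have {}D0 : forall p q (x : hom (CLieC k) p q) a, der D x a = 0.
      apply: der_eq0 => a; have [x ->] := sp_surj char0 part_la (a : cobj (Specht k la) p0).
      rewrite [x]kdelta_decomp (linear_fun_sum _ _ _ (@sp_lin k la p0)).
      rewrite (linear_fun_sum _ _ _ (@der_linr _ _ _ _ D _ _ y0)) big1 // => h _.
      rewrite (linear_funZ (@sp_lin k la p0)) (linear_funZ (@der_linr _ _ _ _ D _ _ y0)).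
      rewrite (_ : der D y0 _ = 0) ?scaler0 //; apply: (@spv_inj k mu q0).
      apply/ffunP => g; move/ffunP/(_ (g, h)): D0; rewrite ffunE /= => ->.
      by rewrite [LHS]ffunE; exact/esym/spv0.
    exists (fun _ _ => 0); split=> [p c a b|p q x a]; first by rewrite scaler0 addr0.
    by rewrite D0 (linear_fun0 (cact_linr _)) subrr.
  rewrite (_ : der_kernel D = 0) ?linear0 //.
  by apply/ffunP => z; rewrite ffunE D0 [RHS]ffunE; exact: spv0.
- move=> v; have /(limageP _ (ksym_lin _ _ _ _ _))[f ef] := subvsP v.
  by exists (kernel_der f); rewrite der_kernelK -ef vsvalK.
Qed.

End ExtModel.

(** * Tensor products of Specht modules over a PROP *)

Section BitensModel.
Variables (k : fieldType) (char0 : [pchar k] =i pred0).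
Local Notation ga m n := {ffun bij m n -> k^o}.
Local Notation "'\d' g" := (kdelta k g) (at level 10).
Variables (la mu : seq nat) (part_la : is_partition la) (part_mu : is_partition mu).
Local Notation N := (sumn la).
Local Notation M := (sumn mu).

Variable W : finprop.
Local Notation LW := (linearize k W).
Variables (P : lprop k) (F : lprop_mor P LW).

Variables (p0 q0 : nat) (w0 : fp_hom W p0 q0) (x0 : hom P p0 q0).
Variables (H : finType) (hinv : H -> H) (sg : H -> bij q0 q0) (ta : H -> bij p0 p0).
Variable ch : H -> k.
Hypotheses (hinvK : involutive hinv)
  (sgV : forall i, sg (hinv i) = bij_inv (sg i)) (taV : forall i, ta (hinv i) = bij_inv (ta i))
  (chV : forall i, ch (hinv i) = ch i)
  (ch_sq : forall i, ch i * ch i = 1) (H0 : (0 < #|H|)%N).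
Hypothesis x0_coef : forall (U : lmodType k) (G : bij q0 q0 -> bij p0 p0 -> U),
  \sum_s \sum_t wcoef w0 (pmap F x0) s t *: G s t = \sum_j ch j *: G (sg j) (bij_inv (ta j)).
Hypothesis x0_sym : forall j, hcomp x0 (hbij P (ta j)) = ch j *: hcomp (hbij P (sg j)) x0.
Hypothesis x0_span : forall (U : lmodType k) (f g : hom P p0 q0 -> U),
  linear f -> linear g ->
  (forall s t, f (hcomp (hbij P s) (hcomp x0 (hbij P t))) = g (hcomp (hbij P s) (hcomp x0 (hbij P t)))) ->
  f =1 g.

Local Notation SM := (Specht k mu).
Local Notation SN := (Specht k la).
Local Notation rel := (@bibalanced k P SM SN q0 p0).
Local Notation ks := (ksym sg ta ch (ysym k mu) (ysym k la)).

(** The tensor v (x) s w0 t (x) w is moved to s^-1 v (x) w0 (x) t w. *)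
Definition bt_fun (v : cobj SM q0) (x : hom P p0 q0) (w : cobj SN p0) : kernels k M N q0 p0 :=
  \sum_(s : bij q0 q0) \sum_(t : bij p0 p0)
    wcoef w0 (pmap F x) s t *: tp (\d (bij_inv s) \k* spv v) (\d t \k* spv w).

Lemma bt_lin1 x w : linear (fun v => bt_fun v x w).
Proof.
apply: linear_sum_fun => s; apply: linear_sum_fun => t; apply: linear_scale_fun.
exact: linear_cmp (tp_linl _) (linear_cmp (kmul_linr _) (@spv_lin k mu q0)).
Qed.

Lemma bt_lin2 v w : linear (fun x => bt_fun v x w).
Proof.
apply: linear_sum_fun => s; apply: linear_sum_fun => t a x y.
rewrite (@pmap_lin _ _ _ F p0 q0); have := wcoef_lin w0 s t a (pmap F x) (pmap F y).
by rewrite /= => ->; rewrite scalerDl scalerA.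
Qed.

Lemma bt_lin3 v x : linear (bt_fun v x).
Proof.
apply: linear_sum_fun => s; apply: linear_sum_fun => t; apply: linear_scale_fun.
exact: linear_cmp (tp_linr _) (linear_cmp (kmul_linr _) (@spv_lin k la p0)).
Qed.

Lemma perm_bijV n (s : 'S_n) : perm_bij s^-1%g = bij_inv (perm_bij s).
Proof.
apply: bij_inv_uniql; apply: bijP => i.
by rewrite bij_compE !perm_bijE bij1E permK.
Qed.

Lemma bt_rel v x w v' x' w' : rel v x w v' x' w' -> bt_fun v x w = bt_fun v' x' w'.
Proof.
case=> {v x w v' x' w'} [s v x w|s v x w].
  rewrite /bt_fun hperm_delta (spv_act (la := mu) (\d (perm_bij s^-1%g))) perm_bijV.
  rewrite pmap_comp pmap_bij [RHS](sum_bijl (perm_bij s)); apply: eq_bigr => r _.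
  apply: eq_bigr => t _; rewrite wcoef_compl; congr (_ *: tp _ _).
  by rewrite bij_inv_comp -kdeltaM kmulA.
rewrite /bt_fun hperm_delta (spv_act (la := la) (\d (perm_bij s))).
rewrite pmap_comp pmap_bij; apply: eq_bigr => r _.
rewrite [LHS](sum_bijr (perm_bij s)).
by apply: eq_bigr => t _; rewrite wcoef_compr -kdeltaM !kmulA.
Qed.

Definition bt_kernel : bitens P SM SN q0 p0 -> kernels k M N q0 p0 := lift3 bt_fun.

Lemma bt_kernel_lin : linear bt_kernel.
Proof.
by apply: lift3_lin; [exact: bt_lin1 | exact: bt_lin2 | exact: bt_lin3 | exact: bt_rel].
Qed.

Lemma bt_kernel_pure v x w : bt_kernel (pure3 rel v x w) = bt_fun v x w.
Proof.
by apply: lift3_pure; [exact: bt_lin1 | exact: bt_lin2 | exact: bt_lin3 | exact: bt_rel].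
Qed.

Lemma bt_fun_x0 v w : bt_fun v x0 w
  = \sum_j ch j *: tp (\d (bij_inv (sg j)) \k* spv v) (\d (bij_inv (ta j)) \k* spv w).
Proof. exact: (x0_coef (fun s t => tp (\d (bij_inv s) \k* spv v) (\d t \k* spv w))). Qed.

Definition kernel_bt (f : kernels k M N q0 p0) : bitens P SM SN q0 p0 :=
  \sum_z f z *: pure3 rel (sp mu (\d z.1)) x0 (sp la (\d z.2)).

Lemma kernel_bt_lin : linear kernel_bt.
Proof.
move=> a f g; rewrite /kernel_bt scaler_sumr -big_split; apply: eq_bigr => z _.
by rewrite !ffunE scalerDl scalerA.
Qed.

Lemma kernel_bt_tp u v : kernel_bt (tp u v) = pure3 rel (sp mu u) x0 (sp la v).
Proof.
rewrite /kernel_bt sum_pair {2}[u]kdelta_decomp.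
rewrite (linear_fun_sum _ _ _ (@sp_lin k mu q0)) (linear_fun_sum _ _ _ (pure3_lin1 _ _ _)).
apply: eq_bigr => g _; rewrite (linear_funZ (@sp_lin k mu q0)) (linear_funZ (pure3_lin1 _ _ _)).
rewrite {2}[v]kdelta_decomp.
rewrite (linear_fun_sum _ _ _ (@sp_lin k la p0)) (linear_fun_sum _ _ _ (pure3_lin3 _ _ _)).
rewrite scaler_sumr; apply: eq_bigr => h _.
rewrite (linear_funZ (@sp_lin k la p0)) (linear_funZ (pure3_lin3 _ _ _)) scalerA.
by rewrite tpE.
Qed.

Lemma bt_bal_l v (s : bij q0 q0) x w :
  pure3 rel (cact (hbij (kSym k) (bij_inv s)) v) x w = pure3 rel v (hcomp (hbij P s) x) w.
Proof.
have := pure3_rel (bibal_l (P := P) (M := SM) (N := SN) (bij_perm s) v x w).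
by rewrite /hperm perm_bijV bij_permK.
Qed.

Lemma bt_bal_r v (s : bij p0 p0) x w :
  pure3 rel v (hcomp x (hbij P s)) w = pure3 rel v x (cact (hbij (kSym k) s) w).
Proof.
have := pure3_rel (bibal_r (P := P) (M := SM) (N := SN) (bij_perm s) v x w).
by rewrite /hperm bij_permK.
Qed.

Local Notation K := (#|H|%:R * (ynorm k mu * ynorm k la)).

Lemma kernel_bt_x0 v w : kernel_bt (bt_fun v x0 w) = K *: pure3 rel v x0 w.
Proof.
rewrite bt_fun_x0 (linear_fun_sum _ _ _ kernel_bt_lin).
rewrite (eq_bigr (fun=> (ynorm k mu * ynorm k la) *: pure3 rel v x0 w)) => [|j _].
  by rewrite sumr_const -scaler_nat scalerA.
rewrite (linear_funZ kernel_bt_lin) kernel_bt_tp.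
rewrite -(sp_act (la := mu) (\d (bij_inv (sg j)))) -(sp_act (la := la) (\d (bij_inv (ta j)))).
rewrite !spK // [cact _ (_ *: v)](linear_funZ (cact_linr _)) [cact _ (_ *: w)](linear_funZ (cact_linr _)).
rewrite (linear_funZ (pure3_lin1 _ _ _)) (linear_funZ (pure3_lin3 _ _ _)).
have e := bt_bal_l v (sg j) x0 (cact (hbij (kSym k) (bij_inv (ta j))) w).
have ex : hcomp (hbij P (sg j)) x0 = ch j *: hcomp x0 (hbij P (ta j)).
  by rewrite x0_sym scalerA ch_sq scale1r.
rewrite ex (linear_funZ (pure3_lin2 _ _ _)) bt_bal_r -cact_comp -hbij_comp bij_compVr cact_id in e.
rewrite [pure3 _ _ _ _]e !scalerA; congr (_ *: _).
by rewrite mulrCA -[X in _ = X]mulr1 -(ch_sq j); ring.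
Qed.

Lemma bt_fun_act v s t x w :
  bt_fun v (hcomp (hbij P s) (hcomp x (hbij P t))) w
  = bt_fun (cact (hbij (kSym k) (bij_inv s)) v) x (cact (hbij (kSym k) t) w).
Proof. by rewrite -!bt_kernel_pure -bt_bal_l bt_bal_r. Qed.

(** By x0_span it is enough to compare the two sides on translates of x0,
    where they are computed by the symmetry of x0. *)
Lemma kernel_btK q : kernel_bt (bt_kernel q) = K *: q.
Proof.
move: q; apply: tens3_ext.
- exact: linear_cmp kernel_bt_lin bt_kernel_lin.
- exact: linear_scale_fun.
move=> v x w; rewrite bt_kernel_pure; move: x.
apply: x0_span.
- exact: linear_cmp kernel_bt_lin (bt_lin2 v w).
- exact: linear_scale_fun (pure3_lin2 _ _ _).
move=> s t; rewrite bt_fun_act kernel_bt_x0.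
by rewrite -bt_bal_l bt_bal_r.
Qed.

Lemma bt_kernelK f : bt_kernel (kernel_bt f) = ks f.
Proof.
rewrite /kernel_bt (linear_fun_sum _ _ _ bt_kernel_lin); apply: eq_bigr => z _.
rewrite (linear_funZ bt_kernel_lin) bt_kernel_pure bt_fun_x0; congr (_ *: _).
rewrite /ksym_tp (reindex_inj (inv_inj hinvK)); apply: eq_bigr => j _.
by rewrite chV sgV taV !bij_invK !spE !kmulA.
Qed.

(** The maps bt_kernel and kernel_bt compose to a nonzero scalar on the tensor
    product, and to ksym on kernels. *)
Theorem bitens_kernels : lin_iso (bitens P SM SN q0 p0) (subvs_of (limage ks)).
Proof.
have nz : K != 0 by rewrite !mulf_neq0 ?ynorm_neq0 // natr_neq0.
apply: (@limage_iso _ _ _ _ ks bt_kernel).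
- exact: ksym_lin.
- exact: bt_kernel_lin.
- apply: linear_inj => [|q q0']; first exact: bt_kernel_lin.
  by apply: (scalerI nz); rewrite scaler0 -kernel_btK q0' (linear_fun0 kernel_bt_lin).
- by move=> f; exists (kernel_bt f); rewrite bt_kernelK.
- move=> q; exists (K^-1 *: bt_kernel q).
  rewrite (linear_funZ (ksym_lin _ _ _ _ _)) -bt_kernelK kernel_btK.
  by rewrite (linear_funZ bt_kernel_lin) scalerA mulVf // scale1r.
Qed.

End BitensModel.

(** * Surjections with a digraph on each fibre *)

(** Arcs join distinct points of the same fibre.  The PROP of associative
    algebras consists of surjections with a linear order on each fibre;
    keeping only the relation, without the axioms of an order, contains it and
    makes all the axioms of a PROP immediate. *)
Definition is_fdig m n (w : {ffun 'I_m -> 'I_n} * {ffun 'I_m * 'I_m -> bool}) : bool :=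
  [forall j, exists i, w.1 i == j]
  && [forall x, forall y, w.2 (x, y) ==> (x != y) && (w.1 x == w.1 y)].

Definition fdig m n :=
  {w : {ffun 'I_m -> 'I_n} * {ffun 'I_m * 'I_m -> bool} | is_fdig w}.
HB.instance Definition _ m n := Finite.on (fdig m n).

Definition fd_fun m n (w : fdig m n) : 'I_m -> 'I_n := (val w).1.
Coercion fd_fun : fdig >-> Funclass.
Definition fd_arc m n (w : fdig m n) (x y : 'I_m) : bool := (val w).2 (x, y).

Lemma fd_surj m n (w : fdig m n) j : exists i, w i = j.
Proof.
by have /andP[/forallP/(_ j)/existsP[i /eqP ij] _] := valP w; exists i.
Qed.

Lemma fd_arcP m n (w : fdig m n) x y : fd_arc w x y -> (x != y) && (w x == w y).
Proof. by have /andP[_ /forallP/(_ x)/forallP/(_ y)/implyP] := valP w. Qed.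

Lemma fd_arc_fun m n (w : fdig m n) x y :
  (if w x == w y then fd_arc w x y else false) = fd_arc w x y.
Proof. by case: ifP => // e; apply/esym/negP => /fd_arcP; rewrite e andbF. Qed.

Lemma fd_arc_neq m n (w : fdig m n) x y :
  (if x == y then false else fd_arc w x y) = fd_arc w x y.
Proof. by case: ifP => // e; apply/esym/negP => /fd_arcP; rewrite e. Qed.

Lemma mk_fd_subproof m n (f : 'I_m -> 'I_n) (r : 'I_m -> 'I_m -> bool) :
  (forall j, exists i, f i = j) ->
  (forall x y, r x y -> (x != y) && (f x == f y)) ->
  is_fdig (finfun f, [ffun xy => r xy.1 xy.2]).
Proof.
move=> fs rP; apply/andP; split.
  by apply/forallP => j; have [i ij] := fs j; apply/existsP; exists i; rewrite ffunE ij.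
by do 2!apply/forallP => ?; apply/implyP; rewrite !ffunE; exact: rP.
Qed.

Definition mk_fd m n f r fs rP : fdig m n :=
  exist (fun w => is_true (is_fdig w)) _ (@mk_fd_subproof m n f r fs rP).

Lemma mk_fdE m n f r fs rP : @mk_fd m n f r fs rP =1 f.
Proof. by move=> x; rewrite /fd_fun /= ffunE. Qed.

Lemma mk_fd_arc m n f r fs rP : fd_arc (@mk_fd m n f r fs rP) =2 r.
Proof. by move=> x y; rewrite /fd_arc /= ffunE. Qed.

Lemma fdP m n (v w : fdig m n) : v =1 w -> fd_arc v =2 fd_arc w -> v = w.
Proof.
case: v w => [[f r] v] [[g s] w] /= fg rs; apply/val_inj; congr pair => /=.
  exact/ffunP.
by apply/ffunP => -[x y]; exact: rs.
Qed.

Lemma fd_heq m n m' n' (v : fdig m n) (w : fdig m' n') :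
  m = m' -> n = n' ->
  (forall (i : 'I_m) (i' : 'I_m'), i = i' :> nat -> v i = w i' :> nat /\
    forall (j : 'I_m) (j' : 'I_m'), j = j' :> nat -> fd_arc v i j = fd_arc w i' j') ->
  heq v w.
Proof.
move=> em en; move: v w; rewrite -em -en => v w vw.
rewrite (_ : v = w) //; apply: fdP => [i|i j]; have [fi ri] := vw i i erefl.
  exact/val_inj.
exact: ri.
Qed.

(** Points of one fibre of v are compared by v, and points of different fibres
    by their images, as in the lexicographic order. *)
Definition fd_comp m n p (w : fdig n p) (v : fdig m n) : fdig m p.
Proof.
refine (@mk_fd m p (w \o v)
  (fun x y => if v x == v y then fd_arc v x y else fd_arc w (v x) (v y)) _ _).
- by move=> l; have [j <-] := fd_surj w l; have [i <-] := fd_surj v j; exists i.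
- move=> x y /=; case: eqP => [vxy|vxy] /fd_arcP/andP[xy e]; first by rewrite vxy xy /=.
  by rewrite e andbT; apply: contraNneq xy => ->.
Defined.

Definition fd_tens_arc m m' (r : rel 'I_m) (r' : rel 'I_m') (x y : 'I_(m + m')) : bool :=
  match split x, split y with
  | inl i, inl j => r i j
  | inr i, inr j => r' i j
  | _, _ => false
  end.

Definition fd_tens m n m' n' (v : fdig m n) (w : fdig m' n') : fdig (m + m') (n + n').
Proof.
refine (@mk_fd _ _ (sum_fun v w) (fd_tens_arc (fd_arc v) (fd_arc w)) _ _).
- apply: ord_splitP => j.
    by have [i <-] := fd_surj v j; exists (lshift m' i); rewrite sum_funl.
  by have [i <-] := fd_surj w j; exists (rshift m i); rewrite sum_funr.
- rewrite /fd_tens_arc => x y; rewrite -(splitK x) -(splitK y) !unsplitK.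
  case: (split x) (split y) => i [] j //= /fd_arcP/andP[ij e];
    by rewrite ?sum_funl ?sum_funr ?eq_lshift ?eq_rshift ij.
Defined.

Definition fd_bij m n (f : bij m n) : fdig m n.
Proof.
refine (@mk_fd m n f (fun _ _ => false) _ _) => // j.
by exists (bij_invf f j); rewrite bij_invfK.
Defined.

Lemma fd_compE m n p (w : fdig n p) (v : fdig m n) x : fd_comp w v x = w (v x).
Proof. exact: mk_fdE. Qed.
Lemma fd_comp_arc m n p (w : fdig n p) (v : fdig m n) x y : fd_arc (fd_comp w v) x y =
  if v x == v y then fd_arc v x y else fd_arc w (v x) (v y).
Proof. exact: mk_fd_arc. Qed.

Lemma fd_bijE m n (f : bij m n) : fd_bij f =1 f.
Proof. exact: mk_fdE. Qed.
Lemma fd_bij_arc m n (f : bij m n) x y : fd_arc (fd_bij f) x y = false.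
Proof. exact: mk_fd_arc. Qed.

Section FdTens.
Variables (m n m' n' : nat) (v : fdig m n) (w : fdig m' n').

Lemma fd_tensl x : fd_tens v w (lshift m' x) = lshift n' (v x).
Proof. by rewrite mk_fdE sum_funl. Qed.
Lemma fd_tensr x : fd_tens v w (rshift m x) = rshift n (w x).
Proof. by rewrite mk_fdE sum_funr. Qed.
Lemma fd_tens_ll x y : fd_arc (fd_tens v w) (lshift m' x) (lshift m' y) = fd_arc v x y.
Proof. by rewrite mk_fd_arc /fd_tens_arc !(unsplitK (inl _)). Qed.
Lemma fd_tens_rr x y : fd_arc (fd_tens v w) (rshift m x) (rshift m y) = fd_arc w x y.
Proof. by rewrite mk_fd_arc /fd_tens_arc !(unsplitK (inr _)). Qed.
Lemma fd_tens_lr x y : fd_arc (fd_tens v w) (lshift m' x) (rshift m y) = false.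
Proof. by rewrite mk_fd_arc /fd_tens_arc (unsplitK (inl _)) (unsplitK (inr _)). Qed.
Lemma fd_tens_rl x y : fd_arc (fd_tens v w) (rshift m x) (lshift m' y) = false.
Proof. by rewrite mk_fd_arc /fd_tens_arc (unsplitK (inl _)) (unsplitK (inr _)). Qed.
End FdTens.

Definition fdE := (fd_compE, fd_comp_arc, fd_bijE, fd_bij_arc, fd_tensl, fd_tensr,
  fd_tens_ll, fd_tens_rr, fd_tens_lr, fd_tens_rl, eq_lshift, eq_rshift, eq_lrshift,
  eq_rlshift).

Lemma fd_compA m n p q (w : fdig p q) (v : fdig n p) (u : fdig m n) :
  fd_comp w (fd_comp v u) = fd_comp (fd_comp w v) u.
Proof.
apply: fdP => [x|x y]; rewrite !fdE //.
by case: (u x =P u y) => [->|]; rewrite ?eqxx.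
Qed.

Lemma fd_comp1l m n (w : fdig m n) : fd_comp (fd_bij (bij1 n)) w = w.
Proof.
apply: fdP => [x|x y]; rewrite !fdE ?bij1E //.
exact: fd_arc_fun.
Qed.

Lemma fd_comp1r m n (w : fdig m n) : fd_comp w (fd_bij (bij1 m)) = w.
Proof.
apply: fdP => [x|x y]; rewrite !fdE !bij1E //.
exact: fd_arc_neq.
Qed.

Lemma fd_bij_comp m n p (g : bij n p) (f : bij m n) :
  fd_bij (bij_comp g f) = fd_comp (fd_bij g) (fd_bij f).
Proof. by apply: fdP => [x|x y]; rewrite !fdE ?bij_compE ?if_same. Qed.

Lemma fd_bij_sum m n m' n' (f : bij m n) (g : bij m' n') :
  fd_bij (bij_sum f g) = fd_tens (fd_bij f) (fd_bij g).
Proof.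
apply: fdP => [|x y]; first by apply: ord_splitP => i; rewrite !fdE ?bij_suml ?bij_sumr.
by move: x y; do 2!apply: ord_splitP => ?; rewrite !fdE.
Qed.

Lemma fd_interchange m n p m' n' p' (g : fdig n p) (f : fdig m n)
    (g' : fdig n' p') (f' : fdig m' n') :
  fd_tens (fd_comp g f) (fd_comp g' f') = fd_comp (fd_tens g g') (fd_tens f f').
Proof.
apply: fdP => [|x y]; first by apply: ord_splitP => i; rewrite !fdE.
by move: x y; do 2!apply: ord_splitP => ?; rewrite !fdE.
Qed.

Lemma fd_swap m n m' n' (f : fdig m n) (g : fdig m' n') :
  fd_comp (fd_bij (swap n n')) (fd_tens f g) = fd_comp (fd_tens g f) (fd_bij (swap m m')).
Proof.
apply: fdP => [|x y]; first by apply: ord_splitP => i; rewrite !(fdE, swapl, swapr).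
by move: x y; do 2!apply: ord_splitP => ?;
  rewrite !(fdE, swapl, swapr) ?if_same ?fd_arc_fun ?fd_arc_neq.
Qed.

Lemma fd_tensA m n m' n' m'' n'' (f : fdig m n) (g : fdig m' n') (h : fdig m'' n'') :
  heq (fd_tens (fd_tens f g) h) (fd_tens f (fd_tens g h)).
Proof.
apply: fd_heq; [exact/esym/addnA | exact/esym/addnA |].
pose c (i : 'I_(m + m' + m'')) : 'I_(m + (m' + m'')) := cast_ord (esym (addnA m m' m'')) i.
have cE (i : 'I_(m + m' + m'')) (i' : 'I_(m + (m' + m''))) : i = i' :> nat -> i' = c i.
  by move=> ii; apply/val_inj.
have c1 i : c (lshift m'' (lshift m' i)) = lshift (m' + m'') i by apply/val_inj.
have c2 i : c (lshift m'' (rshift m i)) = rshift m (lshift m'' i) by apply/val_inj.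
have c3 i : c (rshift (m + m') i) = rshift m (rshift m' i).
  by apply/val_inj; rewrite /= addnA.
move=> i i' /cE ->; split=> [|j j' /cE ->].
  move: i; apply: ord_splitP => [|i]; first apply: ord_splitP => i;
    by rewrite ?c1 ?c2 ?c3 !fdE //= addnA.
move: i j; do 2!(apply: ord_splitP => [|?]; first apply: ord_splitP => ?);
  by rewrite ?c1 ?c2 ?c3 !fdE.
Qed.

Lemma fd_tens0l m n (f : fdig m n) : fd_tens (fd_bij (bij1 0)) f = f.
Proof.
have e j : rshift 0 j = j by apply/val_inj.
by apply: fdP => [x|x y]; [rewrite -{1}[x]e | rewrite -{1}[x]e -{1}[y]e]; rewrite fdE ?e.
Qed.

Lemma fd_tens0r m n (f : fdig m n) : heq (fd_tens f (fd_bij (bij1 0))) f.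
Proof.
apply: fd_heq; rewrite ?addn0 //.
apply: ord_splitP => [i|[]//] i' ii; have {i' ii}-> : i' = i by apply/val_inj.
split=> [|]; first by rewrite fdE.
apply: ord_splitP => [j|[]//] j' jj; have {j' jj}-> : j' = j by apply/val_inj.
by rewrite fdE.
Qed.

Definition fdig_prop : finprop :=
  @FinProp (fun m n => fdig m n) fd_comp fd_tens fd_bij fd_compA fd_comp1l
    fd_comp1r fd_bij_comp fd_bij_sum fd_interchange fd_tensA fd_tens0l
    fd_tens0r fd_swap.

Lemma fd_codom m n (w : fdig m n) : #|codom w| = n.
Proof.
rewrite -[RHS]card_ord; apply: eq_card => j.
by have [i <-] := fd_surj w j; rewrite codom_f.
Qed.

Lemma fd_leq m n (w : fdig m n) : (n <= m)%N.
Proof. by rewrite -(fd_codom w) -[m in (_ <= m)%N]card_ord leq_image_card. Qed.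

(** A surjection between sets of the same size is injective, which leaves no
    room for an arc. *)
Lemma fd_invertible m n (w : fdig m n) : m = n -> exists f, w = fd_bij f.
Proof.
move=> mn; have wi : injective w.
  by apply/injectiveP/card_uniqP; rewrite fd_codom size_map -cardE card_ord.
exists (mk_bij wi mn); apply: fdP => [x|x y]; rewrite fdE ?mk_bijE //.
by apply/negP => /fd_arcP/andP[/eqP xy /eqP/wi].
Qed.

Lemma fd_bij_inj m n : injective (@fd_bij m n).
Proof.
by move=> f g fg; apply: bijP => i; rewrite -!fd_bijE fg.
Qed.

Lemma fdig_mono : monotone_prop fdig_prop.
Proof. by split; [left; exact: fd_leq | exact: fd_invertible | exact: fd_bij_inj]. Qed.

(** * Bijections of sums and of small sets *)

(** Finiteness: a summand that is mapped into itself is mapped onto itself. *)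
Lemma bij_splitl d e (t : bij (d + e) (d + e)) :
  (forall i, exists j, t (lshift e i) = lshift e j) ->
  exists (u : bij d d) (v : bij e e), t = bij_sum u v.
Proof.
move=> /choice[f tf].
have fi : injective f.
  by move=> i j ij; apply/(@lshift_inj d e)/(@bij_inj _ _ t); rewrite !tf ij.
have rP i : exists j, t (rshift d i) = rshift d j.
  case: (splitP (t (rshift d i))) => j ej; last by exists j; apply/val_inj.
  pose u := mk_bij fi erefl.
  have /bij_inj/eqP : t (rshift d i) = t (lshift e (bij_inv u j)).
    rewrite tf; apply/val_inj; rewrite /= ej; congr (nat_of_ord _).
    by rewrite -[RHS](mk_bijE fi erefl) bijVK.
  by rewrite eq_rlshift.
have /choice[g tg] := rP.
have gi : injective g.
  by move=> i j ij; apply/(@rshift_inj d e)/(@bij_inj _ _ t); rewrite !tg ij.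
exists (mk_bij fi erefl), (mk_bij gi erefl).
by apply: bijP; apply: ord_splitP => i; rewrite ?bij_suml ?bij_sumr mk_bijE.
Qed.

(** The complement of the image is enumerated. *)
Lemma bij_extend d e (f : 'I_d -> 'I_(d + e)) : injective f ->
  exists s : bij (d + e) (d + e), forall i, s (lshift e i) = f i.
Proof.
move=> fi; have c : #|[predC codom f]| = e.
  by apply/eqP; rewrite -(eqn_add2l #|codom f|) cardC card_codom // !card_ord.
pose g (i : 'I_e) : 'I_(d + e) := enum_val (cast_ord (esym c) i).
have gf i j : g i <> f j.
  by move=> e1; have := enum_valP (cast_ord (esym c) i); rewrite -/(g i) e1 inE codom_f.
pose h (x : 'I_(d + e)) := match split x with inl i => f i | inr i => g i end.
have hl i : h (lshift e i) = f i by rewrite /h (unsplitK (inl i)).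
have hr i : h (rshift d i) = g i by rewrite /h (unsplitK (inr i)).
have hi : injective h.
  apply: ord_splitP => i; apply: ord_splitP => j; rewrite ?hl ?hr.
  - by move/fi->.
  - by move/esym/gf.
  - by move/gf.
  - by move/enum_val_inj/cast_ord_inj->.
by exists (mk_bij hi erefl) => i; rewrite mk_bijE hl.
Qed.

Notation i0 := (lshift 1 (ord0 : 'I_1) : 'I_(1 + 1)).
Notation i1 := (rshift 1 (ord0 : 'I_1) : 'I_(1 + 1)).

Lemma ord2_ind (P : 'I_(1 + 1) -> Prop) : P i0 -> P i1 -> forall x, P x.
Proof. by move=> P0 P1; apply: ord_splitP => x; rewrite [x]ord1. Qed.

Lemma bij2P (j : bij 2 2) : j = bij1 2 \/ j = swap 1 1.
Proof.
have ord2P (x : 'I_2) : x = i0 \/ x = i1 by move: x; apply: ord2_ind; auto.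
have j01 : j i0 <> j i1 by move/bij_inj.
have [e|e] := ord2P (j i0); have [e'|e'] := ord2P (j i1); rewrite ?e ?e' // in j01 *.
  by left; apply: bijP; apply: ord2_ind; rewrite bij1E.
by right; apply: bijP; apply: ord2_ind; rewrite ?e ?e'; [exact: esym (@swapl 1 1 _) | exact: esym (@swapr 1 1 _)].
Qed.

Lemma swap11 : swap 1 1 = perm_bij (tperm i0 i1).
Proof.
apply: bijP; apply: ord2_ind; rewrite [RHS]mk_bijE ?tpermL ?tpermR.
  exact: (@swapl 1 1).
exact: (@swapr 1 1).
Qed.

Lemma swap11K : swap 1 1 ** swap 1 1 = bij1 2.
Proof.
by apply: bijP; apply: ord2_ind; rewrite bij_compE (@swapl 1 1, @swapr 1 1) (@swapl 1 1, @swapr 1 1) bij1E.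
Qed.

(** Bijections of small sets are compared through functions on nat, which can
    be computed. *)
Definition reads m n (f : bij m n) (F : nat -> nat) := forall x, f x = F x :> nat.

Lemma reads_comp m n p (g : bij n p) (f : bij m n) G F :
  reads g G -> reads f F -> reads (g ** f) (G \o F).
Proof. by move=> gG fF x; rewrite bij_compE gG fF. Qed.

Lemma reads_eq m n (f g : bij m n) F G :
  reads f F -> reads g G -> all (fun i => F i == G i) (iota 0 m) -> f = g.
Proof.
move=> fF gG /allP FG; apply: bijP => x; apply/val_inj; rewrite /= fF gG.
by apply/eqP/FG; rewrite mem_iota /=.
Qed.

Lemma reads_swap m n : reads (swap m n) (fun x => if (x < m)%N then n + x else x - m)%N.
Proof.
apply: ord_splitP => x; rewrite ?swapl ?swapr /=.
  by rewrite (leq_trans (ltn_ord x)).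
by rewrite ltnNge leq_addr /= addKn.
Qed.

Lemma reads1 n : reads (bij1 n) id.
Proof. by move=> x; rewrite bij1E. Qed.

Lemma reads_sum m n m' n' (f : bij m n) (f' : bij m' n') F F' :
  reads f F -> reads f' F' ->
  reads (bij_sum f f') (fun x => if (x < m)%N then F x else n + F' (x - m))%N.
Proof.
move=> fF fF'; apply: ord_splitP => x; rewrite ?bij_suml ?bij_sumr /=.
  by rewrite (leq_trans (ltn_ord x)).
by rewrite ltnNge leq_addr /= addKn fF'.
Qed.

Lemma cycle3K1 : swap 1 2 ** swap 1 2 = swap 2 1.
Proof. exact: (reads_eq (reads_comp (@reads_swap 1 2) (@reads_swap 1 2)) (@reads_swap 2 1)). Qed.

Lemma cycle3K : swap 1 2 ** swap 2 1 = bij1 3.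
Proof. exact: (reads_eq (reads_comp (@reads_swap 1 2) (@reads_swap 2 1)) (@reads1 3)). Qed.

Lemma cycle3K2 : swap 2 1 ** swap 1 2 = bij1 3.
Proof. exact: (reads_eq (reads_comp (@reads_swap 2 1) (@reads_swap 1 2)) (@reads1 3)). Qed.

Lemma cycle3_conj : swap 2 1 ** bij_sum (swap 1 1) (bij1 1) = bij_sum (swap 1 1) (bij1 1) ** swap 1 2.
Proof.
have sE := reads_sum (@reads_swap 1 1) (@reads1 1).
exact: (reads_eq (reads_comp (@reads_swap 2 1) sE) (reads_comp sE (@reads_swap 1 2))).
Qed.

Section SmallSums.
Variable k : fieldType.

Lemma bsgn_swap11 : bsgn k (swap 1 1) = -1.
Proof. by rewrite swap11 bsgn_tperm. Qed.

Lemma sum_bij2 (V : nmodType) (F : bij 2 2 -> V) :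
  \sum_j F j = F (bij1 2) + F (swap 1 1).
Proof.
have n1 : swap 1 1 != bij1 2.
  by apply/eqP => /(congr1 (fun f : bij (1 + 1) (1 + 1) => f i0))/eqP;
     rewrite (@swapl 1 1) bij1E.
rewrite (bigD1 (bij1 2)) //= (bigD1 (swap 1 1)) //= big1 ?addr0 // => j.
by have [->|->] := bij2P j; rewrite eqxx ?andbF.
Qed.

(** A sum over the pairs (s, t) with P s t is a sum over the group J that
    parametrizes them. *)
Lemma sum_delta_param (S T J : finType) (V : lmodType k) (P : S -> T -> bool)
    (g : J -> S * T) (F : S -> T -> V) :
  injective g -> (forall s t, P s t <-> exists j, g j = (s, t)) ->
  \sum_s \sum_t (P s t)%:R *: F s t = \sum_j F (g j).1 (g j).2.
Proof.
move=> gi gP; rewrite pair_big /=.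
rewrite (bigID (mem [set g j | j in J])) /= [X in _ + X]big1 ?addr0 => [|[s t] /= nst].
  rewrite big_imset /=; last by move=> *; exact: gi.
  apply: eq_bigr => j _; case e: (g j) => [s t] /=.
  by rewrite (gP s t).2 ?scale1r //; exists j.
case: (boolP (P s t)) => [/gP[j e]|_]; last by rewrite scale0r.
by case/imsetP: nst; exists j.
Qed.

(** * Commutators in an algebra object *)

Section Commutator.
Variables (Q : lprop k) (M : hom Q 2 1).
Hypothesis M_assoc : hcomp M (htens M (hid Q 1)) = hcomp M (htens (hid Q 1) M).

Definition commutator : hom Q 2 1 := M - hcomp M (hbij Q (swap 1 1)).

Lemma hcompBl m n p (f f' : hom Q n p) (g : hom Q m n) :
  hcomp (f - f') g = hcomp f g - hcomp f' g.
Proof. exact: (linear_funB (hcomp_linl g)). Qed.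
Lemma hcompBr m n p (f : hom Q n p) (g g' : hom Q m n) :
  hcomp f (g - g') = hcomp f g - hcomp f g'.
Proof. exact: (linear_funB (hcomp_linr f)). Qed.
Lemma hcompDr m n p (f : hom Q n p) (g g' : hom Q m n) :
  hcomp f (g + g') = hcomp f g + hcomp f g'.
Proof. exact: (linear_funD (hcomp_linr f)). Qed.

Lemma commutatorN : hcomp commutator (hbij Q (swap 1 1)) = - commutator.
Proof.
by rewrite /commutator hcompBl -hcompA -hbij_comp swap11K hcomp1r opprB.
Qed.

(** With a = M (M + 1), the left factor is a (1 - c) (1 - s) for a
    transposition s and a 3-cycle c that s inverts, that is a (1 - c) - a s (1
    - c^-1); and 1 - c and 1 - c^-1 kill the sum of the cyclic permutations.
    *)
Lemma commutator_jacobi :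
  hcomp (hcomp commutator (htens commutator (hid Q 1)))
    (hid Q 3 + hbij Q (swap 1 2) + hbij Q (swap 2 1)) = 0.
Proof.
set e := (_ + _ + _).
pose a := hcomp M (htens M (hid Q 1)).
pose s := bij_sum (swap 1 1) (bij1 1).
have comm1 : htens commutator (hid Q 1) = htens M (hid Q 1) - hcomp (htens M (hid Q 1)) (hbij Q s).
  rewrite /commutator (linear_funB (htens_linl (hid Q 1))); congr (_ - _).
  by rewrite /s hbij_sum -hinterchange hcomp1r.
have Ms : hcomp (hcomp M (hbij Q (swap 1 1))) (htens M (hid Q 1)) = hcomp a (hbij Q (swap 2 1)).
  by rewrite -hcompA hbij_swap hcompA -M_assoc.
have e1 : hcomp (hbij Q (swap 1 2)) e = e.
  by rewrite /e !hcompDr -!hbij_comp /hid bij_comp1r cycle3K1 cycle3K addrC addrA.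
have e2 : hcomp (hbij Q (swap 2 1)) e = e.
  by rewrite -[in LHS]e1 -[RHS]hcomp1l hcompA -hbij_comp cycle3K2.
rewrite comm1 hcompBr /commutator !hcompBl !hcompA Ms -/a.
rewrite -[hcomp (hcomp a (hbij Q s)) e]hcompA -[hcomp (hcomp a _) e]hcompA e2.
rewrite -[hcomp _ (hbij Q s)]hcompA -hbij_comp cycle3_conj hbij_comp.
rewrite -[hcomp (hcomp a (hcomp _ _)) e]hcompA -[hcomp (hcomp _ _) e]hcompA e1.
by rewrite -[bij_sum _ _]/s !subrr.
Qed.

End Commutator.
End SmallSums.

(** * The Lie bracket on fibrewise digraphs *)

Section LieModel.
Variable k : fieldType.
Local Notation LF := (linearize k fdig_prop).
Local Notation delta := (fdelta k).

Definition lprop_comp (P Q R : lprop k) (G : lprop_mor Q R) (F : lprop_mor P Q) : lprop_mor P R.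
Proof.
refine (@LPropMor k P R (fun m n x => pmap G (pmap F x)) _ _ _ _).
- by move=> m n a x y; rewrite !pmap_lin.
- by move=> m n p g f; rewrite !pmap_comp.
- by move=> m n m' n' f g; rewrite !pmap_tens.
- by move=> m n f; rewrite !pmap_bij.
Defined.

Lemma kSym_neq m n (x y : hom (kSym k) m n) : m != n -> x = y.
Proof. by move=> mn; apply/ffunP => f; case/eqP: mn; exact: bij_dim f. Qed.

(** The product, as the linear order on two points. *)
Definition fd_mu : fdig 2 1.
Proof.
refine (@mk_fd 2 1 (fun=> ord0) (fun x y => (x < y)%N) _ _).
- by move=> j; exists ord0; rewrite [j]ord1.
- by move=> x y xy; rewrite eqxx andbT; apply: contraTneq xy => ->; rewrite ltnn.
Defined.

Lemma fd_muE x : fd_mu x = ord0. Proof. exact: mk_fdE. Qed.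
Lemma fd_mu_arc x y : fd_arc fd_mu x y = (x < y)%N. Proof. exact: mk_fd_arc. Qed.

Definition fd_reads m n (w : fdig m n) (F : nat -> nat) (R : rel nat) :=
  (forall x, w x = F x :> nat) /\ (forall x y : 'I_m, fd_arc w x y = R x y).

Lemma fd_reads_comp m n p (w : fdig n p) (v : fdig m n) G S F R :
  fd_reads w G S -> fd_reads v F R ->
  fd_reads (fd_comp w v) (G \o F) (fun x y => if F x == F y then R x y else S (F x) (F y)).
Proof.
move=> [wG wS] [vF vR]; split=> [x|x y]; first by rewrite fdE wG vF.
by rewrite fdE -(inj_eq val_inj) /= wS vR !vF.
Qed.

Lemma fd_reads_tens m n m' n' (w : fdig m n) (v : fdig m' n') G S F R :
  fd_reads w G S -> fd_reads v F R ->
  fd_reads (fd_tens w v) (fun x => if (x < m)%N then G x else n + F (x - m))%N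
    (fun x y => if (x < m)%N then (y < m)%N && S x y else (m <= y)%N && R (x - m)%N (y - m)%N).
Proof.
move=> [wG wS] [vF vR]; have lt (x : 'I_m) : (lshift m' x < m)%N by exact: (ltn_ord x).
have ge (x : 'I_m') : (rshift m x < m)%N = false by rewrite /= ltnNge leq_addr.
split=> [|x y]; first by apply: ord_splitP => x; rewrite ?lt ?ge !fdE /= ?wG // addKn vF.
move: x y; apply: ord_splitP => x; apply: ord_splitP => y; rewrite !fdE ?ge ?lt //=.
  by rewrite leqNgt ltn_ord.
by rewrite leq_addr !addKn.
Qed.

Lemma fd_reads_eq m n (w v : fdig m n) G S F R : fd_reads w G S -> fd_reads v F R ->
  all (fun x => (G x == F x) && all (fun y => S x y == R x y) (iota 0 m)) (iota 0 m) -> w = v.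
Proof.
move=> [wG wS] [vF vR] /allP GF.
have io (x : 'I_m) : (x : nat) \in iota 0 m by rewrite mem_iota /=.
apply: fdP => [x|x y]; have /andP[/eqP Gx /allP Sx] := GF _ (io x).
  by apply/val_inj; rewrite /= wG vF.
by rewrite wS vR; exact/eqP/Sx.
Qed.

Lemma fd_reads_mu : fd_reads fd_mu (fun=> 0%N) (fun x y => (x < y)%N).
Proof. by split=> [x|x y]; rewrite ?fd_muE ?fd_mu_arc. Qed.

Lemma fd_reads1 n : fd_reads (fd_bij (bij1 n)) id (fun _ _ => false).
Proof. by split=> [x|x y]; rewrite fdE ?bij1E. Qed.

(** Both composites are the linear order on three points. *)
Lemma fd_mu_assoc : fd_comp fd_mu (fd_tens fd_mu (fd_bij (bij1 1)))
  = fd_comp fd_mu (fd_tens (fd_bij (bij1 1)) fd_mu).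
Proof.
exact: (fd_reads_eq (fd_reads_comp fd_reads_mu (fd_reads_tens fd_reads_mu (fd_reads1 1)))
  (fd_reads_comp fd_reads_mu (fd_reads_tens (fd_reads1 1) fd_reads_mu))).
Qed.

Lemma linearizeM (W : finprop) m n p (g : fp_hom W n p) (f : fp_hom W m n) :
  hcomp (delta g : hom (linearize k W) n p) (delta f : hom (linearize k W) m n)
  = delta (fp_comp g f).
Proof. exact: bilext_delta. Qed.

Lemma linearizeT (W : finprop) m n m' n' (g : fp_hom W m n) (f : fp_hom W m' n') :
  htens (delta g : hom (linearize k W) m n) (delta f : hom (linearize k W) m' n')
  = delta (fp_tens g f).
Proof. exact: bilext_delta. Qed.

Definition fd_bracket : hom LF 2 1 := commutator (delta fd_mu : hom LF 2 1).

Lemma fd_bracket_respects :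
  respects (lie_axioms (lie_br k)) (fun _ : gen lie_sig => fd_bracket).
Proof.
move=> m n t u [] /=.
  by rewrite scaleN1r; exact: (commutatorN (delta fd_mu : hom LF 2 1)).
apply: (@commutator_jacobi k LF (delta fd_mu : hom LF 2 1)).
have T1 : htens (delta fd_mu : hom LF 2 1) (hid LF 1) = delta (fd_tens fd_mu (fd_bij (bij1 1))).
  exact: (linearizeT (W := fdig_prop) fd_mu (fd_bij (bij1 1))).
have T2 : htens (hid LF 1) (delta fd_mu : hom LF 2 1) = delta (fd_tens (fd_bij (bij1 1)) fd_mu).
  exact: (linearizeT (W := fdig_prop) (fd_bij (bij1 1)) fd_mu).
have E1 : hcomp (delta fd_mu : hom LF 2 1) (htens (delta fd_mu : hom LF 2 1) (hid LF 1))
    = delta (fd_comp fd_mu (fd_tens fd_mu (fd_bij (bij1 1)))).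
  rewrite T1; exact: (linearizeM (W := fdig_prop) fd_mu (fd_tens fd_mu (fd_bij (bij1 1)))).
have E2 : hcomp (delta fd_mu : hom LF 2 1) (htens (hid LF 1) (delta fd_mu : hom LF 2 1))
    = delta (fd_comp fd_mu (fd_tens (fd_bij (bij1 1)) fd_mu)).
  rewrite T2; exact: (linearizeM (W := fdig_prop) fd_mu (fd_tens (fd_bij (bij1 1)) fd_mu)).
exact: etrans E1 (etrans (congr1 _ fd_mu_assoc) (esym E2)).
Qed.

Definition lie_fdig : lprop_mor (CLie k) LF := presented_mor fd_bracket_respects.
Definition liec_fdig : lprop_mor (CLieC k) LF := lprop_comp lie_fdig (liec_to_lie k).

End LieModel.

Section Bracket.
Variables (k : fieldType) (d : nat).
Local Notation LF := (linearize k fdig_prop).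
Local Notation delta := (fdelta k).

Lemma tens_bracket_sym (Q : lprop k) (b : hom Q 2 1) (j : bij_pair d) :
  hcomp b (hbij Q (swap 1 1)) = - b ->
  hcomp (htens (hid Q d) b) (hbij Q (br_in j))
  = br_sgn k j *: hcomp (hbij Q (br_out j)) (htens (hid Q d) b).
Proof.
move=> bN; rewrite /br_in /br_out !hbij_sum.
rewrite -[LHS]hinterchange -[X in _ *: X]hinterchange hcomp1l hcomp1r hcomp1l.
have -> : hcomp b (hbij Q j.2) = br_sgn k j *: b.
  rewrite /br_sgn; have [->|->] := bij2P j.2; first by rewrite hcomp1r bsgn1 scale1r.
  by rewrite bN bsgn_swap11 scaleN1r.
exact: linear_funZ (htens_linr _) _ _.
Qed.

Definition fd_tens_mu : fdig (d + 2) (d + 1) := fd_tens (fd_bij (bij1 d)) fd_mu.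

Lemma fd_tens_mul (x : 'I_d) : fd_tens_mu (lshift 2 x) = lshift 1 x.
Proof. by rewrite /fd_tens_mu fdE fdE bij1E. Qed.

Lemma fd_tens_mur x : fd_tens_mu (rshift d x) = rshift d ord0.
Proof. by rewrite /fd_tens_mu fdE fd_muE. Qed.

Lemma fd_tens_mu_arcP x y : fd_arc fd_tens_mu x y -> x = rshift d i0 /\ y = rshift d i1.
Proof.
move: x y; apply: ord_splitP => x; apply: ord_splitP => y; rewrite !fdE // fd_mu_arc.
by case: x y => [[|[|//]] ?] [[|[|//]] ?] //= _; split; apply/val_inj.
Qed.

(** The single arc of 1 + mu must go to itself under t, so that t fixes the
    last two points, and s is then determined. *)
Lemma fd_stab (s : bij (d + 1) (d + 1)) (t : bij (d + 2) (d + 2)) :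
  fd_comp (fd_bij s) (fd_comp fd_tens_mu (fd_bij t)) = fd_tens_mu
  <-> exists j, s = bij_sum j (bij1 1) /\ t = bij_sum (bij_inv j) (bij1 2).
Proof.
split=> [e|[j [-> ->]]]; last first.
  rewrite !fd_bij_sum /fd_tens_mu -!fd_interchange !fd_comp1l !fd_comp1r -fd_bij_comp.
  by rewrite bij_compVr.
have ef x : s (fd_tens_mu (t x)) = fd_tens_mu x by rewrite -[in RHS]e !fdE.
have ea x y : fd_arc fd_tens_mu x y -> fd_arc fd_tens_mu (t x) (t y).
  rewrite -[in X in X -> _]e fd_comp_arc !fd_comp_arc !fd_bij_arc !fd_bijE.
  by case: ifP => // _; case: ifP.
have arc01 : fd_arc fd_tens_mu (rshift d i0) (rshift d i1) by rewrite fdE fd_mu_arc.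
have [t0 t1] := fd_tens_mu_arcP (ea _ _ arc01).
have [|j [v tE]] := @bij_splitl d 2 t.
  move=> i; case: (splitP (t (lshift 2 i))) => j tj; first by exists j; apply/val_inj.
  have : t (lshift 2 i) = t (rshift d j).
    have -> : t (lshift 2 i) = rshift d j by apply/val_inj.
    by move: j tj; apply: ord2_ind => _; rewrite ?t0 ?t1.
  by move/bij_inj/eqP; rewrite eq_lrshift.
have v1 : v = bij1 2.
  apply: bijP; apply: ord2_ind; rewrite bij1E; apply: (@rshift_inj d).
    by rewrite -t0 tE bij_sumr.
  by rewrite -t1 tE bij_sumr.
rewrite {v}v1 in tE; exists (bij_inv j); rewrite bij_invK; split=> //.
apply: bijP; apply: ord_splitP => i.
  by have := ef (lshift 2 (bij_inv j i)); rewrite tE !bij_suml bijVK !fd_tens_mul.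
by have := ef (rshift d i0); rewrite t0 bij_sumr bij1E !fd_tens_mur [i]ord1.
Qed.

Definition tens_bracket (Q : lprop k) (b : hom Q 2 1) : hom Q (d + 2) (d + 1) :=
  htens (hid Q d) b.

(** The bracket has the coefficient 1 on 1 + mu and -1 on its composite with
    the transposition, and the stabilizer of 1 + mu is S_d.  Together they
    form the sum over S_d x S_2 with the sign of S_2. *)
Lemma fd_bracket_coef (U : lmodType k) (F : bij (d + 1) (d + 1) -> bij (d + 2) (d + 2) -> U) :
  \sum_s \sum_t wcoef (fd_tens_mu : fp_hom fdig_prop _ _) (tens_bracket (fd_bracket k)) s t *: F s t
  = \sum_(j : bij_pair d) br_sgn k j *: F (br_out j) (bij_inv (br_in j)).
Proof.
pose u := bij_sum (bij1 d) (swap 1 1).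
have bE : tens_bracket (fd_bracket k)
    = delta fd_tens_mu - delta (fd_comp fd_tens_mu (fd_bij u)) :> hom LF _ _.
  rewrite /tens_bracket /fd_bracket /commutator (linear_funB (htens_linr _)).
  rewrite [X in X - _](linearizeT k (W := fdig_prop) (fd_bij (bij1 d)) fd_mu); congr (_ - _).
  rewrite [X in htens _ X](linearizeM k (W := fdig_prop) fd_mu (fd_bij (swap 1 1))).
  rewrite [LHS](linearizeT k (W := fdig_prop) (fd_bij (bij1 d))).
  by congr (delta _); rewrite /fd_tens_mu /u fd_bij_sum -fd_interchange fd_comp1r.
pose T (s : bij (d + 1) (d + 1)) (t : bij (d + 2) (d + 2)) :=
  fd_comp (fd_bij s) (fd_comp fd_tens_mu (fd_bij t)).
have cE s t : wcoef (fd_tens_mu : fp_hom fdig_prop _ _) (tens_bracket (fd_bracket k)) s t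
    = (T s t == fd_tens_mu)%:R - (T s t == fd_comp fd_tens_mu (fd_bij u))%:R.
  by rewrite bE /wcoef !ffunE.
under eq_bigr => s _ do under eq_bigr => t _ do rewrite cE scalerBl.
under eq_bigr => s _ do rewrite sumrB.
rewrite sumrB sum_pair.
pose g (v : bij 2 2) (j : bij d d) := (bij_sum j (bij1 1), bij_sum (bij_inv j) v).
have gi v : injective (g v).
  move=> j j' /(congr1 fst)/= jj; apply: bijP => i; apply: (@lshift_inj d 1).
  by rewrite -!(bij_suml _ (bij1 1)) jj.
rewrite [X in X - _](sum_delta_param (P := fun s t => T s t == fd_tens_mu) F (gi (bij1 2))) => [|s t]; last first.
  split=> [/eqP/fd_stab[j [-> ->]]|[j [<- <-]]]; first by exists j.
  by apply/eqP/fd_stab; exists j.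
rewrite [X in _ - X](sum_delta_param (P := fun s t => T s t == fd_comp fd_tens_mu (fd_bij u)) F (gi (swap 1 1))) => [|s t]; last first.
  have uu : u ** u = bij1 _ by rewrite bij_sum_comp bij_comp1l swap11K bij_sum1.
  have Tu : T s t = fd_comp fd_tens_mu (fd_bij u) <-> T s (t ** u) = fd_tens_mu.
    rewrite /T fd_bij_comp; split=> [e|e].
      by rewrite 2!fd_compA -[fd_comp (fd_comp _ _) (fd_bij t)]fd_compA e -fd_compA -fd_bij_comp uu fd_comp1r.
    by rewrite -[in RHS]e -!fd_compA -fd_bij_comp uu fd_comp1r.
  split=> [/eqP/Tu/fd_stab[j [-> tu]]|[j [es et]]].
    by exists j; congr pair; rewrite -[t]bij_comp1r -uu bij_compA tu bij_sum_comp bij_comp1l bij_comp1r.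
  apply/eqP/Tu/fd_stab; exists j; split=> //.
  by rewrite -et bij_sum_comp bij_comp1r swap11K.
rewrite -sumrB; apply: eq_bigr => j _; rewrite sum_bij2 /br_sgn /br_out /br_in /=.
have swV : bij_inv (swap 1 1) = swap 1 1 by apply/esym/bij_inv_uniql/swap11K.
by rewrite bsgn1 scale1r bsgn_swap11 scaleN1r !bij_inv_sum bij_inv1 swV.
Qed.

Lemma fdig_factor q : fdig (d + 2) q -> fdig q (d + 1) -> (d + 2)%N = q \/ q = (d + 1)%N.
Proof.
move=> /fd_leq q2 /fd_leq q1; move: q1; rewrite leq_eqVlt => /orP[/eqP|q1]; first by right.
by left; apply/eqP; rewrite eqn_leq q2 andbT addnS.
Qed.
End Bracket.

(** * Ext^1 for the bracket *)

Lemma Ext1_iso_trans (k : fieldType) (P : lprop k) (A B : cmod P) (V W : lmodType k) :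
  Ext1_iso A B V -> lin_iso V W -> Ext1_iso A B W.
Proof.
move=> [cls [cs ce cb cc]] [f [lf [g fK gK]]]; exists (f \o cls); split.
- by move=> w; have [E EE] := cs (g w); exists E; rewrite /= EE gK.
- by move=> E E'; rewrite -ce; split=> [/(can_inj fK)|/= ->].
- move=> E1 E2 E3; rewrite -cb /= -(linear_funD lf); split=> [/(can_inj fK)//|->//].
- move=> c E E'; rewrite -cc /= -(linear_funZ lf); split=> [/(can_inj fK)//|->//].
Qed.

Lemma subvs_iso (k : fieldType) (V W : vectType k) (U : {vspace V}) (U' : {vspace W}) :
  \dim U = \dim U' -> lin_iso (subvs_of U) (subvs_of U').
Proof.
move=> e; apply: (@lin_iso_trans k _ 'rV[k]_(\dim U')).
  by apply: vect_row_iso.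
by apply/lin_iso_sym/vect_row_iso.
Qed.

Section Lie.
Variable k : fieldType.

Definition lie_x0 d : hom (CLie k) (d + 2) (d + 1) :=
  tens_bracket d (generator (lie_axioms (lie_br k)) (LieBr : gen lie_sig)).

Lemma lie_brN : hcomp (generator (lie_axioms (lie_br k)) (LieBr : gen lie_sig) : hom (CLie k) 2 1)
    (hbij (CLie k) (swap 1 1)) = - (generator (lie_axioms (lie_br k)) (LieBr : gen lie_sig) : hom (CLie k) 2 1).
Proof.
rewrite -[RHS]scaleN1r.
apply: etrans (pr_compE _ (lie_br k) (tbij (swap 1 1))) _.
rewrite -tclassZ; exact/tclassP/teq_rel/lie_antisym.
Qed.

(** The upper bounds on the hom-sets of C_Lie that are needed: depending on p
    - q they are 0, spanned by permutations, or spanned by translates of 1 +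
    [,].  Spanning is expressed through linear maps out of the hom-set, the
    form used in [bitens_kernels]. *)
Definition lie_span p q (x : hom (CLie k) p q) : Prop :=
  [/\ (p < q)%N -> x = 0,
      (0 < p)%N -> q = 0%N -> x = 0,
      p = q -> forall (U : lmodType k) (f g : hom (CLie k) p q -> U), linear f -> linear g ->
        (forall b, f (hbij _ b) = g (hbij _ b)) -> f x = g x &
      forall d, p = (d + 2)%N -> q = (d + 1)%N ->
        forall (U : lmodType k) (f g : hom (CLie k) p q -> U), linear f -> linear g ->
        (forall (s : bij (d + 1) q) (t : bij p (d + 2)),
           f (hcomp (hbij _ s) (hcomp (lie_x0 d) (hbij _ t)))
           = g (hcomp (hbij _ s) (hcomp (lie_x0 d) (hbij _ t)))) -> f x = g x].

Lemma lie_spanP p q (x : hom (CLie k) p q) : lie_span x.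
Proof.
elim: (gspan_all x) => {q x}.
- move=> q f; split.
  + by move=> /ltn_eqF/eqP[]; exact: bij_dim f.
  + by move=> p0 q0; case/eqP: (lt0n_neq0 p0); rewrite (bij_dim f) q0.
  + by move=> _ U F G lF lG ->.
  + by move=> d pd qd; have /addnI := etrans (esym pd) (etrans (bij_dim f) qd).
- move=> q r f x _ [x1 x2 x3 x4]; have qr := bij_dim f; split.
  + by move=> pr; rewrite x1 ?hcomp0r // qr.
  + by move=> p0 r0; rewrite x2 ?hcomp0r // qr.
  + move=> pr U F G lF lG FG; have pq : p = q by rewrite qr.
    apply: (x3 pq U (fun x => F (hcomp (hbij _ f) x)) (fun x => G (hcomp (hbij _ f) x))).
    * exact: linear_cmp lF (hcomp_linr _).
    * exact: linear_cmp lG (hcomp_linr _).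
    * by move=> b; rewrite -hbij_comp.
  + move=> d pd rd U F G lF lG FG; have qd : q = (d + 1)%N by rewrite qr.
    apply: (x4 d pd qd U (fun x => F (hcomp (hbij _ f) x)) (fun x => G (hcomp (hbij _ f) x))).
    * exact: linear_cmp lF (hcomp_linr _).
    * exact: linear_cmp lG (hcomp_linr _).
    * by move=> s t; rewrite [hcomp (hbij _ f) _]hcompA -hbij_comp.
- move=> q r y x [[] [e gy]] _ [x1 x2 x3 x4]; case: gy => {q r y} in x x1 x2 x3 x4 *.
  set y := htens _ _; split.
  + by move=> pe; rewrite x1 ?hcomp0r // (ltn_trans pe) // ltn_add2l.
  + by move=> _ /eqP; rewrite addn_eq0 andbF.
  + move=> pe U F G lF lG _; rewrite x1 ?hcomp0r; last by rewrite pe ltn_add2l.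
    by rewrite (linear_fun0 lF) (linear_fun0 lG).
  + move=> d pd /(@addIn 1) ed; subst d => U F G lF lG FG.
    apply: (x3 pd U (fun x => F (hcomp y x)) (fun x => G (hcomp y x))).
    * exact: linear_cmp lF (hcomp_linr _).
    * exact: linear_cmp lG (hcomp_linr _).
    * by move=> b; have := FG (bij1 _) b; rewrite !hcomp1l.
- move=> q; split=> // [_|d _ _] U F G lF lG _; by rewrite (linear_fun0 lF) (linear_fun0 lG).
- move=> q a x y _ [x1 x2 x3 x4] _ [y1 y2 y3 y4]; split.
  + by move=> pq; rewrite x1 // y1 // scaler0 addr0.
  + by move=> p0 q0; rewrite x2 // y2 // scaler0 addr0.
  + by move=> pq U F G lF lG FG; rewrite lF lG (x3 pq U F G) // (y3 pq U F G).
  + by move=> d pd qd U F G lF lG FG; rewrite lF lG (x4 d pd qd U F G) // (y4 d pd qd U F G).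
Qed.

Lemma liec_fdig_sym p q (x : hom (CLieC k) p q) :
  pmap (lie_to_sym k) (pmap (liec_to_lie k) x) = to_sym (pmap (liec_fdig k) x).
Proof.
apply: (presented_ext (F := lie_to_sym k) (F' := lprop_comp (sym_mor k fdig_mono) (lie_fdig k))).
by case; apply: kSym_neq.
Qed.

Lemma liec_brN : hcomp (generator (@liec_rel k) LieCBr : hom (CLieC k) 2 1)
    (hbij (CLieC k) (swap 1 1)) = - (generator (@liec_rel k) LieCBr : hom (CLieC k) 2 1).
Proof.
rewrite -[RHS]scaleN1r.
apply: etrans (pr_compE _ (liec_br k) (tbij (swap 1 1))) _.
rewrite -tclassZ; exact/tclassP/teq_rel/liec_lie/lie_antisym.
Qed.

Definition liec_br0 d : hom (CLieC k) (d + 2) (d + 1) :=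
  tens_bracket d (generator (@liec_rel k) LieCBr).

Lemma lie_fdig_x0 d : pmap (lie_fdig k) (lie_x0 d) = tens_bracket d (fd_bracket k).
Proof.
rewrite /lie_x0 /tens_bracket (pmap_tens (lie_fdig k)) /hid (pmap_bij (lie_fdig k)).
congr (htens _ _); exact: (pr_mapE (@fd_bracket_respects k) (lie_br k)).
Qed.

Lemma liec_fdig_br0 d : pmap (liec_fdig k) (liec_br0 d) = tens_bracket d (fd_bracket k).
Proof.
rewrite -lie_fdig_x0; congr (pmap (lie_fdig k) _).
rewrite /lie_x0 /liec_br0 /tens_bracket (pmap_tens (liec_to_lie k)) /hid (pmap_bij (liec_to_lie k)).
congr (htens _ _); exact: (pr_mapE (@liec_lie_respects k) (liec_br k)).
Qed.

Lemma br0_gen d m n (y : hom (CLieC k) m n) : is_gen y -> m = (d + 2)%N -> n = (d + 1)%N ->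
  heq (H := fun m n => GRing.Lmodule.sort (hom (CLieC k) m n)) (liec_br0 d) y.
Proof.
move=> [[] [e gy]]; case: gy => md nd.
  by have ed := @addIn 1 _ _ nd; subst e; exact: heq_refl.
by exfalso; move: md nd; rewrite addn0 => ->; rewrite -addnA => /addnI.
Qed.

Variables (la mu : seq nat) (d : nat).
Hypotheses (char0 : [pchar k] =i pred0) (part_la : is_partition la) (part_mu : is_partition mu).
Hypotheses (la_d : sumn la = (d + 2)%N) (mu_d : sumn mu = (d + 1)%N).

Lemma card_pair_gt0 e : (0 < #|{: bij_pair e}|)%N.
Proof. by apply/card_gt0P; exists (bij1 e, bij1 2). Qed.

Lemma Ext1_bracket :
  Ext1_iso (T_functor (SpechtLie k la)) (T_functor (SpechtLie k mu))
    (bitens (CLie k) (Specht k mu) (Specht k la) (d + 1) (d + 2))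
  /\ Ext1_dim (T_functor (SpechtLie k la)) (T_functor (SpechtLie k mu))
    (\sum_(rho <- parts d) LR k la rho [:: 1; 1] * LR k mu rho [:: 1])%N.
Proof.
have pq : (d + 2)%N != (d + 1)%N by rewrite eqn_add2l.
have E := Ext1_kernels char0 part_la part_mu fdig_mono liec_fdig_sym
  (w0 := fd_tens_mu d : fp_hom fdig_prop _ _) (y0 := liec_br0 d) la_d mu_d pq
  (@fdig_factor d) (@br0_gen d) (card_pair_gt0 d).
have {}E := E (@br_out d) (@br_in d) (br_sgn k (d := d)).
have C (V : lprop k) (F : lprop_mor V (linearize k fdig_prop)) (b : hom V (d + 2) (d + 1)) :
    pmap F b = tens_bracket d (fd_bracket k) ->
    forall (U : lmodType k) (G : bij (d + 1) (d + 1) -> bij (d + 2) (d + 2) -> U),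
    \sum_s \sum_t wcoef (fd_tens_mu d : fp_hom fdig_prop _ _) (pmap F b) s t *: G s t
    = \sum_(j : bij_pair d) br_sgn k j *: G (br_out j) (bij_inv (br_in j)).
  by move=> -> U G; exact: fd_bracket_coef.
have {}E := E (C _ _ _ (liec_fdig_br0 d)) (fun j => tens_bracket_sym j liec_brN).
pose inv2 (j : bij_pair d) : bij_pair d := (bij_inv j.1, bij_inv j.2).
have T := bitens_kernels char0 part_la part_mu (hinv := inv2) (sg := @br_out d) (ta := @br_in d)
  (ch := br_sgn k (d := d)) (F := lie_fdig k)
  (w0 := fd_tens_mu d : fp_hom fdig_prop _ _) (x0 := lie_x0 d).
have {}T : lin_iso _ _ := T _ _ _ _ (@br_sgn_sq k d) (card_pair_gt0 d)
  (C _ _ _ (lie_fdig_x0 d)) (fun j => tens_bracket_sym j lie_brN) _.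
have yt : ysym_or_star (ysym k la) by left.
have yt' : ysym_or_star (kstar (ysym k la)) by right.
split; apply: (Ext1_iso_trans E); last first.
  by apply: vect_row_iso; rewrite -[RHS](br_dim char0 part_la part_mu la_d yt').
apply: lin_iso_trans (lin_iso_sym (T _ _ _ _ _)).
- by apply: subvs_iso; rewrite !br_dim.
- by move=> [a b]; rewrite /inv2 /= !bij_invK.
- by move=> [a b]; rewrite /br_out bij_inv_sum bij_inv1.
- by move=> [a b]; rewrite /br_in bij_inv_sum.
- by move=> [a b]; rewrite /br_sgn bsgnV.
- move=> U f g lf lg fg x; have [_ _ _ X] := lie_spanP x; exact: (X d erefl erefl).
Qed.

End Lie.

(** * Ext^1 for the Casimir element *)

Lemma ub_leq m n (w : ubrauer m n) : (m <= n)%N.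
Proof. by have := leq_card _ (@ub_out_inj _ _ w); rewrite !card_ord. Qed.

Lemma ub_invertible m n (w : ubrauer m n) : m = n -> exists f, w = ub_bij f.
Proof.
move=> mn; pose f := mk_bij (@ub_out_inj _ _ w) mn; exists f; apply: ubP => -[i|j].
  by rewrite [RHS]mk_ubE /= ub_outE mk_bijE.
rewrite [RHS]mk_ubE /= -(ub_outK w); congr (w (inr _)).
by rewrite -[RHS](mk_bijE (@ub_out_inj _ _ w) mn) -/f bij_invfK.
Qed.

Lemma ub_bij_inj m n : injective (@ub_bij m n).
Proof. by move=> f g fg; apply: bijP => i; rewrite -!ub_bij_out fg. Qed.

Lemma ubrauer_mono : monotone_prop ubrauer_prop.
Proof. by split; [right; exact: ub_leq | exact: ub_invertible | exact: ub_bij_inj]. Qed.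

(** s lists the outputs on through strands first; the others can only be
    joined among themselves. *)
Lemma ub_normal d e (w : ubrauer d (d + e)) : exists s : bij (d + e) (d + e),
  (forall i, s (lshift e i) = ub_out w i) /\
  forall j, exists j', j' != j /\ w (inr (s (rshift d j))) = inr (s (rshift d j')).
Proof.
have [s sE] := bij_extend (@ub_out_inj _ _ w); exists s; split=> // j.
case wj: (w (inr (s (rshift d j)))) => [i|z].
  have := ubK w (inr (s (rshift d j))); rewrite wj ub_outE -sE => -[/bij_inj/eqP].
  by rewrite eq_lrshift.
have := ubK w (inr (s (rshift d j))); rewrite wj -(bijVK s z).
elim/ord_splitP: (bij_inv s z) => [i|j']; first by rewrite sE ub_outK.
move=> wj'; exists j'; split=> //; apply/eqP => jj; rewrite jj in wj'.
exact: ub_neq wj'.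
Qed.

(** Parity: a diagram d -> d + 1 would leave a single output to be paired with
    itself. *)
Lemma ubrauer_factor d q : ubrauer d q -> ubrauer q (d + 2) -> d = q \/ q = (d + 2)%N.
Proof.
move=> v /ub_leq; rewrite leq_eqVlt => /orP[/eqP|]; first by right.
rewrite addn2 ltnS; have := ub_leq v; rewrite leq_eqVlt => /orP[/eqP|dq]; first by left.
move=> qd; have e : q = (d + 1)%N by apply/eqP; rewrite eqn_leq addn1 qd.
subst q; have [s [_ /(_ ord0)[j' [] ]]] := ub_normal v.
by rewrite [j']ord1.
Qed.

Definition ub_cup : ubrauer 0 2.
Proof.
refine (@mk_ub 0 2 (fun x => match x with inl i => inl i | inr j => inr (rev_ord j) end) _ _ _).
- by move=> [i|j] //=; rewrite rev_ordK.
- by move=> [[]//|[[|[|//]] ?]] [].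
- by case.
Defined.

Lemma ub_cupE j : ub_cup (inr j) = inr (rev_ord j).
Proof. exact: mk_ubE. Qed.

Lemma ub_cup_swap : ub_comp (ub_bij (swap 1 1)) ub_cup = ub_cup.
Proof.
apply: ubP; apply: (ub_bij_ind (f := swap 1 1)) => -[[]//|i].
rewrite ub_comp_lift ub_cupE /= !ub_bij_out ub_cupE; congr inr.
have [r0 r1] : rev_ord i0 = i1 /\ rev_ord i1 = i0 by split; apply/val_inj.
have [s0 s1] : swap 1 1 i0 = i1 /\ swap 1 1 i1 = i0 by split; [exact: swapl | exact: swapr].
by move: i; apply: ord2_ind; rewrite ?(r0, r1, s0, s1).
Qed.

Section Casimir.
Variables (k : fieldType) (d : nat).
Local Notation delta := (fdelta k).

(** The block transposition is used because the source of 1 + c would be d +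
    0, which does not reduce to d, whereas that of c + 1 is 0 + d. *)
Definition tens_cas (Q : lprop k) (c : hom Q 0 2) : hom Q d (d + 2) :=
  hcomp (hbij Q (swap 2 d)) (htens c (hid Q d)).

Lemma tens_cas_sym (Q : lprop k) (c : hom Q 0 2) (j : bij_pair d) :
  hcomp (hbij Q (swap 1 1)) c = c ->
  hcomp (tens_cas c) (hbij Q (cas_in j))
  = cas_sgn k j *: hcomp (hbij Q (cas_out j)) (tens_cas c).
Proof.
move=> cs; rewrite /cas_sgn scale1r /tens_cas hcompA -hbij_comp.
have -> : cas_out j ** swap 2 d = swap 2 d ** bij_sum j.2 j.1 :> bij (2 + d) (d + 2).
  by apply: bijP; apply: ord_splitP => i;
    rewrite !(bij_compE, swapl, swapr, bij_suml, bij_sumr).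
rewrite hbij_comp -!hcompA; congr (hcomp _ _).
have cj : hcomp (hbij Q j.2) c = c.
  by have [->|->] := bij2P j.2; rewrite ?hcomp1l.
have R : hcomp (htens (hbij Q j.2) (hbij Q j.1)) (htens c (hid Q d)) = htens c (hbij Q j.1).
  by rewrite -hinterchange cj hcomp1r.
have L : hcomp (htens c (hid Q d)) (htens (hid Q 0) (hbij Q j.1)) = htens c (hbij Q j.1).
  by rewrite -hinterchange hcomp1r hcomp1l.
rewrite htens0l in L; rewrite hbij_sum; exact: etrans L (esym R).
Qed.

Definition ub_tens_cup : ubrauer d (d + 2) :=
  ub_comp (ub_bij (swap 2 d)) (ub_tens ub_cup (ub_bij (bij1 d))).

Lemma ub_tens_cup_out i : ub_out ub_tens_cup i = lshift 2 i.
Proof.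
have e : i = rshift 0 i :> 'I_(0 + d) by apply/val_inj.
have out2 : ub_out (ub_tens ub_cup (ub_bij (bij1 d))) i = rshift 2 i.
  rewrite [in LHS]e; apply: etrans (ub_tens_outR ub_cup _ i) _.
  by rewrite ub_bij_out bij1E.
rewrite /ub_tens_cup ub_comp_out out2 ub_bij_out.
exact: (@swapr 2 d).
Qed.

Lemma ub_tens_cup_top b : ub_tens_cup (inr (rshift d b)) = inr (rshift d (rev_ord b)).
Proof.
have e (c : 'I_2) : ub_lift (m := 0 + d) (ub_bij (swap 2 d)) (inr (lshift d c)) = inr (rshift d c).
  by rewrite /= ub_bij_out swapl.
rewrite -!e /ub_tens_cup ub_comp_lift (ub_tensL ub_cup (ub_bij (bij1 d)) (inr b)).
by rewrite ub_cupE.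
Qed.

(** Over d inputs there are two outputs left, and they can only be joined to
    each other. *)
Lemma ub_tens_cupP (w : ubrauer d (d + 2)) :
  exists s, w = ub_comp (ub_bij s) ub_tens_cup.
Proof.
have [s [sl sr]] := ub_normal w; exists s; apply: ubP; apply: (ub_bij_ind (f := s)) => -[i|x].
  by rewrite ub_comp_lift /= !ub_outE ub_tens_cup_out /= ub_bij_out sl.
rewrite ub_comp_lift /= ub_bij_out; move: x; apply: ord_splitP => i.
  by rewrite -[in RHS]ub_tens_cup_out sl !ub_outK.
have [j' [jn ->]] := sr i; rewrite ub_tens_cup_top /= ub_bij_out.
congr (inr (s (rshift d _))).
by move: jn; move: i j'; apply: ord2_ind; apply: ord2_ind => // _; apply/val_inj.
Qed.

Local Notation LU := (uB k).
Local Notation w0 := ub_tens_cup.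

Lemma tens_cas_delta :
  tens_cas (delta ub_cup : hom LU 0 2) = (delta w0 : hom LU d (d + 2)).
Proof.
have T : htens (delta ub_cup : hom LU 0 2) (hid LU d) = delta (ub_tens ub_cup (ub_bij (bij1 d))).
  exact: (linearizeT k (W := ubrauer_prop) ub_cup (ub_bij (bij1 d))).
rewrite /tens_cas T.
exact: (linearizeM k (W := ubrauer_prop) (ub_bij (swap 2 d)) (ub_tens ub_cup (ub_bij (bij1 d)))).
Qed.

Lemma ub_cup_sym : hcomp (hbij LU (swap 1 1)) (delta ub_cup : hom LU 0 2) = delta ub_cup.
Proof.
apply: etrans (linearizeM k (W := ubrauer_prop) (ub_bij (swap 1 1)) ub_cup) _.
by congr (delta _); exact: ub_cup_swap.
Qed.

Lemma fdelta_inj (A : finType) : injective (@fdelta k A).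
Proof.
move=> a b /(congr1 (fun f : {ffun A -> k^o} => f a)); rewrite !ffunE eqxx.
by case: eqP => // _ /eqP; rewrite oner_eq0.
Qed.

(** The outputs on through strands determine s on the first summand, up to t,
    and the two remaining outputs can be exchanged freely. *)
Lemma ub_stab (s : bij (d + 2) (d + 2)) (t : bij d d) :
  ub_comp (ub_bij s) (ub_comp w0 (ub_bij t)) = w0
  <-> exists j, s = cas_out j /\ t = bij_inv (cas_in j).
Proof.
split=> [e|[j [-> ->]]]; last first.
  have : ub_comp w0 (ub_bij (cas_in j)) = ub_comp (ub_bij (cas_out j)) w0.
    apply: fdelta_inj; have := tens_cas_sym j ub_cup_sym.
    rewrite /cas_sgn scale1r tens_cas_delta.
    rewrite [LHS](linearizeM k (W := ubrauer_prop) w0 (ub_bij _)).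
    by rewrite [RHS](linearizeM k (W := ubrauer_prop) (ub_bij _) w0).
  rewrite ub_compA => <-.
  by rewrite -ub_compA -ub_bij_comp bij_compVr ub_comp1r.
have sl i : s (lshift 2 (t i)) = lshift 2 i.
  by rewrite -!ub_tens_cup_out -[in RHS]e !ub_comp_out !ub_bij_out.
have [|u [v sE]] := @bij_splitl d 2 s.
  by move=> i; exists (bij_inv t i); rewrite -(bijVK t i) sl bijKV.
have -> : t = bij_inv u.
  rewrite -[t]bij_invK; congr bij_inv; apply/esym/bij_inv_uniql/bijP => i.
  by apply: (@lshift_inj d 2); rewrite bij_compE bij1E -(bij_suml _ v) -sE sl.
by exists (u, v).
Qed.

Lemma ub_coef (U : lmodType k) (F : bij (d + 2) (d + 2) -> bij d d -> U) :
  \sum_s \sum_t wcoef (w0 : fp_hom ubrauer_prop _ _) (delta w0 : hom LU _ _) s t *: F s t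
  = \sum_(j : bij_pair d) cas_sgn k j *: F (cas_out j) (bij_inv (cas_in j)).
Proof.
have cE s t : wcoef (w0 : fp_hom ubrauer_prop _ _) (delta w0 : hom LU _ _) s t
    = (ub_comp (ub_bij s) (ub_comp w0 (ub_bij t)) == w0)%:R.
  by rewrite /wcoef !ffunE.
under eq_bigr => s _ do under eq_bigr => t _ do rewrite cE.
pose g (j : bij_pair d) := (cas_out j, bij_inv (cas_in j)).
have gi : injective g.
  move=> [a b] [a' b'] /(congr1 fst)/=; rewrite /cas_out /= => e; congr pair; apply: bijP => i.
    by apply: (@lshift_inj d 2); rewrite -!(bij_suml _ b) e !bij_suml.
  by apply: (@rshift_inj d 2); rewrite -!(bij_sumr a) e !bij_sumr.
rewrite [LHS](sum_delta_param (P := fun s t => ub_comp (ub_bij s) (ub_comp w0 (ub_bij t)) == w0) F gi).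
  by apply: eq_bigr => j _; rewrite scale1r.
move=> s t; split=> [/eqP/ub_stab[j [-> ->]]|[j [es et]]]; first by exists j.
by apply/eqP/ub_stab; exists j.
Qed.

Lemma heq_comp_bij (Q : lprop k) m m' n (x : hom Q m' n) (f : bij m m') :
  (forall i, f i = i :> nat) ->
  heq (H := fun m n => GRing.Lmodule.sort (hom Q m n)) x (hcomp x (hbij Q f)).
Proof.
have e := bij_dim f; move: x f; rewrite -e => x f fi.
have -> : f = bij1 m by apply: bijP => i; apply/val_inj; rewrite bij1E; exact: fi.
by rewrite hcomp1r; exact: heq_refl.
Qed.

Lemma tens_cas_heq (Q : lprop k) (c : hom Q 0 2) :
  heq (H := fun m n => GRing.Lmodule.sort (hom Q m n)) (tens_cas c) (htens (hid Q d) c).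
Proof.
rewrite /tens_cas hbij_swap; apply/heq_sym/heq_comp_bij => i.
have -> : i = rshift 0 i :> 'I_(0 + d) by apply/val_inj.
exact: (congr1 (@nat_of_ord _) (@swapr 0 d i)).
Qed.

End Casimir.

Section CasimirExt.
Variable k : fieldType.
Local Notation delta := (fdelta k).

Definition liec_ub_val (g : gen liec_sig) : hom (uB k) (gdom g) (gcod g) :=
  match g return hom (uB k) (@gdom liec_sig g) (@gcod liec_sig g) with
  | LieCBr => 0
  | LieCCas => delta ub_cup
  end.

Lemma liec_ub_respects : respects (@liec_rel k) liec_ub_val.
Proof.
move=> m n t u [[] | []].
- exact: etrans (hcomp0l _ _) (esym (scaler0 _ _)).
- exact: etrans (congr1 (fun x => hcomp x _) (hcomp0l _ _)) (hcomp0l _ _).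
- exact: ub_cup_sym.
- pose e := teval liec_ub_val.
  have e1 : e _ _ (ttens (liec_br k) (tid 1)) = 0 by exact: htens_0l.
  have e2 : e _ _ (ttens (tid 1) (liec_br k)) = 0 by exact: htens_0r.
  have e3 : hcomp (e _ _ (ttens (liec_br k) (tid 1)))
      (e _ _ (ttens (tid 1) (liec_cas k))) = 0 by rewrite e1; exact: hcomp0l.
  have e4 : hcomp (e _ _ (ttens (tid 1) (liec_br k)))
      (e _ _ (ttens (liec_cas k) (tid 1))) = 0 by rewrite e2; exact: hcomp0l.
  exact: etrans e3 (esym e4).
Qed.

Definition liec_ub : lprop_mor (CLieC k) (uB k) := presented_mor liec_ub_respects.

Lemma liec_ub_sym p q (x : hom (CLieC k) p q) :
  pmap (lie_to_sym k) (pmap (liec_to_lie k) x) = to_sym (pmap liec_ub x).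
Proof.
apply: (presented_ext (F := lprop_comp (lie_to_sym k) (liec_to_lie k))
  (F' := lprop_comp (sym_mor k ubrauer_mono) liec_ub)).
by case; apply: kSym_neq.
Qed.

Definition liec_cas0 d : hom (CLieC k) d (d + 2) :=
  tens_cas d (generator (@liec_rel k) LieCCas).

Lemma liec_ub_cas0 d : pmap liec_ub (liec_cas0 d) = (delta (ub_tens_cup d) : hom (uB k) _ _).
Proof.
rewrite /liec_cas0 -tens_cas_delta /tens_cas (pmap_comp liec_ub) (pmap_bij liec_ub).
congr (hcomp _ _); apply: etrans (pmap_tens liec_ub (generator (@liec_rel k) LieCCas) (hid (CLieC k) d)) _.
rewrite /hid (pmap_bij liec_ub); congr (htens _ _).
exact: (pr_mapE (@liec_ub_respects) (liec_cas k)).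
Qed.

Lemma liec_cas_sym : hcomp (hbij (CLieC k) (swap 1 1))
    (generator (@liec_rel k) LieCCas : hom (CLieC k) 0 2)
  = generator (@liec_rel k) LieCCas.
Proof.
apply: etrans (pr_compE _ (tbij (swap 1 1)) (liec_cas k)) _.
exact/tclassP/teq_rel/liec_casimir/casimir_sym.
Qed.

Lemma cas0_gen d m n (y : hom (CLieC k) m n) : is_gen y -> m = d -> n = (d + 2)%N ->
  heq (H := fun m n => GRing.Lmodule.sort (hom (CLieC k) m n)) (liec_cas0 d) y.
Proof.
move=> [[] [e gy]]; case: gy => md nd.
  by exfalso; move: nd; rewrite -md -addnA => /addnI.
have ed : e = d by rewrite -md addn0.
subst e; exact: tens_cas_heq.
Qed.

Variables (la mu : seq nat).
Hypotheses (char0 : [pchar k] =i pred0) (part_la : is_partition la) (part_mu : is_partition mu).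
Hypothesis mu_la : sumn mu = (sumn la + 2)%N.
Local Notation d := (sumn la).

Lemma Ext1_casimir :
  Ext1_iso (T_functor (SpechtLie k la)) (T_functor (SpechtLie k mu))
    (bitens (uB k) (Specht k mu) (Specht k la) (d + 2) d)
  /\ Ext1_dim (T_functor (SpechtLie k la)) (T_functor (SpechtLie k mu))
    (LR k mu la [:: 2])%N.
Proof.
have pq : d != (d + 2)%N by rewrite -{1}[d]addn0 eqn_add2l.
have C (V : lprop k) (F : lprop_mor V (uB k)) (b : hom V d (d + 2)) :
    pmap F b = (delta (ub_tens_cup d) : hom (uB k) _ _) ->
    forall (U : lmodType k) (G : bij (d + 2) (d + 2) -> bij d d -> U),
    \sum_s \sum_t wcoef (ub_tens_cup d : fp_hom ubrauer_prop _ _) (pmap F b) s t *: G s t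
    = \sum_(j : bij_pair d) cas_sgn k j *: G (cas_out j) (bij_inv (cas_in j)).
  by move=> -> U G; exact: ub_coef.
have E := Ext1_kernels char0 part_la part_mu ubrauer_mono liec_ub_sym
  (w0 := ub_tens_cup d : fp_hom ubrauer_prop _ _) (y0 := liec_cas0 d) erefl mu_la pq
  (@ubrauer_factor d) (@cas0_gen d) (card_pair_gt0 d)
  (C _ _ _ (liec_ub_cas0 d)) (fun j => tens_cas_sym j liec_cas_sym).
pose inv2 (j : bij_pair d) : bij_pair d := (bij_inv j.1, bij_inv j.2).
pose idm := @LPropMor k (uB k) (uB k) (fun m n x => x) (fun m n a x y => erefl)
  (fun m n p g f => erefl) (fun m n m' n' f g => erefl) (fun m n f => erefl).
have T := bitens_kernels char0 part_la part_mu (hinv := inv2) (sg := @cas_out d) (ta := @cas_in d)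
  (ch := cas_sgn k (d := d)) (F := idm)
  (w0 := ub_tens_cup d : fp_hom ubrauer_prop _ _) (x0 := delta (ub_tens_cup d) : hom (uB k) _ _).
have sym (j : bij_pair d) := tens_cas_sym j (ub_cup_sym k).
rewrite tens_cas_delta in sym.
have {}T : lin_iso _ _ := T _ _ _ _ (@cas_sgn_sq k d) (card_pair_gt0 d)
  (C _ idm _ erefl) sym _.
have yt : ysym_or_star (ysym k la) by left.
have yt' : ysym_or_star (kstar (ysym k la)) by right.
split; apply: (Ext1_iso_trans E); last first.
  by apply: vect_row_iso; rewrite -[RHS](cas_dim char0 part_la part_mu yt').
apply: lin_iso_trans (lin_iso_sym (T _ _ _ _ _)).
- by apply: subvs_iso; rewrite !cas_dim.
- by move=> [a b]; rewrite /inv2 /= !bij_invK.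
- by move=> [a b]; rewrite /cas_out bij_inv_sum.
- by move=> [a b].
- by [].
- move=> U f g lf lg fg; apply: fspan_ext => // w; have [s ->] := ub_tens_cupP w.
  have := fg s (bij1 d); rewrite (hcomp1r (l := uB k)).
  by rewrite (linearizeM k (W := ubrauer_prop) (ub_bij s) (ub_tens_cup d)).
Qed.

End CasimirExt.

(** * The remaining cases *)

Section Vanishing.
Variables (k : fieldType) (char0 : [pchar k] =i pred0) (la mu : seq nat).
Local Notation A := (T_functor (SpechtLie k la)).
Local Notation B := (T_functor (SpechtLie k mu)).
Local Notation N := (sumn la).
Local Notation M := (sumn mu).
Local Notation P := (CLieC k).

Lemma specht0l p (a : cobj A p) : p != N -> a = 0.
Proof. by move=> pN; apply: (sp0 (la := la)); rewrite eq_sym. Qed.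

Lemma specht0r p (b : cobj B p) : p != M -> b = 0.
Proof. by move=> pM; apply: (sp0 (la := mu)); rewrite eq_sym. Qed.

(** The map h of which D is, on permutations, the inner derivation: the
    average of g^-1 D(g) over the bijections g. *)
Definition average (D : derivation A B) p (a : cobj A p) : cobj B p :=
  #|{: bij N N}|%:R^-1 *:
    \sum_(g : bij p N) cact (hbij P (bij_inv g)) (der D (hbij P g) a).

Lemma average_lin (D : derivation A B) p : linear (@average D p).
Proof.
apply: (linear_cmp (f := fun v : cobj B p => #|{: bij N N}|%:R^-1 *: v)) => [a u v|].
  by rewrite scalerDr !scalerA mulrC.
by apply: linear_sum_fun => g; exact: linear_cmp (cact_linr _) (der_linr _ _).
Qed.

Lemma average_bij (D : derivation A B) p q (f : bij p q) a :
  der D (hbij P f) a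
  = cact (hbij P f) (average D a) - average D (cact (hbij P f) a).
Proof.
have [pN|np] := eqVneq p N; last first.
  rewrite (specht0l a np) (linear_fun0 (der_linr D _)) (linear_fun0 (cact_linr _)).
  by rewrite !(linear_fun0 (@average_lin _ _)) (linear_fun0 (cact_linr _)) subrr.
rewrite /average (linear_funZ (cact_linr _)) -scalerBr (linear_fun_sum _ _ _ (cact_linr _)).
rewrite (sum_bijr f) -sumrB.
rewrite (eq_bigr (fun=> der D (hbij P f) a)) => [|g _]; last first.
  have e := der_comp D (hbij P g) (hbij P f) a; rewrite -hbij_comp in e.
  rewrite e !(linear_funD (cact_linr _)) -!cact_comp -!hbij_comp bij_inv_comp bij_compKVl bij_compVl.
  by rewrite cact_id addrK.
have cN : #|{: bij q N}| = #|{: bij N N}| by rewrite -(bij_dim f) pN.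
rewrite sumr_const -scaler_nat scalerA cN mulVf ?scale1r // natr_neq0 //.
by apply/card_gt0P; exists (bij1 N).
Qed.

Hypothesis not_bracket : M.+1 = N -> M = 0%N.
Hypothesis not_casimir : M <> N.+2.

(** The averaged h handles permutations.  On a generator both sides vanish,
    because its source and target are never at once the objects of la and of
    mu; the hypothesis on the bracket admits m = 0 and n = 1, as no generator
    goes from 1 to 0. *)
Lemma all_inner (D : derivation A B) : inner D.
Proof.
exists (average D); split=> [p|]; first exact: average_lin.
apply: inner_generated => [p|p q f a|p q y gy a]; first exact: average_lin.
  exact: average_bij.
have [pN|pN] := eqVneq p N; last first.
  rewrite (specht0l a pN) (linear_fun0 (der_linr D _)) (linear_fun0 (cact_linr _)).
  by rewrite !(linear_fun0 (@average_lin _ _)) (linear_fun0 (cact_linr _)) subrr.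
have [qM|qM] := eqVneq q M; last exact: etrans (specht0r _ qM) (esym (specht0r _ qM)).
case: gy => [[] [e gy]]; exfalso; case: gy in pN qM => {q y a p}.
  move: not_bracket; rewrite -pN -qM addn2 addn1.
  by move/(_ erefl).
by apply: not_casimir; rewrite -pN -qM addn0 addn2.
Qed.

Lemma Ext1_zero (V : lmodType k) : (forall v : V, v = 0) -> Ext1_iso A B V.
Proof.
move=> V0; apply: (Ext1_classification (@specht_section k la) (L := fun=> 0)).
- by move=> c D D'; rewrite scaler0 addr0.
- by move=> D; split=> // _; exact: all_inner.
- move=> v; rewrite [v]V0; unshelve eexists => //.
  refine (@Derivation k P A B (fun _ _ _ _ => 0) _ _ _).
  + by move=> p q a c u v0; rewrite scaler0 addr0.
  + by move=> p q a c u v0; rewrite scaler0 addr0.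
  + by move=> p q r g f a; rewrite (linear_fun0 (cact_linr g)) addr0.
Qed.
End Vanishing.

Lemma bitens0 (k : fieldType) (P : lprop k) (M N : cmod (kSym k)) m n :
  (forall x : hom P n m, x = 0) -> forall v : bitens P M N m n, v = 0.
Proof.
move=> x0; apply: (@tens3_ext k _ _ _ _ _ id (fun=> 0)) => [//||u x w].
  by move=> a u v; rewrite scaler0 addr0.
by rewrite [x]x0; exact: (linear_fun0 (pure3_lin2 _ _ _)).
Qed.

Lemma fsbig_parts (F : seq nat -> nat) d :
  \big[addn/0%N]_(rho \in [set l | is_partition l /\ (sumn l + 2)%N = (d + 2)%N]) F rho
  = (\sum_(rho <- parts d) F rho)%N.
Proof.
rewrite (fsbig_seq _ _ (parts_uniq d)); apply: eq_fsbigl; apply/seteqP.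
split=> l /=; rewrite mem_parts; first by move=> [-> /addIn->] /=.
by move=> /andP[-> /eqP->].
Qed.

Lemma fsbig_parts0 (F : seq nat -> nat) :
  \big[addn/0%N]_(rho \in [set l | is_partition l /\ (sumn l + 2)%N = 1%N]) F rho = 0%N.
Proof.
rewrite (_ : [set l | _]%classic = classical_sets.set0) ?fsbig_set0 //; apply/seteqP; split=> l //=.
by rewrite addn2 => -[].
Qed.

Unset Implicit Arguments.
Local Open Scope classical_set_scope.
Local Open Scope ring_scope.

Theorem theorem1p2 (k : fieldType) (char0 : [pchar k] =i pred0)
    (la mu : seq nat) (part_la : is_partition la) (part_mu : is_partition mu) :
  let n := sumn la in
  let m := sumn mu in
  let A := T_functor (SpechtLie k la) in
  let B := T_functor (SpechtLie k mu) in
  Ext1_iso A B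
    (if m.+1 == n then bitens (CLie k) (Specht k mu) (Specht k la) m n
     else if m == n.+2 then bitens (uB k) (Specht k mu) (Specht k la) m n
     else 'rV[k]_0)
  /\
  Ext1_dim A B
    (if m.+1 == n then
       \big[addn/0%N]_(rho \in [set l | is_partition l /\ (sumn l + 2)%N = n])
         (LR k la rho [:: 1; 1]%N * LR k mu rho [:: 1]%N)%N
     else if m == n.+2 then LR k mu la [:: 2]%N
     else 0%N).
Proof.
move=> n m A B.
have rV0 (v : 'rV[k]_0) : v = 0 by apply/rowP => -[].
case: eqP => [mn|mn]; last case: eqP => [mn2|mn2].
- case: (posnP m) => [m0|m0].
    (* C_Lie has no nonzero morphism 1 -> 0, and n - 2 is negative. *)
    have n1 : n = 1%N by rewrite -mn m0.
    have zero (V : lmodType k) : (forall v : V, v = 0) -> Ext1_iso A B V.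
      by apply: Ext1_zero => // ; rewrite -/m m0.
    rewrite /Ext1_dim n1 fsbig_parts0; split; apply: zero => //.
    by rewrite m0; apply: bitens0 => x; have [_ + _ _] := lie_spanP x; exact.
  have md : m = (m.-1 + 1)%N by rewrite addn1 prednK.
  have nd : n = (m.-1 + 2)%N by rewrite -mn addn2 prednK.
  have := Ext1_bracket char0 part_la part_mu nd md.
  by rewrite -fsbig_parts -nd -md.
- have md : m = (n + 2)%N by rewrite addn2.
  by have := Ext1_casimir char0 part_la part_mu md; rewrite -md.
- have zero (V : lmodType k) : (forall v : V, v = 0) -> Ext1_iso A B V.
    by apply: Ext1_zero.
  by split; apply: zero.
Qed.
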